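(* Let $Q_\infty=\Phi((T_\infty,\ell),\eta)$, where $((T_\infty,\ell),\eta)$ has law $\mu\otimes\mathcal B(1/2)$, and let $(\mathcal X_n)_{n\ge0}$ be the simple random walk on $Q_\infty$. Then almost surely the integer-valued process $(\ell(\mathcal X_n))_{n\ge0}$ is recurrent, i.e. it visits every integer infinitely often.
   Context: **The law $\mu$.** $\rho_l$ is the law of a Galton–Watson plane tree with offspring law $P(k)=2^{-k-1}$, root label $l$, and each non-root vertex labeled by its parent's label plus an independent uniform element of $\{-1,0,1\}$. $\mu$ is the law of $(T_\infty,\ell)$, which has a spine $\varnothing=S(0),S(1),\dots$ whose labels $X_n$ form a random walk from 0 with i.i.d. uniform steps in $\{-1,0,1\}$. Conditionally on $(X_n)$, independent trees with law $\rho_{X_n}$ are grafted to the left and to the right of each $S(n)$. **The Schaeffer map $\Phi$.** Corners are indexed by $\mathbb Z$: $c_0,c_1,\dots$ are the left-side corners in clockwise contour order from the root corner $c_0$, and negative indices are the right-side corners in counterclockwise order. The successor of $c_i$ is the first $c_j$, $j>i$, with label $\ell(c_i)-1$. $\Phi$ produces the quadrangulation on $V(T_\infty)$ made of arcs from corners to successors. It is rooted at the oriented edge $e^*$, the arc from $c_0$ to its successor, with orientation reversed iff $\eta=1$. Vertices of $Q_\infty$ carry the labels $\ell$. **Simple random walk.** Conditionally on $Q_\infty$, define oriented edges as follows: $E_0=e^*$, and $E_{j+1}$ is chosen uniformly among the oriented edges whose origin is the target $(E_j)_+$ of $E_j$. Then $\mathcal X_k$ is the origin of $E_k$. *)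

(* Defs.v *)
From HB Require Import structures.
From mathcomp Require Import all_boot all_order all_algebra.
From mathcomp Require Import all_classical all_reals all_analysis.
Set Implicit Arguments. Unset Strict Implicit. Unset Printing Implicit Defensive.
Import Order.TTheory GRing.Theory Num.Theory.
Local Open Scope ring_scope.

Inductive ltree : Type := LNode of int & seq ltree.

Definition root_label (t : ltree) : int := let: LNode l _ := t in l.

(* rho_l({t}) : probability of the labelled tree t under rho_l :
   Galton-Watson with offspring law P(k) = 2^{-k-1} (each vertex with k
   children contributes 2^{-k-1}), root label l, and each non-root vertex
   having label = parent's label + uniform element of {-1,0,1}
   (factor 1/3 if the increment is in {-1,0,1}, 0 otherwise). *)
Definition incr_w (R : realType) (l l' : int) : R :=
  if (`|l' - l| <= 1)%R then 3%:R^-1 else 0.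

Fixpoint rho_w (R : realType) (t : ltree) : R :=
  match t with
  | LNode l ts =>
      (2%:R ^- (size ts).+1) *
      (fix aux (us : seq ltree) : R :=
         match us with
         | [::] => 1
         | u :: us' => incr_w R l (root_label u) * rho_w R u * aux us'
         end) ts
  end.

Definition rho (R : realType) (l : int) (t : ltree) : R :=
  if root_label t == l then rho_w R t else 0.

(* Contour sequence of a plane tree: the successive corners visited,
   each given as (address of the vertex in Ulam-Harris notation, label).
   A tree with k edges has 2k+1 entries; the root appears at the start,
   between consecutive subtrees and at the end. *)
Fixpoint contour (t : ltree) : seq (seq nat * int) :=
  match t with
  | LNode l ts =>
      ([::], l) ::
      (fix aux (k : nat) (us : seq ltree) : seq (seq nat * int) :=
         match us with
         | [::] => [::]
         | u :: us' =>
             [seq (k :: p.1, p.2) | p <- contour u] ++ ([::], l) :: aux k.+1 us'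
         end) 0%N ts
  end.

(* i-th element (and index of its block) of the infinite concatenation
   f 0 ++ f 1 ++ f 2 ++ ... (fuel argument; fuel i.+2 suffices as soon as all
   blocks but possibly block 0 are non-empty). *)
Fixpoint catnth (A : Type) (f : nat -> seq A) (a0 : A) (fuel n i : nat) : nat * A :=
  match fuel with
  | 0 => (n, a0)
  | fuel'.+1 =>
      if (i < size (f n))%N then (n, nth a0 (f n) i)
      else catnth f a0 fuel' n.+1 (i - size (f n))
  end.

(* Vertices of T_infty: (n, side, address) = the vertex with the given
   address in the tree grafted on side `side` (false = left, true = right)
   of the spine vertex S(n); the spine vertex S(n) itself is (n, false, [::]). *)
Definition vertex := (nat * bool * seq nat)%type.

(* Blocks of corners.  Left side (c_0, c_1, ...): contour of L_0, then of
   L_1, ...  Right side (c_{-1}, c_{-2}, ...): contour of R_0 without its first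
   corner (the root corner c_0 of S(0) already counted), then of R_1, ... *)
Definition lblocks (L : nat -> ltree) (n : nat) := contour (L n).
Definition rblocks (Rt : nat -> ltree) (n : nat) :=
  if n == 0%N then behead (contour (Rt 0%N)) else contour (Rt n).

Definition corner (L Rt : nat -> ltree) (i : int) : vertex * int :=
  match i with
  | Posz k => let: (n, (a, lb)) := catnth (lblocks L) ([::], 0) k.+2 0 k in
              ((n, false, a), lb)
  | Negz k => let: (n, (a, lb)) := catnth (rblocks Rt) ([::], 0) k.+2 0 k in
              ((n, a != [::], a), lb)
  end.

Definition cvert L Rt i := (corner L Rt i).1.
Definition clab L Rt i := (corner L Rt i).2.

Definition is_succ (L Rt : nat -> ltree) (i j : int) : Prop :=
  (i < j)%R /\ clab L Rt j = clab L Rt i - 1 /\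
  forall k : int, (i < k)%R -> (k < j)%R -> clab L Rt k <> clab L Rt i - 1.

(* Oriented edges of Q_infty: (i, false) is the arc from c_i to its
   successor, (i, true) the same arc reversed.  The arc exists iff c_i has a
   successor. *)
Definition oedge := (int * bool)%type.

Definition org (L Rt : nat -> ltree) (e : oedge) (v : vertex) : Prop :=
  let: (i, b) := e in
  if b then exists j, is_succ L Rt i j /\ cvert L Rt j = v
  else (exists j, is_succ L Rt i j) /\ cvert L Rt i = v.

Definition tgt (L Rt : nat -> ltree) (e : oedge) (v : vertex) : Prop :=
  let: (i, b) := e in
  if b then (exists j, is_succ L Rt i j) /\ cvert L Rt i = v
  else exists j, is_succ L Rt i j /\ cvert L Rt j = v.

Definition olab (L Rt : nat -> ltree) (e : oedge) : int :=
  if e.2 then clab L Rt e.1 - 1 else clab L Rt e.1.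

Definition step_w (R : realType) (x y : int) : R :=
  if (`|y - x| <= 1)%R then 3%:R^-1 else 0.

Definition env_cyl (Omega : Type) (X : nat -> Omega -> int)
  (L Rt : nat -> Omega -> ltree) (eta : Omega -> bool)
  (N : nat) (xs : nat -> int) (ls rs : nat -> ltree) (b : bool) : set Omega :=
  [set w | (forall n, (n <= N)%N -> X n w = xs n /\ L n w = ls n /\ Rt n w = rs n)
           /\ eta w = b].

Definition env_cyl_prob (R : realType) (N : nat) (xs : nat -> int)
  (ls rs : nat -> ltree) : R :=
  2%:R^-1 * (if xs 0%N == 0 then 1 else 0) *
  (\prod_(n < N) step_w R (xs n) (xs n.+1)) *
  (\prod_(n < N.+1) (rho R (xs n) (ls n) * rho R (xs n) (rs n))).

(* Main.v *)
Require Import Defs.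
From HB Require Import structures.
From mathcomp Require Import all_boot all_order all_algebra.
From mathcomp Require Import zify ring lra finmap.
From mathcomp Require Import all_classical all_reals all_analysis.
From mathcomp Require Import measurable_realfun.
Import Order.TTheory GRing.Theory Num.Theory.
Import numFieldNormedType.Exports.
Set Implicit Arguments. Unset Strict Implicit. Unset Printing Implicit Defensive.
Local Open Scope ring_scope.

(* The law of the labelled tree is invariant under re-rooting at the next
   corner c_1: up to a shift of the labels, a cylinder is pulled back to a
   cylinder of the same weight. Summing over the corners gives a mass transport
   principle, hence the walk on oriented edges started from e^* is stationary
   and reversible. Its labels move by +1 or -1 according to the orientation of
   the edge crossed; let S_n be the label increment up to time n.

   Let g_n(m), goo(m) and h be the quenched probabilities, as functions of the
   starting edge, that S <= m up to time n, that S <= m forever, and that S is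
   bounded above. Stationarity and h = Qh give E[Q(h^2) - h^2] = 0, so h is
   constant on almost every (connected) map. Reversing time,
   E[h; S_n < -x] = E[h; S_n > x] <= E[h - goo(x)], which is small for large x
   uniformly in n. When S stays <= m and S_n >= -x, the probability of staying
   <= m forever from time n on is at most goo(x+m) < 1 at the current edge; but
   g_n(m) - goo(m) -> 0 says that this probability is close to 1 for most paths
   that stayed <= m up to time n. Hence E[h goo(m)] = 0 and h = 0: sup S is
   infinite. The same argument applies to -S, and steps +1 and -1 do the rest. *)

(** * Plane trees and their contours *)

(** The bound goo < 1 is established only pointwise, without a uniform gap. Powers replace the gap:
    1 - goo^k <= k (1 - goo), and E[goo^k] tends to 0 by dominated convergence. This dictates the
    order of limits: for fixed k the error k E[h (g_n - goo)] vanishes as n grows, while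
    stationarity makes E[goo^k], taken at the edge reached at time n, independent of n. No moment
    estimate on S_n enters. Weighting by h acts as a substitute for tightness: h is constant along
    the path, which controls the upper tail of h-weighted S_n uniformly in n, and reversal carries
    the control to the lower tail. Corners are indexed by the integers with one arc per corner, so
    the shift by one corner generates all changes of root. Invariance is an equality of measures and
    can be read in both directions; no inverse of the re-rooting map is built. Until the last part
    everything concerns functions of a configuration and an edge. The walk itself enters through a
    single inequality, which suffices because its right-hand side tends to 0. *)

Definition children (t : ltree) : seq ltree := let: LNode _ ts := t in ts.

Fixpoint shl (c : int) (t : ltree) : ltree :=
  let: LNode l ts := t in LNode (l + c) (map (shl c) ts).

(** The hypothesis on the children is a [foldr] conjunction because [ltree] carries no equality
    structure yet, hence no membership in [ts]. *)
Lemma ltree_nested_ind (Q : ltree -> Prop) :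
  (forall l ts, foldr (fun u P => Q u /\ P) True ts -> Q (LNode l ts)) ->
  forall t, Q t.
Proof.
move=> H; fix IH 1 => -[l ts]; apply: H.
by elim: ts => //= u us IHus; split.
Qed.

Fixpoint contours (l : int) (k : nat) (us : seq ltree) : seq (seq nat * int) :=
  if us is u :: us' then
    [seq (k :: p.1, p.2) | p <- contour u] ++ ([::], l) :: contours l k.+1 us'
  else [::].

Lemma contourE l ts : contour (LNode l ts) = ([::], l) :: contours l 0 ts.
Proof.
rewrite /=; congr (_ :: _).
by elim: ts 0%N => //= u us IH k; rewrite IH.
Qed.

Lemma root_shl c t : root_label (shl c t) = root_label t + c.
Proof. by case: t. Qed.

Lemma ltreeE t : t = LNode (root_label t) (children t).
Proof. by case: t. Qed.

Lemma shlK c : cancel (shl c) (shl (- c)).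
Proof.
elim/ltree_nested_ind => l ts IH /=; rewrite addrK; congr LNode.
by elim: ts IH => //= u us IHus [-> /IHus ->].
Qed.

Lemma shlNK c : cancel (shl (- c)) (shl c).
Proof. by move=> t; rewrite -{1}(opprK c) shlK. Qed.

Lemma contour_shl c t :
  contour (shl c t) = [seq (p.1, p.2 + c) | p <- contour t].
Proof.
elim/ltree_nested_ind: t => l ts IH.
rewrite [shl _ _]/= !contourE map_cons; congr (_ :: _).
elim: ts 0%N IH => //= u us IHus k [IHu /IHus ->].
by rewrite map_cat map_cons IHu -!map_comp.
Qed.

Lemma contour_head t :
  contour t = ([::], root_label t) :: behead (contour t).
Proof. by case: t. Qed.

#[local] Opaque contour.

Lemma size_contour_gt0 t : (0 < size (contour t))%N.
Proof. by rewrite contour_head. Qed.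

Fixpoint label_at (t : ltree) (a : seq nat) : int :=
  if a is k :: a' then label_at (nth t (children t) k) a' else root_label t.

Lemma contours_label l k us p : p \in contours l k us ->
  (p = ([::], l)) \/ exists j a t0, [/\ (j < size us)%N, p.1 = (k + j)%N :: a &
     (a, p.2) \in contour (nth t0 us j)].
Proof.
elim: us k => //= u us IH k; rewrite mem_cat inE => /orP[|/orP[/eqP->|]].
- case/mapP => q qu ->; right; exists 0%N, q.1, u; rewrite addn0; split=> //.
  by rewrite /= -surjective_pairing.
- by left.
- case/IH => [->|]; first by left.
  case=> j [a [t0 [ltj e i]]]; right; exists j.+1, a, t0.
  by rewrite ltnS ltj e addnS.
Qed.

Lemma contour_label t p : p \in contour t -> p.2 = label_at t p.1.
Proof.
elim/ltree_nested_ind: t p => l ts IH p.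
rewrite contourE inE => /orP[/eqP-> //|/contours_label [-> //|]].
case=> j [a [t0 [ltj e /=]]]; rewrite e add0n /=.
rewrite (set_nth_default (LNode l ts)) //.
elim: ts j {e} (LNode l ts) IH ltj => //= u us IHus [|j] t [IHu IHt] ltj /=.
  by move/IHu.
exact: IHus.
Qed.

(** * The re-rooting map *)

(* The n-th entry holds the left tree at S(n) and the subtrees of the children
   of S(n) on its right; the right tree shares its root label with the left one. *)
Definition config := nat -> ltree * seq ltree.
Definition lft (w : config) n := (w n).1.
Definition rgt (w : config) n := LNode (root_label (w n).1) (w n).2.
Notation wcorner w := (corner (lft w) (rgt w)).
Notation wvert w := (cvert (lft w) (rgt w)).
Notation wlab w := (clab (lft w) (rgt w)).

Definition tagL (n : nat) (p : seq nat * int) : vertex * int := ((n, false, p.1), p.2).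
Definition tagR (n : nat) (p : seq nat * int) : vertex * int :=
  ((n, p.1 != [::], p.1), p.2).

Definition lcorners (w : config) m :=
  flatten [seq map (tagL n) (lblocks (lft w) n) | n <- iota 0 m].
Definition rcorners (w : config) m :=
  flatten [seq map (tagR n) (rblocks (rgt w) n) | n <- iota 0 m].

(** Replaces the fuel recursion by [nth] in a finite concatenation, a form on which re-rooting acts
    through [map] and [behead]. The function [tag] attaches the block index to an address. *)
Lemma catnthE (A B : Type) (f : nat -> seq A) (tag : nat -> A -> B) a0 x0 fuel n i m :
  (m <= fuel)%N -> (i < size (flatten [seq map (tag j) (f j) | j <- iota n m]))%N ->
  tag (catnth f a0 fuel n i).1 (catnth f a0 fuel n i).2 =
  nth x0 (flatten [seq map (tag j) (f j) | j <- iota n m]) i.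
Proof.
elim: m n i fuel => [|m IH] n i [|fuel] //= lemf.
rewrite size_cat size_map nth_cat size_map.
case: (ltnP i (size (f n))) => lt_i ltsz /=; first by rewrite (nth_map a0).
by rewrite IH // ltn_subLR.
Qed.

Lemma catnth_block (A B : Type) (f : nat -> seq A) (tag : nat -> A -> B) a0 fuel n i m :
  (m <= fuel)%N -> (size (flatten [seq map (tag j) (f j) | j <- iota n m]) <= i)%N ->
  (n + m <= (catnth f a0 fuel n i).1)%N.
Proof.
elim: m n i fuel => [|m IH] n i fuel.
  move=> _ _; rewrite addn0; elim: fuel n i => //= fuel IHf n i.
  case: ifP => _; first exact: leqnn.
  exact: leq_trans (leqnSn n) (IHf _ _).
case: fuel => //= fuel lemf; rewrite size_cat size_map => lesz.
case: (ltnP i (size (f n))) => lt_i /=; first by lia.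
by rewrite -addSnnS; apply: IH => //; rewrite leq_subRL.
Qed.

Lemma catnth_ext (A : Type) (f g : nat -> seq A) a0 fuel n i :
  (forall j, (j < n + fuel)%N -> f j = g j) ->
  catnth f a0 fuel n i = catnth g a0 fuel n i.
Proof.
elim: fuel n i => //= fuel IH n i efg.
by rewrite efg ?IH // => [j|]; [rewrite addSnnS => /efg | lia].
Qed.

Lemma size_lcorners w m : (m <= size (lcorners w m))%N.
Proof.
rewrite /lcorners; elim: m 0%N => //= m IH n.
rewrite size_cat size_map; have := size_contour_gt0 (lft w n).
by have := IH n.+1; rewrite /lblocks; lia.
Qed.

(** One block more than on the left: the right block 0 has lost the corner c_0 and may be empty. *)
Lemma size_rcorners w m : (m <= size (rcorners w m.+1))%N.
Proof.
rewrite /rcorners /= size_cat; apply: (leq_trans _ (leq_addl _ _)).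
elim: m 0%N => //= m IH n.
by rewrite size_cat size_map; exact: (leq_add (size_contour_gt0 (rgt w n.+1)) (IH n.+1)).
Qed.

Lemma lcorners_prefix w m1 m2 x0 k : (m1 <= m2)%N -> (k < size (lcorners w m1))%N ->
  nth x0 (lcorners w m2) k = nth x0 (lcorners w m1) k.
Proof.
move=> lem ltk; rewrite /lcorners -(subnKC lem) iotaD map_cat flatten_cat.
by rewrite nth_cat ltk.
Qed.

Lemma rcorners_prefix w m1 m2 x0 k : (m1 <= m2)%N -> (k < size (rcorners w m1))%N ->
  nth x0 (rcorners w m2) k = nth x0 (rcorners w m1) k.
Proof.
move=> lem ltk; rewrite /rcorners -(subnKC lem) iotaD map_cat flatten_cat.
by rewrite nth_cat ltk.
Qed.

Lemma corner_pos w x0 k m : (k < size (lcorners w m))%N ->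
  wcorner w (Posz k) = nth x0 (lcorners w m) k.
Proof.
move=> ltk.
have ltk2 : (k < size (lcorners w k.+2))%N by have := size_lcorners w k.+2; lia.
transitivity (nth x0 (lcorners w k.+2) k).
  rewrite -(@catnthE _ _ _ tagL ([::], 0) x0 k.+2) //.
  by rewrite /corner; case: catnth => n [].
by case: (leqP m k.+2) => [|/ltnW] lem; rewrite ?(lcorners_prefix _ lem) // lcorners_prefix.
Qed.

Lemma corner_neg w x0 k m : (k < size (rcorners w m))%N ->
  wcorner w (Negz k) = nth x0 (rcorners w m) k.
Proof.
move=> ltk.
have ltk2 : (k < size (rcorners w k.+2))%N by have := size_rcorners w k.+1; lia.
transitivity (nth x0 (rcorners w k.+2) k).
  rewrite -(@catnthE _ _ _ tagR ([::], 0) x0 k.+2) //.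
  by rewrite /corner; case: catnth => n [].
by case: (leqP m k.+2) => [|/ltnW] lem; rewrite ?(rcorners_prefix _ lem) // rcorners_prefix.
Qed.

Definition shift_config (c : int) (w : config) : config :=
  fun n => (shl c (w n).1, map (shl c) (w n).2).

(** If S(0) is a leaf on the left, c_1 is the first corner of S(1): S(1) becomes the root and the
    old S(0), with its right subtrees, becomes the first child on its right. Otherwise c_1 is the
    first corner of the first left child [u]: the spine gains [u] as its new origin, with nothing on
    its right, and the old S(0) becomes S(1). *)
Definition reroot_abs (w : config) : config :=
  let l := root_label (w 0%N).1 in
  match children (w 0%N).1 with
  | [::] => fun n => if n is 0 then ((w 1%N).1, LNode l (w 0%N).2 :: (w 1%N).2)
                     else w n.+1
  | u :: us => fun n => match n with
      | 0 => (u, [::])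
      | 1 => (LNode l us, (w 0%N).2)
      | n'.+1 => w n'
      end
  end.

(* The configuration seen from the corner c_1, which becomes the root. *)
Definition reroot (w : config) : config :=
  shift_config (- root_label (lft (reroot_abs w) 0)) (reroot_abs w).

(** When S(0) is a leaf on the left, it becomes child 0 on the right of the new root, so the right
    children of the old S(1) move from [k] to [k.+1]. Addresses carried by no corner receive
    arbitrary values. *)
Definition reroot_vertex (w : config) (v : vertex) : vertex :=
  let: (n, b, a) := v in
  match children (lft w 0) with
  | [::] => match n with
    | 0 => if b then (0%N, true, 0%N :: a) else (0%N, true, [:: 0%N])
    | 1 => if b then (if a is k :: a' then (0%N, true, k.+1 :: a') else (0%N, false, [::]))
           else (0%N, false, a)
    | n'.+1 => (n', b, a)
    end
  | _ => match n with
    | 0 => if b then (1%N, true, a) else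
           match a with
           | [::] => (1%N, false, [::])
           | 0 :: a' => (0%N, false, a')
           | k.+1 :: a' => (1%N, false, k :: a')
           end
    | n'.+1 => (n'.+2, b, a)
    end
  end.

Lemma contours_addr l k us p : p \in contours l k us ->
  p.1 = [::] \/ exists j a, p.1 = (k + j)%N :: a.
Proof.
case/contours_label => [->|]; first by left.
by case=> j [a [_ [_ -> _]]]; right; exists j, a.
Qed.

Lemma contoursS l k us :
  contours l k.+1 us =
  [seq (if p.1 is j :: a then j.+1 :: a else [::], p.2) | p <- contours l k us].
Proof.
elim: us k => //= u us IH k; rewrite IH map_cat map_cons /=; congr (_ ++ _ :: _).
by rewrite -map_comp.
Qed.

Definition phi (w : config) (p : vertex * int) := (reroot_vertex w p.1, p.2).

Lemma lcorners_reroot_leaf w m : children (lft w 0) = [::] ->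
  lcorners (reroot_abs w) m = map (phi w) (behead (lcorners w m.+1)).
Proof.
move=> leaf; have e0 : contour (lft w 0) = [:: ([::], root_label (lft w 0))].
  by rewrite {1}(ltreeE (lft w 0)) leaf.
rewrite /lcorners /= /lblocks e0 /= map_flatten -map_comp (iotaDl 1 0) -map_comp.
congr flatten; apply: eq_map => n /=; rewrite -map_comp add1n.
have -> : lft (reroot_abs w) n = lft w n.+1 by rewrite /reroot_abs leaf; case: n.
by apply: eq_map => p; rewrite /phi /= leaf; case: n.
Qed.

Lemma lcorners_reroot_node w m u us : children (lft w 0) = u :: us ->
  lcorners (reroot_abs w) m.+2 = map (phi w) (behead (lcorners w m.+1)).
Proof.
move=> node; have e0 : contour (lft w 0) =
    ([::], root_label (lft w 0)) :: contours (root_label (lft w 0)) 0 (u :: us).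
  by rewrite {1}(ltreeE (lft w 0)) node contourE.
rewrite /lcorners /= /lblocks e0 /= !map_cat /= catA; congr (_ ++ _); last first.
  rewrite map_flatten -map_comp (iotaDl 1 1) -map_comp; congr flatten.
  apply/eq_in_map => n; rewrite mem_iota => /andP[n1 _] /=.
  rewrite -map_comp /reroot_abs node; case: n n1 => // n _; rewrite add1n /=.
  by apply: eq_map => p; rewrite /phi /= node.
rewrite /reroot_abs node [lft _ 0]/= [lft _ 1]/=; congr (_ ++ _).
  by rewrite -!map_comp; apply: eq_map => p; rewrite /phi /= node.
rewrite contourE /= /phi /= node; congr (_ :: _).
rewrite contoursS -!map_comp; apply/eq_in_map => p /contours_addr /=.
by rewrite /phi /tagL /= node => -[->|[j [a ->]]].
Qed.

Lemma rcornersE w m : rcorners w m.+1 =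
  map (tagR 0) (contours (root_label (w 0%N).1) 0 (w 0%N).2) ++
  flatten [seq map (tagR n.+1) (contour (rgt w n.+1)) | n <- iota 0 m].
Proof.
rewrite /rcorners /= (iotaDl 1 0) -map_comp /rblocks /rgt contourE.
by congr (_ ++ flatten _); apply: eq_map => n /=; rewrite add1n.
Qed.

(** The old root corner c_0 opens the new right side as c_{-1}, hence the extra head of the list. *)
Lemma rcorners_reroot_leaf w m : children (lft w 0) = [::] ->
  rcorners (reroot_abs w) m.+1 =
  map (phi w) (((0%N, false, [::]), root_label (lft w 0)) :: rcorners w m.+2).
Proof.
move=> leaf; rewrite !rcornersE -[iota 0 m.+1]/(0%N :: iota 1 m) map_cons.
rewrite -[flatten (_ :: _)]/(_ ++ flatten _) map_cons -cat1s !map_cat !catA; congr (_ ++ _); last first.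
  rewrite map_flatten (iotaDl 1 0) -!map_comp; congr flatten.
  apply/eq_map => n /=; rewrite -map_comp add1n.
  rewrite /rgt; have -> : reroot_abs w n.+1 = w n.+2 by rewrite /reroot_abs leaf.
  by apply: eq_map => p; rewrite /phi /= leaf.
have -> : (reroot_abs w 0%N) =
    ((w 1%N).1, LNode (root_label (w 0%N).1) (w 0%N).2 :: (w 1%N).2).
  by rewrite /reroot_abs leaf.
rewrite /= !contourE /= contoursS /phi /= leaf /=; congr (_ :: _).
rewrite !map_cat map_cons -!map_comp; congr (_ ++ _ :: _);
  by apply/eq_in_map => p /contours_addr /= [|[j [a]]] ->; rewrite /tagR/= leaf.
Qed.

Lemma rcorners_reroot_node w m u us : children (lft w 0) = u :: us ->
  rcorners (reroot_abs w) m.+2 =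
  map (phi w) (((0%N, false, [::]), root_label (lft w 0)) :: rcorners w m.+1).
Proof.
move=> node; rewrite !rcornersE /= !map_cat.
have -> : reroot_abs w 0%N = (u, [::]) by rewrite /reroot_abs node.
rewrite /= -cat_cons; congr (_ ++ _); last first.
  rewrite map_flatten (iotaDl 1 0) -!map_comp; congr flatten.
  apply/eq_map => n /=; rewrite -map_comp add1n.
  rewrite /rgt; have -> : reroot_abs w n.+2 = w n.+1 by rewrite /reroot_abs node.
  by apply: eq_map => p; rewrite /phi /= node.
have -> : rgt (reroot_abs w) 1 = LNode (root_label (w 0%N).1) (w 0%N).2.
  by rewrite /rgt /reroot_abs node.
rewrite contourE /= /phi /= node /tagR /=; congr (_ :: _).
by rewrite -map_comp; apply/eq_in_map => p /contours_addr /= [|[j [a]]] ->; rewrite /= node.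
Qed.

Lemma map_shl_behead c t :
  behead (contour (shl c t)) = [seq (p.1, p.2 + c) | p <- behead (contour t)].
Proof. by rewrite contour_shl -behead_map. Qed.

Lemma shift_rgt c w n : rgt (shift_config c w) n = shl c (rgt w n).
Proof. by rewrite /rgt /= root_shl. Qed.

Lemma lcorners_shift c w m :
  lcorners (shift_config c w) m = [seq (p.1, p.2 + c) | p <- lcorners w m].
Proof.
rewrite /lcorners map_flatten -map_comp; congr flatten; apply: eq_map => n /=.
by rewrite /lblocks contour_shl -!map_comp.
Qed.

Lemma rcorners_shift c w m :
  rcorners (shift_config c w) m = [seq (p.1, p.2 + c) | p <- rcorners w m].
Proof.
rewrite /rcorners map_flatten -map_comp; congr flatten; apply: eq_map => n /=.
rewrite /rblocks shift_rgt; case: ifP => _; rewrite ?shift_rgt ?map_shl_behead ?contour_shl.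
  by rewrite -!map_comp.
by rewrite -!map_comp.
Qed.

Lemma corner_shift c w (i : int) : wcorner (shift_config c w) i =
  ((wcorner w i).1, (wcorner w i).2 + c).
Proof.
pose x0 : vertex * int := (0%N, false, [::], 0).
case: i => k.
  have ltk : (k < size (lcorners w k.+1))%N by exact: size_lcorners.
  rewrite (corner_pos x0 ltk) (@corner_pos _ (x0.1, x0.2 + c) k k.+1) lcorners_shift ?size_map //.
  by rewrite (nth_map x0).
have ltk : (k < size (rcorners w k.+2))%N by exact: size_rcorners.
rewrite (corner_neg x0 ltk) (@corner_neg _ (x0.1, x0.2 + c) k k.+2) rcorners_shift ?size_map //.
by rewrite (nth_map x0).
Qed.

Lemma corner0 w : wcorner w 0 = ((0%N, false, [::]), root_label (lft w 0)).
Proof.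
by rewrite (@corner_pos w (0%N, false, [::], 0) 0 1) // /lcorners /= /lblocks contour_head.
Qed.

(** Up to a renaming of vertices, re-rooting is the shift of corner indices; the arcs of the map,
    defined from corners, are shifted with it. *)
Lemma corner_reroot_abs w (i : int) : wcorner (reroot_abs w) i = phi w (wcorner w (i + 1)).
Proof.
pose x0 : vertex * int := (0%N, false, [::], 0).
have hL k : exists m m', [/\ (k < size (lcorners (reroot_abs w) m))%N,
    (k.+1 < size (lcorners w m'))%N &
    lcorners (reroot_abs w) m = map (phi w) (behead (lcorners w m'))].
  have := size_lcorners w k.+2; have := size_lcorners w k.+2.+1.
  case e: (children (lft w 0)) => [|u us] s1 s2.
    exists k.+2, k.+3; rewrite lcorners_reroot_leaf // size_map size_behead.
    by split => //; lia.
  exists k.+3, k.+2; rewrite (lcorners_reroot_node _ e) size_map size_behead.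
  by split => //; lia.
have hR k : exists m m', [/\ (k < size (rcorners (reroot_abs w) m))%N,
    (k <= size (rcorners w m'))%N &
    rcorners (reroot_abs w) m =
      map (phi w) (((0%N, false, [::]), root_label (lft w 0)) :: rcorners w m')].
  have := size_rcorners w k.+1; have := size_rcorners w k.+2.
  case e: (children (lft w 0)) => [|u us] s1 s2.
    exists k.+2, k.+3; rewrite rcorners_reroot_leaf //= size_map.
    by split => //; lia.
  exists k.+3, k.+2; rewrite (rcorners_reroot_node _ e) /= size_map.
  by split => //; lia.
case: i => k.
  have [m [m' [lt1 lt2 e]]] := hL k.
  rewrite (_ : Posz k + 1 = Posz k.+1); last by lia.
  rewrite (corner_pos (phi w x0) lt1) e (corner_pos x0 lt2) (nth_map x0) ?nth_behead //.
  by rewrite size_behead; lia.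
have [m [m' [lt1 lt2 e]]] := hR k.
rewrite (corner_neg (phi w x0) lt1) e (nth_map x0) //.
(* The case [k = 0] crosses from the right side to the left one: the new c_{-1} is the old c_0. *)
case: k lt1 lt2 e => [|k] lt1 lt2 e.
  by rewrite (_ : Negz 0 + 1 = 0); [rewrite corner0 | lia].
rewrite (_ : Negz k.+1 + 1 = Negz k); last by lia.
by rewrite (corner_neg x0 lt2).
Qed.

Lemma lab_reroot w (i : int) : wlab (reroot w) i = wlab w (i + 1) - wlab w 1.
Proof.
rewrite /clab corner_shift corner_reroot_abs /=.
by have := corner_reroot_abs w 0; rewrite corner0 add0r => -[_ ->].
Qed.

Lemma vert_reroot w (i : int) : wvert (reroot w) i = reroot_vertex w (wvert w (i + 1)).
Proof. by rewrite /cvert corner_shift corner_reroot_abs. Qed.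

Lemma corner_cases w (i : int) :
  (exists n q, q \in contour (lft w n) /\ wcorner w i = tagL n q) \/
  (exists n q, q \in contour (rgt w n) /\ wcorner w i = tagR n q).
Proof.
pose x0 : vertex * int := (0%N, false, [::], 0).
case: i => k; [left|right].
  have ltk : (k < size (lcorners w k.+1))%N by exact: size_lcorners.
  rewrite (corner_pos x0 ltk); have /flattenP[s] := mem_nth x0 ltk.
  by case/mapP => n _ -> /mapP[q qn ->]; exists n, q.
have ltk : (k < size (rcorners w k.+2))%N by exact: size_rcorners.
rewrite (corner_neg x0 ltk); have /flattenP[s] := mem_nth x0 ltk.
case/mapP => n _ -> /mapP[q qn ->]; exists n, q; split => //.
by move: qn; rewrite /rblocks; case: ifP => // /eqP ->; exact: mem_behead.
Qed.

Definition vertex_label (w : config) (v : vertex) : int :=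
  let: (n, b, a) := v in label_at (if b then rgt w n else lft w n) a.

(** Makes the label at the end of an edge independent of the corner through which the edge reaches
    the vertex. *)
Lemma lab_vert w (i : int) : wlab w i = vertex_label w (wvert w i).
Proof.
rewrite /clab /cvert.
case: (corner_cases w i) => -[n [q [/contour_label qn ->]]] //=.
by rewrite qn; case: (q.1).
Qed.

(** Rules out the addresses on which [reroot_vertex] fails to be injective: a spine vertex is always
    addressed on the left, and a left leaf S(0) has no descendants there. *)
Definition valid_vertex (w : config) (v : vertex) : bool :=
  let: (n, b, a) := v in
  if b then a != [::] else
  (n == 0%N) ==> nilp (children (lft w 0)) ==> (a == [::]).

Lemma vert_valid w (i : int) : valid_vertex w (wvert w i).
Proof.
rewrite /cvert; case: (corner_cases w i) => -[n [q [qn ->]]] /=.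
  apply/implyP => /eqP n0; apply/implyP => /nilP leaf.
  by move: qn; rewrite n0 (ltreeE (lft w 0)) leaf contourE inE => /eqP ->.
by case: eqVneq => //= _; rewrite !implybT.
Qed.

Lemma reroot_vertex_inj w u v : valid_vertex w u -> valid_vertex w v ->
  reroot_vertex w u = reroot_vertex w v -> u = v.
Proof.
case: u => [[n b] a]; case: v => [[n' b'] a'] /=.
case: (children (lft w 0)) => [|x s] /=.
  by case: n => [|[|n]]; case: n' => [|[|n']]; case: b; case: b'; case: a => [|k a];
     case: a' => [|k' a'] //= *; congruence.
by case: n => [|n]; case: n' => [|n']; case: b; case: b'; case: a => [|[|k] a];
   case: a' => [|[|k'] a'] //= *; congruence.
Qed.

Lemma vert_reroot_eq w (i j : int) :
  wvert (reroot w) i = wvert (reroot w) j <-> wvert w (i + 1) = wvert w (j + 1).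
Proof.
rewrite !vert_reroot; split=> [|-> //].
by apply: reroot_vertex_inj; exact: vert_valid.
Qed.

(** A vertex belongs to one block, and only finitely many corners precede the end of that block on
    either side. *)
Lemma vert_finite w n b a : exists M : nat, forall i : int,
  wvert w i = (n, b, a) -> (- M%:Z <= i <= M%:Z)%R.
Proof.
exists (size (lcorners w n.+1) + size (rcorners w n.+1)).+1%N => -[] k e.
  suff : (k < size (lcorners w n.+1))%N by lia.
  rewrite ltnNge; apply/negP => le_k.
  have lef : (n.+1 <= k.+2)%N by have := size_lcorners w n.+1; lia.
  have := @catnth_block _ _ _ tagL ([::], 0) k.+2 0 k n.+1 lef le_k.
  by move: e; rewrite /cvert /corner; case: catnth => m [? ?] [->] /=; lia.
suff : (k < size (rcorners w n.+1))%N by lia.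
rewrite ltnNge; apply/negP => le_k.
have lef : (n.+1 <= k.+2)%N by have := size_rcorners w n; lia.
have := @catnth_block _ _ _ tagR ([::], 0) k.+2 0 k n.+1 lef le_k.
by move: e; rewrite /cvert /corner; case: catnth => m [? ?] [->] /=; lia.
Qed.

(** The fuel of [catnth] bounds the number of levels that are read. This locality is the source of
    all measurability statements on corners. *)
Lemma corner_ext w w' (i : int) :
  (forall n, (n < `|i|%N.+2)%N -> w n = w' n) -> wcorner w i = wcorner w' i.
Proof.
case: i => k eww; rewrite /corner.
  rewrite (catnth_ext (g := lblocks (lft w'))) // => j ltj.
  by rewrite /lblocks /lft eww.
rewrite (catnth_ext (g := rblocks (rgt w'))) // => j ltj.
have e : w j = w' j by apply: eww; exact: leq_trans ltj (leqnSn k.+2).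
rewrite /rblocks /rgt e; case: eqP => // j0; by rewrite -j0 e.
Qed.

Lemma lab_left_root w n : exists k, (n <= k)%N /\ wlab w (Posz k) = root_label (w n).1.
Proof.
pose x0 : vertex * int := (0%N, false, [::], 0).
exists (size (lcorners w n)); split; first exact: size_lcorners.
have e : lcorners w n.+1 = lcorners w n ++ map (tagL n) (contour (lft w n)).
  by rewrite /lcorners -addn1 iotaD map_cat flatten_cat /= cats0.
have lt : (size (lcorners w n) < size (lcorners w n.+1))%N.
  by rewrite e size_cat size_map -[X in (X < _)%N]addn0 ltn_add2l size_contour_gt0.
by rewrite /clab (corner_pos x0 lt) e nth_cat ltnn subnn contour_head.
Qed.

Lemma lab_right_root w n : exists k, (n <= k)%N /\ wlab w (Negz k) = root_label (w n.+1).1.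
Proof.
pose x0 : vertex * int := (0%N, false, [::], 0).
exists (size (rcorners w n.+1)); split; first exact: size_rcorners.
have e : rcorners w n.+2 = rcorners w n.+1 ++ map (tagR n.+1) (contour (rgt w n.+1)).
  by rewrite /rcorners -(addn1 n.+1) iotaD map_cat flatten_cat /= cats0.
have lt : (size (rcorners w n.+1) < size (rcorners w n.+2))%N.
  by rewrite e size_cat size_map -[X in (X < _)%N]addn0 ltn_add2l size_contour_gt0.
by rewrite /clab (corner_neg x0 lt) e nth_cat ltnn subnn contour_head.
Qed.

(** * The graph structure on oriented edges *)

Notation wsucc w := (is_succ (lft w) (rgt w)).
Notation worg w := (org (lft w) (rgt w)).
Notation wtgt w := (tgt (lft w) (rgt w)).
Notation wolab w := (olab (lft w) (rgt w)).

Definition nbr (w : config) (e e' : oedge) : Prop :=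
  exists v, wtgt w e v /\ worg w e' v.

Definition reve (e : oedge) : oedge := (e.1, ~~ e.2).
Definition shifte (k : int) (e : oedge) : oedge := (e.1 + k, e.2).

Lemma reveK : involutive reve.
Proof. by case=> i b; rewrite /reve negbK. Qed.

Lemma org_reve w e v : worg w (reve e) v <-> wtgt w e v.
Proof. by case: e => i []. Qed.

Lemma tgt_reve w e v : wtgt w (reve e) v <-> worg w e v.
Proof. by case: e => i []. Qed.

Lemma nbr_reve w e e' : nbr w (reve e') (reve e) <-> nbr w e e'.
Proof.
by split=> -[v []]; rewrite ?tgt_reve ?org_reve => H1 H2; exists v;
  rewrite ?tgt_reve ?org_reve.
Qed.

Lemma succ_reroot w (i j : int) : wsucc (reroot w) i j <-> wsucc w (i + 1) (j + 1).
Proof.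
rewrite /is_succ !lab_reroot; split => -[lt_ij [eij H]].
  split; first by lia.
  split; first by lia.
  move=> k ltik ltkj; have := H (k - 1); rewrite !lab_reroot subrK.
  by move/(_ ltac:(lia) ltac:(lia)); lia.
split; first by lia.
split; first by lia.
by move=> k ltik ltkj; rewrite !lab_reroot; have := H (k + 1) ltac:(lia) ltac:(lia); lia.
Qed.

(** Re-rooting renames vertices but only shifts corners, so adjacency is restated through two
    corners of the common vertex. *)
Lemma nbr_cases w e e' : nbr w e e' <-> exists i j,
  [/\ wvert w i = wvert w j,
     (if e.2 then i = e.1 /\ exists k, wsucc w e.1 k else wsucc w e.1 i) &
     (if e'.2 then wsucc w e'.1 j else j = e'.1 /\ exists k, wsucc w e'.1 k)].
Proof.
case: e e' => a b [a' b']; split.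
  case=> v []; case: b; case: b' => /=.
  - by move=> [[k sk] <-] [j [sj ej]]; exists a, j; split => //; split => //; exists k.
  - by move=> [[k sk] <-] [[k' sk'] ej]; exists a, a'; split => //; split => //; [exists k|exists k'].
  - by move=> [i [si <-]] [j [sj ej]]; exists i, j.
  - by move=> [i [si <-]] [[k' sk'] ej]; exists i, a'; split => //; split => //; exists k'.
case=> i [j [eij H H']]; exists (wvert w i); case: b H; case: b' H' => /=.
- by move=> H' [ei ?]; subst i; split => //; exists j.
- by move=> [ej ?] [ei ?]; subst i j; split.
- by move=> H' H; split; [exists i|exists j].
- by move=> [ej ?] H; subst j; split; [exists i|split].
Qed.

Lemma nbr_reroot w e e' : nbr (reroot w) e e' <-> nbr w (shifte 1 e) (shifte 1 e').
Proof.
rewrite !nbr_cases; case: e e' => a b [a' b'] /=; split.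
  case=> i [j [/vert_reroot_eq eij H H']]; exists (i + 1), (j + 1); split => //.
    case: b H => [[-> [k /succ_reroot sk]]|/succ_reroot //].
    by split => //; exists (k + 1).
  case: b' H' => [/succ_reroot //|[-> [k /succ_reroot sk]]].
  by split => //; exists (k + 1).
case=> i [j [eij H H']]; exists (i - 1), (j - 1); split.
- by apply/vert_reroot_eq; rewrite !subrK.
- case: b H => [[-> [k sk]]|sk].
    by rewrite addrK; split => //; exists (k - 1); apply/succ_reroot; rewrite subrK.
  by apply/succ_reroot; rewrite subrK.
- case: b' H' => [sk|[-> [k sk]]].
    by apply/succ_reroot; rewrite subrK.
  by rewrite addrK; split => //; exists (k - 1); apply/succ_reroot; rewrite subrK.
Qed.

Lemma olab_org w e v : worg w e v -> wolab w e = vertex_label w v.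
Proof.
case: e => i [] /= [] => [j [[_ [e _]] <-]|_ <-].
  by rewrite -lab_vert e.
by rewrite -lab_vert.
Qed.

Lemma olab_tgt w e v : wtgt w e v ->
  vertex_label w v = wolab w e + (if e.2 then 1 else -1).
Proof.
by move/org_reve/olab_org <-; case: e => i [] /=; rewrite /olab /= ?subrK.
Qed.

Lemma nbr_olab w e e' : nbr w e e' ->
  wolab w e' = wolab w e + (if e.2 then 1 else -1).
Proof. by case=> v [/olab_tgt <- /olab_org]. Qed.

(** The deterministic properties behind the geometry of the map. The labels on the left side provide
    successors; those on the right side bound how far back an arc ending at a given vertex can
    start, which makes degrees finite. *)
Definition good (w : config) : Prop :=
  [/\ forall i : int, `|wlab w (i + 1) - wlab w i| <= 1,
      forall z (n : nat), exists k, (n <= k)%N /\ wlab w (Posz k) = z &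
      forall z (n : nat), exists k, (n <= k)%N /\ wlab w (Negz k) = z].

Lemma first_after w (z i : int) : good w -> exists j, [/\ i < j, wlab w j = z &
  forall k, i < k -> k < j -> wlab w k <> z].
Proof.
case=> _ Hp _; have [k0 [lek0 ek0]] := Hp z (absz i).+1.
have ex : exists k : nat, wlab w (i + 1 + k%:Z) == z.
  exists (absz (k0%:Z - i - 1)%R); apply/eqP; rewrite -ek0; congr clab; lia.
case: (ex_minnP ex) => k /eqP ek mink; exists (i + 1 + k%:Z); split=> //; first by lia.
move=> l ltil ltlk el; have := mink (absz (l - i - 1)%R).
rewrite (_ : i + 1 + _ = l); last by lia.
by rewrite el eqxx => /(_ isT); lia.
Qed.

Lemma succ_ex w (i : int) : good w -> exists j, wsucc w i j.
Proof. by case/(first_after (wlab w i - 1) i) => j [? ? ?]; exists j; split. Qed.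

Lemma nbr_self w e : good w -> nbr w e (reve e).
Proof.
move=> gw; have [j sj] := succ_ex e.1 gw; case: e sj => i [] /= sj.
  by exists (wvert w i); split; split => //; exists j.
by exists (wvert w j); split; exists j.
Qed.

(** Outgoing arcs start at the finitely many corners of the target [v]. An arc that ends at [v]
    cannot start before a corner [Negz k] lying left of all corners of [v] and carrying the label of
    [v], since that corner, or an earlier one, would then be the successor. *)
Lemma nbr_finite w e : good w -> finite_set [set e' | nbr w e e'].
Proof.
move=> gw.
have [v ev] : exists v, wtgt w e v.
  by have [v [ev _]] := nbr_self e gw; exists v.
case: v ev => [[n b] a] ev; set v := (n, b, a) in ev *.
have [M HM] := vert_finite w n b a.
have [k [lek ek]] : exists k, (M <= k)%N /\ wlab w (Negz k) = vertex_label w v.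
  by case: gw => _ _ /(_ (vertex_label w v) M).
have tgt_uniq v' : wtgt w e v' -> v' = v.
  move: ev; case: (e) => i [] /= [].
    by move=> _ <- [_ <-].
  move=> j [[lj [ej Hj]] ejv] [j' [[lj' [ej' Hj']] <-]].
  suff -> : j' = j by [].
  by have := Hj j' lj'; have := Hj' j lj; lia.
pose s : seq oedge :=
  [seq (i, b') | i <- map Posz (iota 0 k.+2) ++ map Negz (iota 0 k.+2), b' <- [:: true; false]].
apply: (@sub_finite_set _ _ [set` s]); last exact: finite_seq.
move=> [i b'] /= [v' [/tgt_uniq -> ov]].
suff : (- k.+1%:Z <= i <= k.+1%:Z).
  move=> lei; apply/allpairsP; exists (i, b'); split; [|by case: b' {ov}|by []].
  rewrite -[(i, b').1]/i mem_cat; apply/orP.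
  by case: i lei {ov} => i lei; [left|right]; apply: map_f; rewrite mem_iota; lia.
case: b' ov => /= -[].
  move=> j [[lij [eij Hij]] ej]; have := HM j ej.
  have := Hij (Negz k); have : wlab w j = vertex_label w v by rewrite -ej -lab_vert.
  have [|] := leP i (Negz k) => ?; last by lia.
  by lia.
by move=> _ /HM; lia.
Qed.

(** * Connectedness of the map *)

Inductive reach (w : config) : oedge -> oedge -> Prop :=
| reach_refl e : reach w e e
| reach_step e1 e2 e3 : nbr w e1 e2 -> reach w e2 e3 -> reach w e1 e3.

Lemma reach_trans w e1 e2 e3 : reach w e1 e2 -> reach w e2 e3 -> reach w e1 e3.
Proof. by elim=> // e e' e'' n _ IH /IH; exact: reach_step. Qed.

Lemma reach1 w e e' : nbr w e e' -> reach w e e'.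
Proof. by move=> n; apply: reach_step n (reach_refl _ _). Qed.

Definition biconn w e e' := reach w e e' /\ reach w e' e.

Lemma biconn_sym w e e' : biconn w e e' -> biconn w e' e.
Proof. by case. Qed.

Lemma biconn_trans w e1 e2 e3 : biconn w e1 e2 -> biconn w e2 e3 -> biconn w e1 e3.
Proof. by case=> a b [c d]; split; [exact: reach_trans a c|exact: reach_trans d b]. Qed.

Lemma biconn_rev w (i : int) : good w -> biconn w (i, false) (i, true).
Proof. by move=> gw; split; apply: reach1; have := nbr_self (i, _) gw; apply. Qed.

Lemma biconn_succ w (i j : int) : good w -> wsucc w i j -> biconn w (i, false) (j, false).
Proof.
move=> gw sij; have [k sjk] := succ_ex j gw; split.
  apply: reach1; exists (wvert w j); split; first by exists j.
  by split => //; exists k.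
apply: (reach_trans (biconn_rev j gw).1).
apply: reach_trans (biconn_rev i gw).2.
apply: reach1; exists (wvert w j); split; last by exists j.
by split => //; exists k.
Qed.

(** Compare the successors of c_i and c_{i+1}. If the label drops, c_{i+1} is the successor of c_i;
    if it is unchanged, both have the same successor; if it rises, labels stay above that of c_i
    until the successor of c_{i+1}, and the second iterated successor of c_{i+1} is the successor of
    c_i. *)
Lemma biconn_next w (i : int) : good w -> biconn w (i, false) (i + 1, false).
Proof.
move=> gw; have [skip0 _ _] := gw.
have skip (l : int) : -1 <= wlab w (l + 1) - wlab w l /\ wlab w (l + 1) - wlab w l <= 1.
  by apply/andP; rewrite -ler_norml; exact: skip0.
have ski := skip i.
have [j si] := succ_ex i gw; have [k sk] := succ_ex (i + 1) gw.
have [lij [eij Hij]] := si; have [lk [ek Hk]] := sk.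
have [e|[e|e]] : wlab w (i + 1) = wlab w i - 1 \/ wlab w (i + 1) = wlab w i \/
    wlab w (i + 1) = wlab w i + 1. by lia.
- suff ej : j = i + 1 by rewrite -ej; exact: biconn_succ.
  by have := Hij (i + 1); lia.
- suff ejk : j = k.
    subst k; exact: biconn_trans (biconn_succ gw si) (biconn_sym (biconn_succ gw sk)).
  rewrite e in ek Hk.
  have ni : j <> i + 1 by move=> ji; move: eij; rewrite ji; lia.
  have := Hij k; have := Hk j; lia.
- have [l sl] := succ_ex k gw; have [lkl [el Hl]] := sl.
  have above (p : nat) : i + 1 + p%:Z < k -> wlab w i + 1 <= wlab w (i + 1 + p%:Z).
    elim: p => [|p IH] lp; first by rewrite addr0; lia.
    have := Hk (i + 1 + p.+1%:Z) ltac:(lia) lp.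
    have := skip (i + 1 + p%:Z).
    rewrite (_ : i + 1 + p%:Z + 1 = i + 1 + p.+1%:Z); last by lia.
    have := IH ltac:(lia); lia.
  suff ejl : j = l.
    subst l; apply: biconn_trans (biconn_succ gw si) _; apply: biconn_sym.
    exact: biconn_trans (biconn_succ gw sk) (biconn_succ gw sl).
  have kj : k < j.
    rewrite ltNge; apply/negP => jk.
    have [ejk|ltjk] : j = k \/ j < k by lia.
      by move: eij; rewrite ejk; lia.
    have ni : j <> i + 1 by move=> ji; move: eij; rewrite ji; lia.
    have := above (absz (j - i - 1)%R); rewrite (_ : i + 1 + _ = j); last by lia.
    by lia.
  have := Hij l; have := Hl j; lia.
Qed.

Lemma reach_all w e e' : good w -> reach w e e'.
Proof.
move=> gw; have up (i : int) (p : nat) : biconn w (i, false) (i + p%:Z, false).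
  elim: p => [|p IH]; first by rewrite addr0; split; exact: reach_refl.
  apply: biconn_trans IH _; have := biconn_next (i + p%:Z) gw.
  by rewrite -addrA (_ : p%:Z + 1 = p.+1%:Z)//; lia.
have ff (i j : int) : biconn w (i, false) (j, false).
  have [le|le] := leP i j.
    by have := up i (absz (j - i)%R); rewrite (_ : i + _ = j) //; lia.
  by apply: biconn_sym; have := up j (absz (j - i)%R); rewrite (_ : j + _ = i) //; lia.
have toF (e0 : oedge) : biconn w e0 (e0.1, false).
  by case: e0 => i [] /=; [apply: biconn_sym; exact: biconn_rev|split; exact: reach_refl].
exact: (biconn_trans (toF e) (biconn_trans (ff _ _) (biconn_sym (toF e')))).1.
Qed.

Lemma olab_unbounded w (z : int) : good w -> exists e, wolab w e = z.
Proof. by case=> _ /(_ z 0%N) [k [_ <-]] _; exists (Posz k, false). Qed.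

(** * Measurability for countable data *)

Local Open Scope classical_set_scope.

Section countable_partition.
Context {d : measure_display} {T : measurableType d}.

Lemma m_ex (C : countType) (p : C -> T -> Prop) :
  (forall c, measurable [set w | p c w]) -> measurable [set w | exists c, p c w].
Proof.
move=> mp; rewrite (_ : [set w | _] = \bigcup_c [set w | p c w]).
  by apply: countable_bigcupT_measurable => //; exact: countableP.
by apply/seteqP; split => w [c]; exists c.
Qed.

Lemma m_not (p : T -> Prop) : measurable [set w | p w] -> measurable [set w | ~ p w].
Proof. exact: measurableC. Qed.

Lemma m_all (C : countType) (p : C -> T -> Prop) :
  (forall c, measurable [set w | p c w]) -> measurable [set w | forall c, p c w].
Proof.
move=> mp; rewrite (_ : [set w | _] = ~` [set w | exists c, ~ p c w]).
  by apply: measurableC; apply: m_ex => c; exact: m_not.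
apply/seteqP; split => w; first by move=> H [c]; apply.
by move=> H c; apply: contrapT => n; apply: H; exists c.
Qed.

Lemma m_and (p q : T -> Prop) : measurable [set w | p w] -> measurable [set w | q w] ->
  measurable [set w | p w /\ q w].
Proof. exact: measurableI. Qed.

Lemma m_or (p q : T -> Prop) : measurable [set w | p w] -> measurable [set w | q w] ->
  measurable [set w | p w \/ q w].
Proof. exact: measurableU. Qed.

Lemma m_cst (p : Prop) : measurable [set w : T | p].
Proof.
have [h|h] := pselect p; [rewrite (_ : [set _ | _] = setT)|rewrite (_ : [set _ | _] = set0)];
  by [exact: measurableT|exact: measurable0|apply/seteqP; split].
Qed.

Lemma m_imp (p q : T -> Prop) : measurable [set w | p w] -> measurable [set w | q w] ->
  measurable [set w | p w -> q w].
Proof.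
move=> mp mq; rewrite (_ : [set w | _] = [set w | ~ p w \/ q w]).
  by apply: m_or => //; exact: m_not.
apply/seteqP; split => w /=; last by case=> // np /np.
by move=> H; have [/H|] := pselect (p w); [right|left].
Qed.

Lemma m_iff (p q : T -> Prop) : measurable [set w | p w] -> measurable [set w | q w] ->
  measurable [set w | p w <-> q w].
Proof. by move=> mp mq; apply: m_and; exact: m_imp. Qed.

(** Measurability of a map into a countable type, stated fibre by fibre so that no sigma-algebra on
    [C] is needed. *)
Definition discrete (C : Type) (c : T -> C) := forall x, measurable [set w | c w = x].

Lemma discrete_pred (C : countType) (c : T -> C) (p : C -> Prop) :
  discrete c -> measurable [set w | p (c w)].
Proof.
move=> mc; rewrite (_ : [set w | _] = [set w | exists x, c w = x /\ p x]).
  by apply: m_ex => x; apply: m_and => //; exact: m_cst.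
by apply/seteqP; split => w /=; [exists (c w)|case=> x [->]].
Qed.

Lemma m_fiber (C : countType) (c : T -> C) (p : C -> T -> Prop) :
  discrete c -> (forall x, measurable [set w | p x w]) -> measurable [set w | p (c w) w].
Proof.
move=> mc mp; rewrite (_ : [set w | _] = [set w | exists x, c w = x /\ p x w]).
  by apply: m_ex => x; exact: m_and.
by apply/seteqP; split => w /=; [exists (c w)|case=> x [->]].
Qed.

Lemma measurable_fun_glue (C : countType) (c : T -> C) d' (Y : measurableType d')
    (F : C -> T -> Y) :
  discrete c -> (forall x, measurable_fun setT (F x)) ->
  measurable_fun setT (fun w => F (c w) w).
Proof.
move=> mc mF _ B mB; rewrite setTI.
apply: (@m_fiber _ _ (fun x w => B (F x w))) => // x.
by have := mF x measurableT B mB; rewrite setTI.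
Qed.

Lemma setI_fibers (C : countType) (c : T -> C) (A : set T) :
  A = \bigcup_n (A `&` [set w | choice.pickle (c w) = n]).
Proof. by apply/seteqP; split => w; [exists (choice.pickle (c w))|case=> n _ []]. Qed.

Lemma fibers_trivIset (C : countType) (c : T -> C) (A : set T) :
  trivIset setT (fun n => A `&` [set w | choice.pickle (c w) = n]).
Proof. by move=> i j _ _ [w [[_ /= <-] [_ /= <-]]]. Qed.

Lemma fibers_measurable (C : countType) (c : T -> C) (A : set T) n : discrete c ->
  measurable A -> measurable (A `&` [set w | choice.pickle (c w) = n]).
Proof.
move=> mc mA; apply: measurableI => //.
exact: (discrete_pred (fun x => choice.pickle x = n) mc).
Qed.

Lemma setI_fiberE (C : countType) (c : T -> C) (A : set T) n :
  A `&` [set w | choice.pickle (c w) = n] =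
  if pickle_inv n is Some x then A `&` [set w | c w = x] else set0.
Proof.
case E: (pickle_inv n) => [x|]; last first.
  by apply/seteqP; split => // w [_ /= cn]; move: E; rewrite -cn pickleK_inv.
apply/seteqP; split => w [Aw /= e]; split => //=.
  by move: E; rewrite -e pickleK_inv => -[].
by have := @pickle_invK C n; rewrite E /= e.
Qed.

End countable_partition.

Section measure_partition.
Context {R : realType} {d1 d2 : measure_display}.
Context {T1 : measurableType d1} {T2 : measurableType d2}.
Local Open Scope ereal_scope.

Lemma measure_fibers (mu : {measure set T1 -> \bar R}) (C : countType) (c : T1 -> C)
    (A : set T1) : discrete c -> measurable A ->
  mu A = \sum_(n <oo) mu (A `&` [set w | choice.pickle (c w) = n]).
Proof.
move=> mc mA; rewrite {1}(setI_fibers c A) measure_semi_bigcup //.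
- by move=> n; exact: fibers_measurable.
- exact: fibers_trivIset.
- by rewrite -setI_fibers.
Qed.

Lemma le_measure_fibers (mu : {measure set T1 -> \bar R}) (nu : {measure set T2 -> \bar R})
    (C : countType) (c1 : T1 -> C) (c2 : T2 -> C) (A : set T1) (B : set T2) :
  discrete c1 -> discrete c2 -> measurable A -> measurable B ->
  (forall x, mu (A `&` [set w | c1 w = x]) <= nu (B `&` [set w | c2 w = x])) ->
  mu A <= nu B.
Proof.
move=> m1 m2 mA mB H; rewrite (measure_fibers mu m1 mA).
have -> : nu B = \sum_(n <oo) nu (B `&` [set w | choice.pickle (c2 w) = n]).
  rewrite {1}(setI_fibers c2 B) measure_semi_bigcup //.
  - by move=> n; exact: fibers_measurable.
  - exact: fibers_trivIset.
  - by rewrite -setI_fibers.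
apply: lee_nneseries => n _ //; rewrite !setI_fiberE.
by case: pickle_inv => // ; rewrite !measure0.
Qed.

Lemma integral_fibers (mu : {measure set T1 -> \bar R}) (C : countType) (c : T1 -> C)
    (A : set T1) (f : T1 -> \bar R) : discrete c -> measurable A ->
  measurable_fun A f -> (forall w, 0 <= f w) ->
  \int[mu]_(w in A) f w = \sum_(n <oo) \int[mu]_(w in A `&` [set w | choice.pickle (c w) = n]) f w.
Proof.
move=> mc mA mf f0; rewrite {1}(setI_fibers c A) ge0_integral_bigcup //.
- by move=> n; exact: fibers_measurable.
- by rewrite -setI_fibers.
- exact: fibers_trivIset.
Qed.

End measure_partition.

Lemma eq_measure_fibers (R : realType) d1 d2 (T1 : measurableType d1) (T2 : measurableType d2)
    (mu : {measure set T1 -> \bar R}) (nu : {measure set T2 -> \bar R})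
    (C : countType) (c1 : T1 -> C) (c2 : T2 -> C) (A : set T1) (B : set T2) :
  discrete c1 -> discrete c2 -> measurable A -> measurable B ->
  (forall x, mu (A `&` [set w | c1 w = x]) = nu (B `&` [set w | c2 w = x])) ->
  mu A = nu B.
Proof.
move=> m1 m2 mA mB H; apply/eqP; rewrite eq_le.
by rewrite (le_measure_fibers m1 m2) ?(le_measure_fibers m2 m1) // => x; rewrite H.
Qed.

Lemma null_fibers (R : realType) d (T : measurableType d)
    (mu : {measure set T -> \bar R}) (C : countType) (c : T -> C) (A : set T) :
  discrete c -> measurable A ->
  (forall x, mu (A `&` [set w | c w = x]) = 0%E) -> mu A = 0%E.
Proof.
move=> mc mA H; rewrite -(measure0 mu).
apply: (eq_measure_fibers mc mc mA measurable0) => x.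
by rewrite H set0I measure0.
Qed.

(** * The space of configurations *)

Fixpoint encode_ltree (t : ltree) : GenTree.tree int :=
  let: LNode l ts := t in GenTree.Node 0 (GenTree.Leaf l :: map encode_ltree ts).

Fixpoint decode_ltree (t : GenTree.tree int) : ltree :=
  match t with
  | GenTree.Node _ (GenTree.Leaf l :: ts) => LNode l (map decode_ltree ts)
  | _ => LNode 0 [::]
  end.

Lemma encode_ltreeK : cancel encode_ltree decode_ltree.
Proof.
elim/ltree_nested_ind => l ts IH /=; congr LNode.
by elim: ts IH => //= u us IHus [-> /IHus ->].
Qed.

HB.instance Definition _ := Countable.copy ltree (can_type encode_ltreeK).

Definition level := (ltree * seq ltree)%type.
Definition level0 : level := (LNode 0 [::], [::]).

HB.instance Definition _ := gen_eqMixin config.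
HB.instance Definition _ := gen_choiceMixin config.
HB.instance Definition _ := isPointed.Build config (fun=> level0).

Fixpoint prefix_of (s : seq level) (w : config) : Prop :=
  if s is x :: s' then w 0%N = x /\ prefix_of s' (fun n => w n.+1) else True.

Definition cylinders : set (set config) :=
  [set A | A = set0 \/ exists s, A = prefix_of s].

Definition mconfig := g_sigma_algebraType cylinders.

Lemma prefix_ofE s w : prefix_of s w <-> mkseq w (size s) = s.
Proof.
elim: s w => //= x s IH w.
rewrite /mkseq /= (iotaDl 1 0) -map_comp; split.
  by move=> [-> /IH H]; congr (_ :: _); rewrite -[RHS]H.
by move=> [-> e]; split => //; apply/IH; rewrite -[RHS]e.
Qed.

(** Prefixes form a tree, so cylinders are stable under intersection up to the empty set. This is
    what the uniqueness theorem for measures asks of a generator. *)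
Lemma prefix_of_cmp s s' :
  [\/ forall w, prefix_of s w -> prefix_of s' w -> False,
      forall w, prefix_of s w -> prefix_of s' w |
      forall w, prefix_of s' w -> prefix_of s w].
Proof.
elim: s s' => [|x s IH] [|y s'] /=; try by [constructor 2|constructor 3].
have [<-|xy] := eqVneq x y; last first.
  by constructor 1 => w [-> _] [e _]; rewrite e eqxx in xy.
case: (IH s') => H; [constructor 1|constructor 2|constructor 3].
- by move=> w [_ /H h] [_ /h].
- by move=> w [e /H h].
- by move=> w [e /H h].
Qed.

Lemma cylinders_setI : setI_closed cylinders.
Proof.
move=> A B [->|[s ->]]; first by left; rewrite set0I.
move=> [->|[s' ->]]; first by left; rewrite setI0.
case: (prefix_of_cmp s s') => H.
- by left; apply/seteqP; split => // w [/H h /h].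
- by right; exists s; apply/seteqP; split => w //=; [case|move=> h; split => //; exact: H].
- by right; exists s'; apply/seteqP; split => w //=; [case|move=> h; split => //; exact: H].
Qed.

Lemma measurable_prefix s : measurable (prefix_of s : set mconfig).
Proof. by apply: sub_sigma_algebra; right; exists s. Qed.

Lemma measurable_local (N : nat) (p : config -> Prop) :
  (forall w w', (forall n, (n < N)%N -> w n = w' n) -> p w -> p w') ->
  measurable ([set w | p w] : set mconfig).
Proof.
move=> loc; rewrite (_ : [set w | p w] = [set w | exists s : seq level,
    prefix_of s w /\ (size s = N /\ p (nth level0 s))]).
  by apply: m_ex => s; apply: m_and; [exact: measurable_prefix|exact: m_cst].
apply/seteqP; split => w /=.
  move=> pw; exists (mkseq w N); rewrite size_mkseq; split.
    by apply/prefix_ofE; rewrite size_mkseq.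
  by split => //; apply: loc pw => n ltn; rewrite nth_mkseq.
case=> s [/prefix_ofE e [sN ps]]; apply: loc ps => n ltn.
by rewrite -e nth_mkseq ?sN.
Qed.

Lemma discrete_local (C : Type) (N : nat) (c : config -> C) :
  (forall w w', (forall n, (n < N)%N -> w n = w' n) -> c w = c w') ->
  discrete (c : mconfig -> C).
Proof.
move=> loc x; apply: (measurable_local (N := N)) => w w' e <-.
by apply: loc => n ltn; rewrite e.
Qed.

Lemma measure_config_unique (R : realType) (mu nu : {measure set mconfig -> \bar R}) :
  (forall s, mu (prefix_of s) = nu (prefix_of s)) -> (mu setT < +oo)%E ->
  forall A, measurable A -> mu A = nu A.
Proof.
move=> H fin A mA; pose g (n : nat) : set mconfig := prefix_of [::].
have Gg i : cylinders (g i) by right; exists [::].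
have gcov : \bigcup_k g k = setT by apply/seteqP; split => // w _; exists 0%N.
apply: (@measure_unique _ R mconfig cylinders g erefl cylinders_setI Gg gcov mu nu _ _ A mA).
- by move=> B [->|[s ->]]; rewrite ?measure0.
- by move=> k; rewrite (_ : g k = setT) //; apply/seteqP.
Qed.

Lemma discrete_corner i : discrete (fun w : mconfig => wcorner w i).
Proof. by apply: (discrete_local (N := (absz i).+2)) => w w'; exact: corner_ext. Qed.

Lemma discrete_lab i : discrete (fun w : mconfig => wlab w i).
Proof. by apply: (discrete_local (N := (absz i).+2)) => w w' /corner_ext; rewrite /clab => ->. Qed.

Lemma discrete_vert i : discrete (fun w : mconfig => wvert w i).
Proof. by apply: (discrete_local (N := (absz i).+2)) => w w' /corner_ext; rewrite /cvert => ->. Qed.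

Lemma measurable_succ i j : measurable ([set w | wsucc w i j] : set mconfig).
Proof.
apply: (@m_and _ mconfig); first exact: m_cst.
apply: (@m_and _ mconfig).
  apply: (measurable_local (N := (maxn (absz i) (absz j)).+2)) => w w' e.
  have ei : wcorner w i = wcorner w' i by apply: corner_ext => n ltn; apply: e; lia.
  have ej : wcorner w j = wcorner w' j by apply: corner_ext => n ltn; apply: e; lia.
  by rewrite /clab ei ej.
apply: (@m_all _ mconfig) => k; apply: m_imp; first exact: m_cst.
apply: m_imp; first exact: m_cst.
apply: m_not; apply: (measurable_local (N := (maxn (absz i) (absz k)).+2)) => w w' e.
have ei : wcorner w i = wcorner w' i by apply: corner_ext => n ltn; apply: e; lia.
have ek : wcorner w k = wcorner w' k by apply: corner_ext => n ltn; apply: e; lia.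
by rewrite /clab ei ek.
Qed.

Lemma measurable_worg e v : measurable ([set w | worg w e v] : set mconfig).
Proof.
have mS i : measurable ([set w | exists j, wsucc w i j] : set mconfig).
  by apply: (@m_ex _ mconfig) => j; exact: measurable_succ.
case: e => i [] /=.
  apply: (@m_ex _ mconfig) => j; apply: m_and; [exact: measurable_succ|exact: discrete_vert].
by apply: (@m_and _ mconfig); [exact: mS|exact: discrete_vert].
Qed.

Lemma measurable_nbr e e' : measurable ([set w | nbr w e e'] : set mconfig).
Proof.
apply: (@m_ex _ mconfig) => v; apply: m_and; last exact: measurable_worg.
rewrite (_ : [set w | _] = [set w | worg w (reve e) v]); first exact: measurable_worg.
by apply/seteqP; split => w; move/org_reve.
Qed.

Lemma measurable_good : measurable ([set w | good w] : set mconfig).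
Proof.
rewrite (_ : [set w | _] = [set w | (forall i : int, `|wlab w (i + 1) - wlab w i| <= 1) /\
   ((forall z (n : nat), exists k, (n <= k)%N /\ wlab w (Posz k) = z) /\
    (forall z (n : nat), exists k, (n <= k)%N /\ wlab w (Negz k) = z))]); last first.
  by apply/seteqP; split => w; [case|case=> ? []; split].
apply: (@m_and _ mconfig); last apply: (@m_and _ mconfig).
- apply: (@m_all _ mconfig) => i.
  apply: (measurable_local (N := (maxn (absz i) (absz (i + 1)%R)).+2)) => w w' e.
  have ei : wcorner w i = wcorner w' i by apply: corner_ext => n ltn; apply: e; lia.
  have ej : wcorner w (i + 1) = wcorner w' (i + 1) by apply: corner_ext => n ltn; apply: e; lia.
  by rewrite /clab ei ej.
- apply: (@m_all _ mconfig) => z; apply: (@m_all _ mconfig) => n; apply: (@m_ex _ mconfig) => k.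
  by apply: m_and; [exact: m_cst|exact: discrete_lab].
- apply: (@m_all _ mconfig) => z; apply: (@m_all _ mconfig) => n; apply: (@m_ex _ mconfig) => k.
  by apply: m_and; [exact: m_cst|exact: discrete_lab].
Qed.

Lemma reroot_local n (w w' : config) : (forall k, (k <= n.+1)%N -> w k = w' k) ->
  reroot w n = reroot w' n.
Proof.
move=> e; have e0 : w 0%N = w' 0%N by apply: e.
have e1 : w 1%N = w' 1%N by apply: e.
rewrite /reroot /shift_config /reroot_abs /lft e0.
case: (children (w' 0%N).1) => [|u us]; rewrite ?e1; case: n e => [|[|n]] e //=.
- by rewrite (e 2%N).
- by rewrite (e n.+3).
- by rewrite (e n.+1) //; lia.
Qed.

Lemma measurable_reroot : measurable_fun setT (reroot : mconfig -> mconfig).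
Proof.
apply: (@measurability _ _ mconfig mconfig setT reroot cylinders erefl).
move=> _ [B [->|[s ->]] <-]; rewrite setTI; first by rewrite preimage_set0; exact: measurable0.
rewrite (_ : _ @^-1` _ = [set w | mkseq (reroot w) (size s) = s]); last first.
  by apply/seteqP; split => w /prefix_ofE.
apply: (measurable_local (N := (size s).+1)) => w w' e <-.
rewrite size_mkseq; apply/eq_in_map => n; rewrite mem_iota add0n => /andP[_ ltn].
by symmetry; apply: reroot_local => k lek; apply: e; lia.
Qed.

(** * The law of the configuration *)

(** The proof [mf] is an argument of the function so that its measure structure can be inferred from
    the term. *)
Definition image_measure {d1 d2} {T1 : measurableType d1} {T2 : measurableType d2}
    {R : realType} (m : {measure set T1 -> \bar R}) (f : T1 -> T2)
    (mf : measurable_fun setT f) : set T2 -> \bar R := fun A => m (f @^-1` A).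

Section image_measure.
Context {d1 d2 : measure_display} {T1 : measurableType d1} {T2 : measurableType d2}.
Context {R : realType} (m : {measure set T1 -> \bar R}) (f : T1 -> T2).
Context (mf : measurable_fun setT f).

Let preimage_measurable A : measurable A -> measurable (f @^-1` A).
Proof. by move=> mA; rewrite -[X in measurable X]setTI; exact: mf. Qed.

Let image0 : image_measure m mf set0 = 0%E.
Proof. by rewrite /image_measure preimage_set0 measure0. Qed.

Let image_ge0 A : (0 <= image_measure m mf A)%E.
Proof. exact: measure_ge0. Qed.

Let image_sigma_additive : semi_sigma_additive (image_measure m mf).
Proof.
move=> F mF tF mUF; rewrite /image_measure preimage_bigcup.
apply: measure_semi_sigma_additive.
- by move=> n; exact: preimage_measurable.
- apply/trivIsetP => /= i j _ _ ij; rewrite -preimage_setI.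
  by move/trivIsetP : tF => /(_ _ _ _ _ ij) ->//; rewrite preimage_set0.
- by rewrite -preimage_bigcup; exact: preimage_measurable.
Qed.

HB.instance Definition _ := isMeasure.Build _ _ _
  (image_measure m mf) image0 image_ge0 image_sigma_additive.

Lemma ge0_integral_image (g : T2 -> \bar R) (D : set T2) : measurable D ->
  measurable_fun setT g -> (forall y, 0 <= g y)%E ->
  (\int[image_measure m mf]_(y in D) g y = \int[m]_(x in f @^-1` D) g (f x))%E.
Proof.
move=> mD mg g0; rewrite -(ge0_integral_pushforward mf m) //.
exact: measurable_funS mg.
Qed.

End image_measure.

Lemma le_measure_mod_null (R : realType) d (T : measurableType d)
    (mu : {measure set T -> \bar R}) (N A B : set T) :
  measurable N -> measurable A -> measurable B -> mu N = 0%E ->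
  (forall w, ~ N w -> A w -> B w) -> (mu A <= mu B)%E.
Proof.
move=> mN mA mB N0 H; rewrite -[leRHS]adde0 -N0.
apply: (le_trans _ (measureU2 mu mB mN)).
apply: le_measure; rewrite ?inE //; first exact: measurableU.
by move=> w Aw; have [Nw|nNw] := pselect (N w); [right|left; exact: H].
Qed.

Lemma eq_measure_mod_null (R : realType) d (T : measurableType d)
    (mu : {measure set T -> \bar R}) (N A B : set T) :
  measurable N -> measurable A -> measurable B -> mu N = 0%E ->
  (forall w, ~ N w -> (A w <-> B w)) -> mu A = mu B.
Proof.
move=> mN mA mB N0 H; apply/eqP.
by rewrite eq_le !(@le_measure_mod_null _ _ _ _ N) // => w /H; tauto.
Qed.

Section weights.
Context {R : realType}.

Definition level_w (x : level) : R :=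
  rho_w R x.1 * rho_w R (LNode (root_label x.1) x.2).

Fixpoint chain_w (r : int) (s : seq level) : R :=
  if s is x :: s' then step_w R r (root_label x.1) * level_w x * chain_w (root_label x.1) s'
  else 1.

Definition config_w (s : seq level) : R :=
  if s is x :: s' then
    (if root_label x.1 == 0 then 1 else 0) * level_w x * chain_w (root_label x.1) s'
  else 1.

Lemma rho_wE l ts : rho_w R (LNode l ts) =
  2%:R ^- (size ts).+1 * \prod_(u <- ts) (incr_w R l (root_label u) * rho_w R u).
Proof.
rewrite /=; congr (_ * _).
by elim: ts => [|u us IH]; rewrite ?big_nil // big_cons IH.
Qed.

#[local] Opaque rho_w.

Lemma incr_wC (l l' : int) : incr_w R l l' = incr_w R l' l.
Proof. by rewrite /incr_w distrC. Qed.

Lemma step_wE : step_w R = incr_w R.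
Proof. by []. Qed.

Lemma incr_w_shift c (l l' : int) : incr_w R (l + c) (l' + c) = incr_w R l l'.
Proof. by rewrite /incr_w; congr (if `|_| <= _ then _ else _); lia. Qed.

Lemma rho_w_shl c t : rho_w R (shl c t) = rho_w R t.
Proof.
elim/ltree_nested_ind: t => l ts IH; rewrite [shl _ _]/= !rho_wE size_map big_map.
congr (_ * _); elim: ts IH => [|u us IHus] /=; first by rewrite !big_nil.
by case=> IHu /IHus e; rewrite !big_cons e IHu root_shl incr_w_shift.
Qed.

Lemma level_wE a rs : level_w (a, rs) = rho_w R a * (2%:R ^- (size rs).+1 *
  \prod_(u <- rs) (incr_w R (root_label a) (root_label u) * rho_w R u)).
Proof. by rewrite /level_w rho_wE. Qed.

Definition shl_level (c : int) (x : level) : level := (shl c x.1, map (shl c) x.2).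

Lemma shl_levelK c : cancel (shl_level c) (shl_level (- c)).
Proof.
by move=> [t ts]; rewrite /shl_level /= shlK -map_comp map_id_in // => u _; exact: shlK.
Qed.

Lemma shl_levelNK c : cancel (shl_level (- c)) (shl_level c).
Proof. by move=> x; rewrite -{1}(opprK c) shl_levelK. Qed.

Lemma level_w_shl c x : level_w (shl_level c x) = level_w x.
Proof.
rewrite /level_w rho_w_shl root_shl.
by rewrite -(rho_w_shl c (LNode _ x.2)).
Qed.

Lemma chain_w_shl c r s : chain_w (r + c) (map (shl_level c) s) = chain_w r s.
Proof.
elim: s r => //= x s IH r.
by rewrite level_w_shl root_shl step_wE incr_w_shift IH.
Qed.

End weights.

#[local] Opaque rho_w.

(* The prefix of a configuration w with root label 0 such that [reroot w] has
   the given prefix; a cylinder is pulled back to a cylinder of the same weight. *)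
Definition unroot_prefix (s : seq level) : seq level :=
  match s with
  | (a, [::]) :: (b, rs) :: s' =>
      map (shl_level (- root_label b))
        ((LNode (root_label b) (a :: children b), rs) :: s')
  | (a, r0 :: rs) :: s' =>
      map (shl_level (- root_label r0))
        ((LNode (root_label r0) [::], children r0) :: (a, rs) :: s')
  | _ => s
  end.

(** The geometric law gives one factor 1/2 per vertex and one per child. Exchanging a spine edge for
    a tree edge trades the factor of an empty tree for that of an additional child, and the label
    factors agree because the uniform step is symmetric. *)
Lemma config_w_unroot (R : realType) s : (1 < size s)%N ->
  (if s is x :: _ then root_label x.1 == 0 else true) ->
  config_w (unroot_prefix s) = config_w s :> R.
Proof.
case: s => [|[a [|r0 rs]] s] //=.
  case: s => [|[b rs] s] //= _ ra0.
  rewrite ra0 addrN eqxx !mul1r.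
  rewrite -[in chain_w 0 _](addrN (root_label b)) chain_w_shl.
  set c := - root_label b.
  rewrite level_w_shl.
  rewrite mulrA; congr (_ * _); rewrite /level_w /= !rho_wE.
  rewrite big_cons big_nil /= (eqP ra0) step_wE.
  have -> : rho_w R b = 2%:R ^- (size (children b)).+1 *
      \prod_(u <- children b) (incr_w R (root_label b) (root_label u) * rho_w R u).
    by rewrite {1}(ltreeE b) rho_wE.
  rewrite (exprS _ (size (children b)).+1) invfM incr_wC.

  by rewrite !mulr1 !expr1; ring.
move=> _ ra0; rewrite addrN ra0 eqxx !mul1r.
set c := - root_label r0.
rewrite !level_w_shl.
rewrite root_shl -[in step_w _ 0](addrN (root_label r0)) -/c chain_w_shl step_wE incr_w_shift.
set Ch := chain_w _ _; rewrite !level_wE big_cons ![root_label (LNode _ _)]/= (eqP ra0).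
have -> : rho_w R r0 = 2%:R ^- (size (children r0)).+1 *
    \prod_(u <- children r0) (incr_w R (root_label r0) (root_label u) * rho_w R u).
  by rewrite {1}(ltreeE r0) rho_wE.
rewrite rho_wE !big_nil ![size [::]]/= ![size (_ :: _)]/=.
rewrite incr_wC (exprS _ (size rs).+1) invfM.
by rewrite !mulr1 !expr1; ring.
Qed.

Lemma prefix_shift c s w :
  prefix_of s (shift_config c w) <-> prefix_of (map (shl_level (- c)) s) w.
Proof.
elim: s w => //= x s IH w; rewrite -(IH (fun n => w n.+1)).
split=> -[e H]; split => //.
  by rewrite -e; exact/esym/shl_levelK.
by rewrite -[LHS]/(shl_level c (w 0%N)) e shl_levelNK.
Qed.

Lemma reroot_leaf w : children (w 0%N).1 = [::] ->
  reroot w = fun n => shl_level (- root_label (w 1%N).1)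
    (if n is 0 then ((w 1%N).1, LNode (root_label (w 0%N).1) (w 0%N).2 :: (w 1%N).2)
     else w n.+1).
Proof. by move=> leaf; rewrite /reroot /reroot_abs leaf. Qed.

Lemma reroot_node w u us : children (w 0%N).1 = u :: us ->
  reroot w = fun n => shl_level (- root_label u)
    (match n with
     | 0 => (u, [::])
     | 1 => (LNode (root_label (w 0%N).1) us, (w 0%N).2)
     | n'.+1 => w n'
     end).
Proof. by move=> node; rewrite /reroot /reroot_abs node. Qed.

(** Two levels are needed because re-rooting mixes S(0) and S(1). Since the old root has label 0,
    the label it carries in [s] is exactly the shift applied by [reroot], so the shift can be undone
    from [s] alone. *)
Lemma prefix_reroot s w : (1 < size s)%N ->
  (if s is x :: _ then root_label x.1 == 0 else true) -> root_label (w 0%N).1 = 0 ->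
  (prefix_of s (reroot w) <-> prefix_of (unroot_prefix s) w).
Proof.
case: s => [|[a [|r0 rs]] s] //.
  case: s => [|[b rs] s] // _ /eqP ra0 rw0.
  case e: (children (w 0%N).1) => [|u us].
    rewrite (reroot_leaf e) /=; split=> [[[]] //|[ew _]].
    by rewrite ew in e.
  have ew : w 0%N = (LNode 0 (u :: us), (w 0%N).2).
    by rewrite [LHS]surjective_pairing {1}(ltreeE (w 0%N).1) e rw0.
  rewrite (reroot_node e) /= rw0.
  rewrite -[prefix_of s _]/(prefix_of s (shift_config (- root_label u) (fun n => w n.+1))).
  rewrite prefix_shift opprK {2}ew; split.
    case=> -[eu] [[eb ers] H]; have rb : root_label b = - root_label u.
      by rewrite -eb /= add0r.
    rewrite rb opprK; split => //.
    rewrite /shl_level -ers -eb -eu /= ?addNr ?addrN; congr (_, _); last first.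
      by rewrite -map_comp map_id_in // => x _; exact: shlNK.
    congr (LNode _ (_ :: _)); first by rewrite shlNK.
    by rewrite -map_comp map_id_in // => x _; exact: shlNK.
  case=> -[_ eu eus ers] H.
  have ru : root_label u = - root_label b by rewrite eu root_shl ra0 add0r.
  rewrite ru opprK; split; last split => //.
    by rewrite eu /shl_level /= shlNK.
  rewrite ers eus /shl_level /= add0r -!map_comp.
  by rewrite !(map_id_in (f := _ \o _)) -?(ltreeE b) // => x _; exact: shlNK.
move=> _ /eqP ra0 rw0.
case e: (children (w 0%N).1) => [|u us]; last first.
  rewrite (reroot_node e) /=; split=> [[[]] //|[ew _]].
  by rewrite ew in e.
have ew : w 0%N = (LNode 0 [::], (w 0%N).2).
  by rewrite [LHS]surjective_pairing {1}(ltreeE (w 0%N).1) e rw0.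
rewrite (reroot_leaf e) /= rw0.
set c := - root_label (w 1%N).1.
rewrite -[prefix_of s _]/(prefix_of s (shift_config c (fun n => w n.+2))).
rewrite prefix_shift (surjective_pairing (w 1%N)); split.
  case=> -[ea er0 ers] H; have rr : root_label r0 = c by rewrite -er0 /= add0r.
  rewrite rr; split; last split => //.
    rewrite [LHS]ew /shl_level /= addrN -er0 /= -map_comp; congr (_, _).
    by rewrite map_id_in // => x _; exact: shlK.
  rewrite /shl_level /= -ea -ers shlK -map_comp; congr (_, _).
  by rewrite map_id_in // => x _; exact: shlK.
case=> -[e0] [[e1 e2] H].
have rr : c = root_label r0 by rewrite /c e1 root_shl ra0 add0r opprK.
rewrite rr; split => //.
rewrite e1 e2 e0 /shl_level /= !shlNK add0r -!map_comp; congr (_, _ :: _).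
  by rewrite map_id_in -?(ltreeE r0) // => x _; exact: shlNK.
by rewrite map_id_in // => x _; exact: shlNK.
Qed.

(** * Re-rooting invariance *)

Definition config_law (R : realType) (mu : {measure set mconfig -> \bar R}) :=
  forall s, mu (prefix_of s) = (config_w s)%:E.

Section invariance.
Context {R : realType} (mu : {measure set mconfig -> \bar R}).
Context (law : config_law mu).

Lemma config_law_setT : mu setT = 1%E.
Proof.
have -> : [set: config] = prefix_of [::] by apply/seteqP.
by rewrite law.
Qed.

Lemma discrete_level n : discrete (fun w : mconfig => w n).
Proof. by apply: (discrete_local (N := n.+1)) => w w' ->. Qed.

Lemma root0_ae : mu [set w | root_label (w 0%N).1 <> 0] = 0%E.
Proof.
have m : measurable ([set w | root_label (w 0%N).1 <> 0] : set mconfig).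
  exact: (discrete_pred (fun x : level => root_label x.1 <> 0) (discrete_level 0)).
apply: (null_fibers (discrete_level 0) m) => x.
have [r0|r0] := eqVneq (root_label x.1) 0.
  rewrite (_ : _ `&` _ = set0) ?measure0 //.
  by apply/seteqP; split => // w [/= H ew]; apply: H; rewrite ew.
apply/eqP; rewrite -measure_le0 -[leRHS](_ : mu (prefix_of [:: x]) = 0%E); last first.
  by rewrite law /= (negPf r0) !mul0r.
apply: le_measure; rewrite ?inE; last by move=> w [_ ew]; split.
  by apply: measurableI => //; exact: discrete_level.
exact: measurable_prefix.
Qed.

Lemma measurable_reroot_pre (A : set mconfig) : measurable A ->
  measurable (reroot @^-1` A : set mconfig).
Proof. by move=> mA; rewrite -[X in measurable X]setTI; exact: measurable_reroot. Qed.

Lemma reroot_invariant (A : set mconfig) : measurable A -> mu (reroot @^-1` A) = mu A.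
Proof.
have key s : (1 < size s)%N -> mu (reroot @^-1` (prefix_of s)) = mu (prefix_of s).
  move=> s2.
  have [rs0|rs0] := boolP (if s is x :: _ then root_label x.1 == 0 else true).
    rewrite [RHS]law -config_w_unroot // -law.
    apply: (eq_measure_mod_null _ _ _ root0_ae).
    - exact: (discrete_pred (fun x : level => root_label x.1 <> 0) (discrete_level 0)).
    - exact: (measurable_reroot_pre (measurable_prefix _)).
    - exact: measurable_prefix.
    - by move=> w /contrapT rw; exact: prefix_reroot.
  (* Re-rooting normalises the root label to 0: the preimage is empty, and the weight of [s]
     vanishes as well. *)
  rewrite (_ : _ @^-1` _ = set0).
    rewrite measure0 law; case: s rs0 {s2} => //= x s.
    by case: eqP => // _; rewrite !mul0r.
  apply/seteqP; split => // w; case: s s2 rs0 => //= x s _ rs0 [ex _]; move: rs0.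
  by rewrite -ex /= root_shl addrN eqxx.
move=> mA; apply: (measure_config_unique (mu := image_measure mu measurable_reroot)) mA.
  move=> s; rewrite /image_measure.
  (* [key] requires two levels; a prefix of length 1 is cut along the value of level 1. *)
  have [/key //|] := ltnP 1 (size s); case: s => [|x [|y s]] // _.
  have mp s : measurable (reroot @^-1` prefix_of s : set mconfig).
    exact: (measurable_reroot_pre (measurable_prefix _)).
  apply: (@eq_measure_fibers _ _ _ _ _ mu mu _ (fun w => reroot w 1%N) (fun w => w 1%N)) => //.
  - move=> y; apply: (discrete_local (N := 3)) => w w' eww.
    by apply: reroot_local => k lek; exact: eww.
  - exact: discrete_level.
  - exact: measurable_prefix.
  - move=> y; have := key [:: x; y] isT => /=.
    rewrite (_ : _ @^-1` _ = (reroot @^-1` (fun w => w 0%N = x /\ True)) `&` [set w | reroot w 1%N = y]).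
      move=> ->; congr (mu _); apply/seteqP; split => w /=; tauto.
    by apply/seteqP; split => w /=; tauto.
by rewrite -[X in (X < _)%E]/(mu setT) config_law_setT ltry.
Qed.

Lemma ge0_integral_reroot (f : config -> \bar R) :
  measurable_fun setT (f : mconfig -> \bar R) -> (forall w, 0 <= f w)%E ->
  (\int[mu]_w f (reroot w) = \int[mu]_w f w)%E.
Proof.
move=> mf f0; transitivity (\int[image_measure mu measurable_reroot]_w f w)%E.
  exact/esym/(ge0_integral_image mu measurable_reroot measurableT mf f0).
by apply: eq_measure_integral => A mA _; exact: reroot_invariant.
Qed.

End invariance.

(** * Almost every configuration is good *)

Lemma le_measure_fibersM (R : realType) d (T : measurableType d)
    (mu : {measure set T -> \bar R}) (C : countType) (c : T -> C) (A B : set T) (k : R) :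
  discrete c -> measurable A -> measurable B -> 0 <= k ->
  (forall x, (mu (A `&` [set w | c w = x]) <= k%:E * mu (B `&` [set w | c w = x]))%E) ->
  (mu A <= k%:E * mu B)%E.
Proof.
move=> mc mA mB k0 H; rewrite (measure_fibers mu mc mA) (measure_fibers mu mc mB).
rewrite -nneseriesZl //; apply: lee_nneseries => n _ //; rewrite !setI_fiberE.
by case: pickle_inv => // ; rewrite !measure0 mule0.
Qed.

(** * The spine labels are unbounded above and below *)

Section spine.
Context {R : realType} (mu : {measure set mconfig -> \bar R}).
Context (law : config_law mu).
Local Notation spine n w := (root_label (w n%N).1).

Lemma config_w_rcons s y : s <> [::] -> config_w (rcons s y) =
  config_w s * (step_w R (root_label (last level0 s).1) (root_label y.1) * level_w y).
Proof.
have chain r t z : @chain_w R r (rcons t z) =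
    chain_w r t * (step_w R (last r (map (fun x : level => root_label x.1) t)) (root_label z.1) * level_w z).
  by elim: t r => [|x t IH] r /=; rewrite ?mulr1 ?mul1r // IH !mulrA.
case: s => // x s _; rewrite /= chain (last_map (fun x : level => root_label x.1)) !mulrA.
by case: s => //= y' s; rewrite (last_map (fun x : level => root_label x.1)).
Qed.

Lemma prefix_rcons s y (w : config) : prefix_of (rcons s y) w <-> prefix_of s w /\ w (size s) = y.
Proof.
elim: s w => [|x s IH] w /=; first by tauto.
by rewrite (IH (fun n => w n.+1)); tauto.
Qed.

Lemma measure_prefix_fiber s x :
  mu (prefix_of s `&` [set w | w (size s) = x]) = (config_w (rcons s x))%:E.
Proof.
by rewrite -law; congr (mu _); apply/seteqP; split => w /=; rewrite prefix_rcons.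
Qed.

Lemma discrete_spine n : discrete (fun w : mconfig => spine n w).
Proof. by apply: (discrete_local (N := n.+1)) => w w' ->. Qed.

Lemma measurable_prefixI s (p : config -> Prop) : measurable ([set w | p w] : set mconfig) ->
  measurable (prefix_of s `&` [set w | p w] : set mconfig).
Proof. by move=> mp; apply: measurableI => //; exact: measurable_prefix. Qed.

(** Translating the labels of the next level by 1 preserves its weight, so neighbouring admissible
    values of the next spine label have equal mass. In this way the total mass of the tree weights
    never has to be computed. *)
Lemma step_shift_eq s (x : int) : s <> [::] ->
  `|x - root_label (last level0 s).1| <= 1 -> `|x + 1 - root_label (last level0 s).1| <= 1 ->
  mu (prefix_of s `&` [set w | spine (size s) w = x]) =
  mu (prefix_of s `&` [set w | spine (size s) w = x + 1]).
Proof.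
move=> s0 h1 h2.
apply: (@eq_measure_fibers _ _ _ _ _ mu mu _ (fun w => w (size s))
   (fun w => shl_level (- 1) (w (size s)))).
- exact: discrete_level.
- move=> z; exact: (discrete_pred (fun y => shl_level (-1) y = z) (discrete_level (size s))).
- by apply: measurable_prefixI; exact: discrete_spine.
- by apply: measurable_prefixI; exact: discrete_spine.
move=> z; rewrite -!setIA.
have [rz|rz] := eqVneq (root_label z.1) x; last first.
  rewrite (_ : [set w | spine (size s) w = x] `&` _ = set0); last first.
    by apply/seteqP; split => // w [/= e ez]; rewrite -e ez eqxx in rz.
  rewrite (_ : [set w | spine (size s) w = x + 1] `&` _ = set0) //.
  apply/seteqP; split => // w [/= e ez]; move: rz; rewrite -ez /= root_shl e.
  by rewrite addrK eqxx.
rewrite (_ : [set w | spine (size s) w = x] `&` _ = [set w | w (size s) = z]); last first.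
  by apply/seteqP; split => w /= [] // ->.
rewrite (_ : [set w | spine (size s) w = x + 1] `&` _ =
    [set w | w (size s) = shl_level 1 z]); last first.
  apply/seteqP; split => w /=.
    by case=> _ <-; rewrite shl_levelNK.
  by move=> ->; rewrite shl_levelK root_shl rz.
rewrite !measure_prefix_fiber; congr EFin; rewrite !config_w_rcons // level_w_shl.
by rewrite root_shl rz /step_w h1 h2.
Qed.

(** The three admissible values have equal masses and disjoint fibres inside the cylinder. Only this
    upper bound on the transition probability is used. *)
Lemma step_third s (x : int) : s <> [::] -> `|x - root_label (last level0 s).1| <= 1 ->
  (mu (prefix_of s `&` [set w | spine (size s) w = x]) <= (config_w s / 3%:R)%:E)%E.
Proof.
move=> s0 hx; set x0 := root_label (last level0 s).1.
pose S y := prefix_of s `&` [set w | spine (size s) w = y] : set mconfig.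
have mS y : measurable (S y) by apply: measurable_prefixI; exact: discrete_spine.
have e1 : mu (S (x0 - 1)) = mu (S x0).
  by rewrite -{2}(subrK 1 x0); apply: step_shift_eq => //; rewrite ?subrK ?subrr // -/x0; lia.
have e2 : mu (S x0) = mu (S (x0 + 1)).
  by apply: step_shift_eq => //; rewrite -/x0; lia.
have ex : mu (S x) = mu (S x0).
  have [->|[->|->]] : x = x0 - 1 \/ x = x0 \/ x = x0 + 1 by move: hx; rewrite -/x0; lia.
  - exact: e1.
  - by [].
  - by rewrite e2.
have fin : mu (S x0) \is a fin_num.
  rewrite ge0_fin_numE //; apply: (@le_lt_trans _ _ (mu (prefix_of s))).
    by apply: le_measure; rewrite ?inE //; [exact: measurable_prefix|move=> w []].
  by rewrite law ltry.
have sum : (mu (S (x0 - 1)%R) + mu (S x0) + mu (S (x0 + 1)%R) <= mu (prefix_of s))%E.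
  have d1 : S (x0 - 1) `&` S x0 = set0.
    by apply/seteqP; split => // w [[_ /= h3] [_ /= h4]]; lia.
  have d2 : (S (x0 - 1) `|` S x0) `&` S (x0 + 1) = set0.
    by apply/seteqP; split => // w [[] [_ /= h3] [_ /= h4]]; lia.
  have mU : measurable (S (x0 - 1) `|` S x0) by exact: measurableU.
  rewrite -(measureU mu (mS _) (mS _) d1) -(measureU mu mU (mS _) d2).
  apply: le_measure; rewrite ?inE; [|exact: measurable_prefix|].
    by apply: measurableU => //; exact: measurableU.
  by move=> w [[]|] [].
rewrite -/(S x) ex; move: sum; rewrite e1 -e2 law -(fineK fin) -!EFinD !lee_fin.
by rewrite ler_pdivlMr // => le; lra.
Qed.

Lemma spine_step_null n : mu [set w | ~ `|spine n.+1 w - spine n w| <= 1] = 0%E.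
Proof.
have m1 : measurable ([set w | ~ `|spine n.+1 w - spine n w| <= 1] : set mconfig).
  by apply: (measurable_local (N := n.+2)) => w w' e; rewrite !e.
have dm : discrete (fun w : mconfig => mkseq w n.+2).
  apply: (discrete_local (N := n.+2)) => w w' e.
  by apply/eq_in_map => k; rewrite mem_iota => /andP[_ /e].
apply: (null_fibers dm m1) => s.
have [ss|ss] := eqVneq (size s) n.+2; last first.
  rewrite (_ : _ `&` _ = set0) ?measure0 //; apply/seteqP; split => // w [_ /= es].
  by rewrite -es size_mkseq eqxx in ss.
case/lastP: s ss => // s y; rewrite size_rcons => -[ss].
have [st|/negP st] := boolP (`|root_label y.1 - root_label (last level0 s).1| <= 1).
  rewrite (_ : _ `&` _ = set0) ?measure0 //; apply/seteqP; split => // w [/= H es].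
  apply: H; move: st.
  have : nth level0 (mkseq w n.+2) n.+1 = y by rewrite es nth_rcons ss ltnn eqxx.
  have : nth level0 (mkseq w n.+2) n = last level0 s.
    by rewrite es nth_rcons ss ltnSn -nth_last ss.
  by rewrite !nth_mkseq // => -> ->.
apply/eqP; rewrite -measure_le0 -[leRHS](_ : mu (prefix_of (rcons s y)) = 0%E); last first.
  rewrite law config_w_rcons; last by case: s ss {st}.
  by rewrite /step_w (negPf (introN idP st)) mul0r mulr0.
apply: le_measure; rewrite ?inE; last first.
- by move=> w [_ /= es]; apply/prefix_ofE; rewrite size_rcons ss.
- exact: measurable_prefix.
- by apply: measurableI => //; exact: dm.
Qed.

(* The probability that a walk with uniform steps in {-1, 0, 1} stays at most y
   above its starting point during N steps. *)
Fixpoint stay_w (N : nat) (y : int) : R :=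
  if 0 <= y then
    if N is N'.+1 then (stay_w N' (y - 1) + stay_w N' y + stay_w N' (y + 1)) / 3%:R else 1
  else 0.

Lemma stay_wS N y : stay_w N.+1 y =
  if 0 <= y then (stay_w N (y - 1) + stay_w N y + stay_w N (y + 1)) / 3%:R else 0.
Proof. by []. Qed.

Lemma stay_w_ge0 N y : 0 <= stay_w N y.
Proof.
elim: N y => [|N IH] y /=; case: ifP => // _.
by rewrite divr_ge0 // !addr_ge0.
Qed.

Lemma stay_w_le1 N y : stay_w N y <= 1.
Proof.
elim: N y => [|N IH] y /=; case: ifP => // _.
by rewrite ler_pdivrMr // mul1r; have := IH (y - 1); have := IH y; have := IH (y + 1); lra.
Qed.

Lemma stay_w_decr N y : stay_w N.+1 y <= stay_w N y.
Proof.
elim: N y => [|N IH] y.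
  by have := stay_w_le1 1 y; rewrite /=; case: ifP.
rewrite stay_wS [leRHS]stay_wS; case: ifP => // _.
rewrite ler_pM2r ?invr_gt0 //.
by have := IH (y - 1); have := IH y; have := IH (y + 1); lra.
Qed.

(** The decreasing limit u vanishes on negative integers and satisfies 2 u(z) = u(z-1) + u(z+1) for
    z >= 0, hence u(k) = (k+1) u(0). Boundedness by 1 forces u(0) = 0. *)
Lemma stay_w_cvg0 y : (fun N => stay_w N y) @ \oo --> (0 : R).
Proof.
have cv z : cvgn (fun N => stay_w N z).
  apply: nonincreasing_is_cvgn.
    by apply/nonincreasing_seqP => N; exact: stay_w_decr.
  by exists 0 => _ [N _ <-]; exact: stay_w_ge0.
pose u z := limn (fun N => stay_w N z).
have u_ge0 z : 0 <= u z by apply: limr_ge => //; apply: nearW => N; exact: stay_w_ge0.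
have u_le1 z : u z <= 1 by apply: limr_le => //; apply: nearW => N; exact: stay_w_le1.
have uneg z : z < 0 -> u z = 0.
  move=> z0; rewrite /u (_ : (fun N => _) = fun=> 0) ?lim_cst //.
  by apply/funext => -[|N] /=; rewrite leNgt z0.
have urec z : 0 <= z -> 2 * u z = u (z - 1) + u (z + 1).
  move=> z0; have : u z = (u (z - 1) + u z + u (z + 1)) / 3%:R; last by move=> h; lra.
  apply/cvg_lim => //; rewrite -(cvg_shiftn 1).
  rewrite (_ : (fun n => _) = fun N => (stay_w N (z - 1) + stay_w N z + stay_w N (z + 1)) / 3%:R).
    by apply: cvgMl; apply: cvgD; [apply: cvgD|]; exact: cv.
  by apply/funext => N; rewrite addn1 /= z0.
have ulin (k : nat) : u k%:Z = k.+1%:R * u 0 /\ u k.+1%:Z = k.+2%:R * u 0.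
  elim: k => [|k [IH1 IH2]].
    have := urec 0 (lexx _); rewrite sub0r add0r (uneg (-1)) // add0r => <-.
    by rewrite mul1r.
  split => //; have := urec k.+1%:Z isT.
  rewrite (_ : k.+1%:Z - 1 = k%:Z); last by lia.
  rewrite (_ : k.+1%:Z + 1 = k.+2%:Z); last by lia.
  rewrite IH1 IH2 -(natr1 k.+2) -(natr1 k.+1); lra.
have u00 : u 0 = 0.
  apply/eqP; rewrite eq_le u_ge0 andbT leNgt; apply/negP => u0.
  have := archi_boundP (ltW (eqbRL (invr_gt0 (u 0)) u0)).
  set k := Num.bound _; rewrite -(ltr_pM2r u0) mulVf ?gt_eqF // => hk.
  have := u_le1 k%:Z; rewrite (ulin k).1 -natr1 mulrDl mul1r.
  by lra.
have -> : 0 = u y; last exact: cv.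
have [y0|y0] := ltP y 0; first by rewrite uneg.
by rewrite (_ : y = (absz y)%:Z); [rewrite (ulin _).1 u00 mulr0|lia].
Qed.

Definition sgn_int (e : bool) (x : int) : int := if e then x else - x.

Lemma measurable_stay e k N (m : int) : measurable
  ([set w | forall n, (n <= N)%N -> sgn_int e (spine (k + n) w) <= m] : set mconfig).
Proof.
apply: (measurable_local (N := (k + N).+1)) => w w' eww H n len.
by rewrite -eww ?H // ltnS leq_add2l.
Qed.

(** Induction on [N] over all prefixes: fixing the next level gives a longer prefix, and
    [step_third] weighs the three possible spine labels. The index [(size s).-1] is the level of the
    last entry, where the walk currently stands. *)
Lemma stay_bound e N s (m : int) : s <> [::] ->
  (mu (prefix_of s `&`
     [set w | forall n, (n <= N)%N -> (sgn_int e (spine ((size s).-1 + n) w) <= m)%R]) <=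
   (stay_w N (m - sgn_int e (root_label (last level0 s).1))%R)%:E * mu (prefix_of s))%E.
Proof.
elim: N s => [|N IH] s s0; set x0 := root_label (last level0 s).1.
all: have sp0 w : prefix_of s w -> spine (size s).-1 w = x0.
1,3: by move/prefix_ofE => es; rewrite /x0 -nth_last -es nth_mkseq ?size_mkseq //;
  case: (s) s0.
all: have [y0|y0] := leP 0 (m - sgn_int e x0); last first.
1,3: rewrite (_ : _ `&` _ = set0) ?measure0;
    [by rewrite mule_ge0 // lee_fin stay_w_ge0|];
    apply/seteqP; split => // w [/sp0 e0 /= /(_ 0%N isT)]; rewrite addn0 e0; lia.
  rewrite /= y0 mul1e; apply: le_measure; rewrite ?inE; last by move=> w [].
    by apply: measurable_prefixI; exact: measurable_stay.
  exact: measurable_prefix.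
set A := _ `&` _.
have mA : measurable (A : set mconfig) by apply: measurable_prefixI; exact: measurable_stay.
pose S y := prefix_of s `&` [set w | spine (size s) w = y] : set mconfig.
have mS y : measurable (S y) by apply: measurable_prefixI; exact: discrete_spine.
have sz : (size s).-1.+1 = size s by case: (s) s0.
have part x : `|x - x0| <= 1 ->
    (mu (A `&` [set w | spine (size s) w = x]) <=
     (stay_w N (m - sgn_int e x) * (config_w s / 3%:R))%:E)%E.
  move=> hx; apply: (@le_trans _ _ ((stay_w N (m - sgn_int e x)%R)%:E * mu (S x))%E); last first.
    by rewrite EFinM lee_wpmul2l ?lee_fin ?stay_w_ge0 // step_third.
  apply: (@le_measure_fibersM _ _ _ mu _ (fun w : mconfig => w (size s))) => //.
  - exact: discrete_level.
  - by apply: measurableI => //; exact: discrete_spine.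
  - exact: stay_w_ge0.
  move=> z; have [rz|rz] := eqVneq (root_label z.1) x; last first.
    rewrite (_ : A `&` _ `&` _ = set0) ?measure0 ?mule_ge0 ?lee_fin ?stay_w_ge0 //.
    by apply/seteqP; split => // w [[_ /= h] h']; rewrite -h h' eqxx in rz.
  have := IH (rcons s z) (ltac:(by case: (s))).
  rewrite last_rcons rz size_rcons /=.
  rewrite (_ : S x `&` _ = prefix_of (rcons s z)); last first.
    apply/seteqP; split => w /=; rewrite prefix_rcons; first by move=> [[? _] ?].
    by move=> [ps ew]; split => //; split => //=; rewrite ew.
  apply: le_trans; apply: le_measure; rewrite ?inE.
  - apply: measurableI; last exact: discrete_level.
    by apply: measurableI => //; exact: discrete_spine.
  - by apply: measurable_prefixI; exact: measurable_stay.
  move=> w [[[ps st] _] /= ew]; split; first by rewrite prefix_rcons.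
  by move=> n len; have := st n.+1 len; rewrite -addSnnS sz.
(* Off this null set the next spine label takes one of three values, so [A] is covered by the three
   fibres [A1], [A2], [A3]. *)
have mbad : measurable ([set w | ~ `|spine (size s) w - spine (size s).-1 w| <= 1] : set mconfig).
  by apply: (measurable_local (N := (size s).+1)) => w w' eww; rewrite !eww //; lia.
have bad0 : mu [set w | ~ `|spine (size s) w - spine (size s).-1 w| <= 1] = 0%E.
  by rewrite -{1}sz; exact: spine_step_null.
pose A1 := A `&` [set w | spine (size s) w = x0 - 1].
pose A2 := A `&` [set w | spine (size s) w = x0].
pose A3 := A `&` [set w | spine (size s) w = x0 + 1].
have mAi y : measurable (A `&` [set w | spine (size s) w = y] : set mconfig).
  by apply: measurableI => //; exact: discrete_spine.
have mA12 : measurable (A1 `|` A2 : set mconfig) by apply: measurableU; exact: mAi.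
have mA123 : measurable (A1 `|` A2 `|` A3 : set mconfig).
  by apply: measurableU => //; exact: mAi.
have le123 : (mu A <= mu A1 + mu A2 + mu A3)%E.
  rewrite -[leRHS]adde0 -bad0.
  apply: (@le_trans _ _ (mu ((A1 `|` A2 `|` A3) `|`
      [set w | ~ `|spine (size s) w - spine (size s).-1 w| <= 1]))).
    apply: le_measure; rewrite ?inE //; first exact: measurableU.
    move=> w Aw; have [st|] := pselect (`|spine (size s) w - spine (size s).-1 w| <= 1); last by right.
    left; move: st; rewrite (sp0 _ Aw.1) => st.
    have [h|[h|h]] : spine (size s) w = x0 - 1 \/ spine (size s) w = x0 \/
        spine (size s) w = x0 + 1 by lia.
    - by left; left.
    - by left; right.
    - by right.
  apply: (le_trans (measureU2 mu mA123 mbad)); rewrite leeD2r //.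
  apply: (le_trans (measureU2 mu mA12 (mAi _))); rewrite leeD2r //.
  exact: (measureU2 mu (mAi _) (mAi _)).
apply: (le_trans le123).
have p1 : (mu A1 <= (stay_w N (m - sgn_int e (x0 - 1)) * (config_w s / 3%:R))%:E)%E.
  by apply: part; rewrite (_ : x0 - 1 - x0 = -1) //; lia.
have p2 : (mu A2 <= (stay_w N (m - sgn_int e x0) * (config_w s / 3%:R))%:E)%E.
  by apply: part; rewrite subrr.
have p3 : (mu A3 <= (stay_w N (m - sgn_int e (x0 + 1)) * (config_w s / 3%:R))%:E)%E.
  by apply: part; rewrite (_ : x0 + 1 - x0 = 1) //; lia.
apply: (le_trans (leeD (leeD p1 p2) p3)).
rewrite law -!EFinD -EFinM lee_fin stay_wS y0 -!mulrDl.
have -> : stay_w N (m - sgn_int e (x0 - 1)) + stay_w N (m - sgn_int e x0) +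
    stay_w N (m - sgn_int e (x0 + 1)) =
    stay_w N (m - sgn_int e x0 - 1) + stay_w N (m - sgn_int e x0) +
    stay_w N (m - sgn_int e x0 + 1).
  have -> : m - sgn_int e (x0 - 1) = if e then m - sgn_int e x0 + 1 else m - sgn_int e x0 - 1.
    by rewrite /sgn_int; case: (e); lia.
  have -> : m - sgn_int e (x0 + 1) = if e then m - sgn_int e x0 - 1 else m - sgn_int e x0 + 1.
    by rewrite /sgn_int; case: (e); lia.
  by case: (e) => //; rewrite addrC addrA addrAC.
by rewrite mulrA mulrAC.
Qed.

Lemma ae_all (C : countType) (p : C -> mconfig -> Prop) :
  (forall c, \forall w \ae mu, p c w) -> \forall w \ae mu, forall c, p c w.
Proof.
move=> H; have : \forall w \ae mu, forall n, if pickle_inv n is Some c then p c w else True.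
  by apply: ae_foralln => n; case: (pickle_inv n) => [c|]; [exact: H|exact: aeW].
by apply: filterS => w h c; have := h (choice.pickle c); rewrite pickleK_inv.
Qed.

Lemma ae_not (p : mconfig -> Prop) : measurable ([set w | ~ p w] : set mconfig) ->
  mu [set w | ~ p w] = 0%E -> \forall w \ae mu, p w.
Proof. by move=> mp p0; exists [set w | ~ p w]; split. Qed.

Lemma measurable_stayT e (m : int) : measurable
  ([set w | forall n, sgn_int e (spine n w) <= m] : set mconfig).
Proof.
apply: (@m_all _ mconfig) => n.
by apply: (measurable_local (N := n.+1)) => w w' eww; rewrite eww.
Qed.

Lemma spine_unbounded e (m : int) : mu [set w | forall n, sgn_int e (spine n w) <= m] = 0%E.
Proof.
set A := [set w | _]; have mA : measurable (A : set mconfig) := measurable_stayT e m.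
have le N : (mu A <= (stay_w N m)%:E)%E.
  have : (mu A <= (stay_w N m)%:E * mu setT)%E.
    apply: (@le_measure_fibersM _ _ _ mu _ (fun w : mconfig => w 0%N)) => //.
    - exact: discrete_level.
    - exact: stay_w_ge0.
    move=> x; rewrite setTI.
    have -> : [set w : config | w 0%N = x] = prefix_of [:: x].
      by apply/seteqP; split => w //=; case.
    have [r0|r0] := eqVneq (root_label x.1) 0; last first.
      apply: (@le_trans _ _ (mu (prefix_of [:: x]))); last by rewrite law /= (negPf r0) !mul0r mule0.
      apply: le_measure; rewrite ?inE; last exact: subIsetr.
        by apply: measurableI => //; exact: measurable_prefix.
      exact: measurable_prefix.
    have := @stay_bound e N [:: x] m (ltac:(by [])); rewrite [last _ _]/= r0.
    have -> : m - sgn_int e 0 = m by rewrite /sgn_int; case: (e); lia.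
    apply: le_trans; apply: le_measure; rewrite ?inE.
    - by apply: measurableI => //; exact: measurable_prefix.
    - by apply: (@measurable_prefixI [:: x]); exact: (measurable_stay e 0).
    - by move=> w [Aw px]; split => // n _; exact: Aw.
  by rewrite (config_law_setT law) mule1.
have fA : mu A \is a fin_num.
  by rewrite ge0_fin_numE // (le_lt_trans (le 0%N)) ?ltry.
have : fine (mu A) <= 0.
  rewrite -(cvg_lim _ (stay_w_cvg0 m)) //.
  apply: limr_ge; first by apply/cvg_ex; exists 0; exact: stay_w_cvg0.
  by apply: nearW => N; rewrite -lee_fin fineK.
by rewrite -lee_fin fineK // measure_le0 => /eqP.
Qed.

End spine.

Lemma walk_visits (x : nat -> int) : (forall n, `|x n.+1 - x n| <= 1) ->
  (forall m : int, exists n, m < x n) -> (forall m : int, exists n, x n < m) ->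
  forall z n0, exists n, (n0 <= n)%N /\ x n = z.
Proof.
move=> step0 up down z n0.
have step n : -1 <= x n.+1 - x n /\ x n.+1 - x n <= 1.
  by apply/andP; rewrite -ler_norml.
have bound n : x 0%N - n%:Z <= x n /\ x n <= x 0%N + n%:Z.
  by elim: n => [|n [IH1 IH2]]; [lia|have := step n; lia].
have [a [lea xa]] : exists a, (n0 <= a)%N /\ x a < z.
  (* With unit steps, a value below [x 0 - n0] cannot be reached before time [n0]; the choice of [b]
     below uses the same device. *)
  have [a xa] := down (Num.min z (x 0%N - n0%:Z)); exists a.
  by have := bound a; move: xa; rewrite lt_min => /andP[]; lia.
have [b [leb xb]] : exists b, (a <= b)%N /\ z < x b.
  have [b xb] := up (Num.max z (x 0%N + a%:Z)); exists b.
  by have := bound b; move: xb; rewrite gt_max => /andP[]; lia.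
apply: contrapT => H.
have below k : x (a + k)%N < z.
  elim: k => [|k IH]; first by rewrite addn0.
  have : x (a + k.+1)%N <> z by move=> e; apply: H; exists (a + k.+1)%N; split => //; lia.
  by have := step (a + k)%N; rewrite addnS; lia.
by have := below (b - a)%N; rewrite subnKC //; lia.
Qed.

Section good_ae.
Context {R : realType} (mu : {measure set mconfig -> \bar R}).
Context (law : config_law mu).

(** Invariance equates the masses at i and i+1, so nullity at the root spreads to positive and to
    negative corners alike. *)
Lemma null_reroot (B : int -> config -> Prop) :
  (forall i, measurable ([set w | B i w] : set mconfig)) ->
  (forall (i : int) w, B i (reroot w) <-> B (i + 1) w) ->
  mu [set w | B 0 w] = 0%E -> forall i, mu [set w | B i w] = 0%E.
Proof.
move=> mB eB B0; have step (i : int) : mu [set w | B (i + 1) w] = mu [set w | B i w].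
  rewrite -[RHS](reroot_invariant law) //; congr (mu _).
  by apply/seteqP; split => w /= /eB.
have pos (n : nat) : mu [set w | B n%:Z w] = 0%E.
  by elim: n => // n IH; rewrite -addn1 PoszD step.
have neg (n : nat) : mu [set w | B (- n%:Z) w] = 0%E.
  elim: n => [|n IH]; first by rewrite oppr0.
  by rewrite -step (_ : - n.+1%:Z + 1 = - n%:Z) //; lia.
move=> i; have [i0|i0] := leP 0 i.
  by rewrite (_ : i = (absz i)%:Z); [exact: pos|lia].
by rewrite (_ : i = - (absz i)%:Z); [exact: neg|lia].
Qed.

(** After re-rooting only c_0 and c_1 matter. Their labels are those of the two ends of one tree
    edge or one spine edge, whose factor in the weight vanishes when the labels differ by more than
    1. *)
Lemma lab_step_null i : mu [set w | ~ `|wlab w (i + 1) - wlab w i| <= 1] = 0%E.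
Proof.
pose B (i : int) (w : config) := ~ `|wlab w (i + 1) - wlab w i| <= 1.
have mB j : measurable ([set w | B j w] : set mconfig).
  apply: (measurable_local (N := (maxn (absz j) (absz (j + 1)%R)).+2)) => w w' e.
  have ei : wcorner w j = wcorner w' j by apply: corner_ext => n ltn; apply: e; lia.
  have ej : wcorner w (j + 1) = wcorner w' (j + 1) by apply: corner_ext => n ltn; apply: e; lia.
  by rewrite /B /clab ei ej.
apply: (null_reroot (B := B)) => //.
  by move=> j w; rewrite /B !lab_reroot (_ : _ - _ - _ = wlab w (j + 1 + 1) - wlab w (j + 1)) //; lia.
have lab0 w : wlab w 0 = root_label (w 0%N).1 by rewrite /clab corner0.
have lab1 w : wlab w 1 = if children (w 0%N).1 is u :: _ then root_label u else root_label (w 1%N).1.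
  have e := corner_reroot_abs w 0; rewrite corner0 add0r in e.
  have -> : wlab w 1 = (phi w (wcorner w 1)).2 by [].
  rewrite -e [LHS]/=.
  by rewrite /lft /reroot_abs; case: (children (w 0%N).1).
have dm : discrete (fun w : mconfig => mkseq w 2).
  by apply: (discrete_local (N := 2)) => w w' e; rewrite /mkseq /= !e.
apply: (null_fibers dm (mB 0)) => s.
case: s => [|x [|y [|? ?]]]; try by rewrite (_ : _ `&` _ = set0) ?measure0 //;
  apply/seteqP; split => // w [].
have [st|st] := pselect (`|(if children x.1 is u :: _ then root_label u else root_label y.1) - root_label x.1| <= 1).
  rewrite (_ : _ `&` _ = set0) ?measure0 //; apply/seteqP; split => // w [/= H [e0 e1]].
  by apply: H; rewrite add0r lab0 lab1 e0 e1.
apply/eqP; rewrite -measure_le0 -[leRHS](_ : mu (prefix_of [:: x; y]) = 0%E); last first.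
  rewrite law /= mulr1; case: x st => [t rs] /=; case: t => l [|u us] /= st.
    by rewrite /step_w (introF idP st) !(mul0r, mulr0).
  by rewrite /level_w /= rho_wE big_cons /incr_w (introF idP st) !(mul0r, mulr0).
apply: le_measure; rewrite ?inE; [|exact: measurable_prefix|].
  by apply: measurableI => //; exact: dm.
by move=> w [_ /= [e0 e1]].
Qed.

Lemma good_ae : {ae mu, forall w : mconfig, good w}.
Proof.
have h1 : {ae mu, forall w : mconfig, forall i : int, `|wlab w (i + 1) - wlab w i| <= 1}.
  apply: ae_all => i; apply: ae_not; last exact: lab_step_null.
  apply: m_not; apply: (measurable_local (N := (maxn (absz i) (absz (i + 1)%R)).+2)) => w w' e.
  have ei : wcorner w i = wcorner w' i by apply: corner_ext => n ltn; apply: e; lia.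
  have ej : wcorner w (i + 1) = wcorner w' (i + 1) by apply: corner_ext => n ltn; apply: e; lia.
  by rewrite /clab ei ej.
have h2 : {ae mu, forall w : mconfig, forall n, `|root_label (w n.+1).1 - root_label (w n).1| <= 1}.
  apply: ae_all => n; apply: ae_not; last exact: spine_step_null.
  by apply: m_not; apply: (measurable_local (N := n.+2)) => w w' e; rewrite !e.
have h3 : {ae mu, forall w : mconfig, forall (e : bool) (m : int),
    ~ forall n, sgn_int e (root_label (w n).1) <= m}.
  apply: ae_all => e; apply: ae_all => m; apply: ae_not.
    by apply: m_not; apply: m_not; exact: measurable_stayT.
  rewrite (_ : [set w | _] = [set w | forall n, sgn_int e (root_label (w n).1) <= m]).
    exact: spine_unbounded.
  by apply/seteqP; split => w; [move/contrapT|move=> h; apply].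
move: h1 h2 h3; apply: filterS3 => w h1 h2 h3.
have vis : forall z n0, exists n, (n0 <= n)%N /\ root_label (w n).1 = z.
  apply: walk_visits => // m.
    apply: contrapT => H; apply: (h3 true m) => n /=.
    by rewrite leNgt; apply/negP => lt; apply: H; exists n.
  apply: contrapT => H; apply: (h3 false (- m)) => n /=.
  by rewrite lerN2 leNgt; apply/negP => lt; apply: H; exists n.
split => // z n.
  have [k [lek ek]] := vis z n; have [j [lej ej]] := lab_left_root w k.
  by exists j; split; [exact: leq_trans lej|rewrite ej].
have [k [lek ek]] := vis z n.+1; case: k lek ek => // k lek ek.
have [j [lej ej]] := lab_right_root w k.
by exists j; split; [exact: leq_trans lej|rewrite ej].
Qed.

End good_ae.

(** * Expectations of bounded measurable functions *)

Section expectation.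
Context {R : realType} {d : measure_display} {T : measurableType d}.
Context (mu : {measure set T -> \bar R}).
Context (muT : mu setT = 1%E).

Definition bm (f : T -> R) := measurable_fun setT f /\ exists M, forall w, `|f w| <= M.

Definition Ex (f : T -> R) : R := \int[mu]_w f w.

Lemma bm_integrable f : bm f -> mu.-integrable setT (EFin \o f).
Proof.
move=> [mf [M fM]]; apply: measurable_bounded_integrable => //.
  by rewrite muT ltry.
exists M; split; first exact: num_real.
by move=> x xM w _ /=; apply: le_trans (fM w) (ltW xM).
Qed.

Lemma bm_cst r : bm (fun=> r).
Proof. by split; [exact: measurable_cst|exists `|r|]. Qed.

Lemma bmD f g : bm f -> bm g -> bm (fun w => f w + g w).
Proof.
move=> [mf [M fM]] [mg [M' gM]]; split; first exact: measurable_funD.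
by exists (M + M') => w; apply: le_trans (ler_normD _ _) (lerD _ _).
Qed.

Lemma bmM f g : bm f -> bm g -> bm (fun w => f w * g w).
Proof.
move=> [mf [M fM]] [mg [M' gM]]; split; first exact: measurable_funM.
exists (M * M') => w; rewrite normrM.
by rewrite ler_pM.
Qed.

Lemma bmZ r f : bm f -> bm (fun w => r * f w).
Proof. exact/bmM/bm_cst. Qed.

Lemma bm01 (f : T -> R) : measurable_fun setT f -> (forall w, 0 <= f w <= 1) -> bm f.
Proof. by move=> mf f01; split => //; exists 1 => w; have /andP[f0 ?] := f01 w; rewrite ger0_norm. Qed.

Lemma ExD f g : bm f -> bm g -> Ex (fun w => f w + g w) = Ex f + Ex g.
Proof. by move=> bf bg; apply: RintegralD => //; exact: bm_integrable. Qed.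

Lemma ExZ r f : bm f -> Ex (fun w => r * f w) = r * Ex f.
Proof. by move=> bf; apply: RintegralZl => //; exact: bm_integrable. Qed.

Lemma Ex_EFin f : bm f -> (Ex f)%:E = (\int[mu]_w (f w)%:E)%E.
Proof.
move=> bf; rewrite /Ex /Rintegral fineK //; apply: integrable_fin_num => //.
exact: bm_integrable.
Qed.

Lemma Ex_ae_eq f g : bm f -> bm g -> {ae mu, forall w, f w = g w} -> Ex f = Ex g.
Proof.
move=> bf bg fg; rewrite /Ex /Rintegral; congr fine.
apply: ae_eq_integral => //.
- by apply/measurable_EFinP; case: bf.
- by apply/measurable_EFinP; case: bg.
- by apply: filterS fg => w /= -> _.
Qed.

Lemma Ex_ge0 (f : T -> R) : (forall w, 0 <= f w) -> 0 <= Ex f.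
Proof. by move=> f0; exact: Rintegral_ge0. Qed.

Lemma le_Ex f g : bm f -> bm g -> {ae mu, forall w, f w <= g w} -> Ex f <= Ex g.
Proof.
(* The maximum equals [g] almost everywhere and dominates [f] everywhere, which turns an almost sure
   inequality into a pointwise one. *)
move=> bf bg fg; pose g' w := Num.max (f w) (g w).
have bg' : bm g'.
  case: bf bg => [mf [M fM]] [mg [M' gM]]; split; first exact: measurable_maxr.
  exists (Num.max M M') => w; rewrite /g' le_max; case: (leP (f w) (g w)) => _.
    by rewrite gM orbT.
  by rewrite fM.
rewrite -(Ex_ae_eq bg' bg); last by apply: filterS fg => w le; rewrite /g' max_r.
apply: le_Rintegral => //; [exact: bm_integrable|exact: bm_integrable|].
by move=> w _; rewrite le_max lexx.
Qed.

Lemma Ex_cst r : Ex (fun=> r) = r.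
Proof. by rewrite /Ex Rintegral_cst // muT mulr1. Qed.

Lemma Ex_eq0 f : bm f -> (forall w, 0 <= f w) -> Ex f = 0 -> {ae mu, forall w, f w = 0}.
Proof.
move=> bf f0 E0; have mf : measurable_fun setT (EFin \o f) by apply/measurable_EFinP; case: bf.
have : (\int[mu]_w `|(EFin \o f) w| = 0)%E.
  rewrite (eq_integral (fun w => (f w)%:E)); first by rewrite -Ex_EFin // E0.
  by move=> w _ /=; rewrite ger0_norm.
by move/(ae_eq_integral_abs mu measurableT mf); apply: filterS => w /(_ I) /= [].
Qed.

Lemma Ex_cvg (f_ : nat -> T -> R) f M : (forall n, measurable_fun setT (f_ n)) ->
  (forall n w, `|f_ n w| <= M) -> (forall w, f_ ^~ w @ \oo --> f w) ->
  bm f /\ (fun n => Ex (f_ n)) @ \oo --> Ex f.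
Proof.
move=> mf fM cv; have mlim : measurable_fun setT f.
  exact: (measurable_fun_cvg mf (fun w _ => cv w)).
have bf : bm f.
  split => //; exists M => w.
  have cvn : (fun n => `|f_ n w|) @ \oo --> `|f w| by apply: cvg_norm; exact: cv.
  rewrite -(cvg_lim _ cvn) //; apply: limr_le; first by apply/cvg_ex; exists `|f w|.
  by apply: nearW => n; exact: fM.
have bfn n : bm (f_ n) by split => //; exists M.
split => //.
have mE g : measurable_fun setT g -> measurable_fun setT (EFin \o g : T -> \bar R).
  by move=> mg; exact/measurable_EFinP.
have cvE : {ae mu, forall w, setT w -> (fun n => (EFin \o f_ n) w) @ \oo --> (EFin \o f) w}.
  by apply: aeW => w _; apply/cvg_EFin; [exact: nearW|exact: cv].
have ig : mu.-integrable setT (cst M%:E).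
  by apply: (bm_integrable (bm_cst M)).
have dom : {ae mu, forall w n, setT w -> (`|(EFin \o f_ n) w| <= cst M%:E w)%E}.
  by apply: aeW => w n _; rewrite lee_fin.
have [_ _ H] := dominated_convergence measurableT (fun n => mE _ (mf n)) (mE _ mlim) cvE ig dom.
by rewrite -(Ex_EFin bf) in H; exact: fine_cvg H.
Qed.

End expectation.

(** * The random walk operator and mass transport *)

Lemma fset_set_infinite (T : choiceType) (A : set T) : ~ finite_set A -> fset_set A = fset0.
Proof. by move=> nfA; rewrite /fset_set; case: pselect. Qed.

(* The junk value [fset0] is never met for good w, by [nbr_finite]. *)
Definition nb (w : config) (e : oedge) : {fset oedge} := fset_set [set e' | nbr w e e'].

Lemma in_nb w e e' : good w -> (e' \in nb w e) <-> nbr w e e'.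
Proof.
move=> gw; rewrite /nb in_fset_set; last exact: nbr_finite.
by split; [move/set_mem|move=> h; exact/mem_set].
Qed.

Lemma nb_gt0 w e : good w -> (0 < #|` nb w e|)%N.
Proof.
move=> gw; rewrite cardfs_gt0; apply/fset0Pn; exists (reve e).
by apply/in_nb => //; exact: nbr_self.
Qed.

Lemma shifteK k : cancel (shifte k) (shifte (- k)).
Proof. by case=> i b; rewrite /shifte /= addrK. Qed.

Lemma shifteNK k : cancel (shifte (- k)) (shifte k).
Proof. by case=> i b; rewrite /shifte /= subrK. Qed.

Lemma nb_reroot w e : nb w (shifte 1 e) = (shifte 1 @` nb (reroot w) e)%fset.
Proof.
rewrite /nb; set B := [set e' | nbr (reroot w) e e'].
have eB : [set e' | nbr w (shifte 1 e) e'] = shifte 1 @` B.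
  apply/seteqP; split => [e' h|_ [e' /nbr_reroot h <-]] //.
  by exists (shifte (-1) e'); rewrite ?shifteNK //; apply/nbr_reroot; rewrite shifteNK.
rewrite eB; have [fB|nfB] := pselect (finite_set B); first by rewrite fset_set_image.
rewrite !fset_set_infinite //.
  by rewrite imfset0.
move=> fB; apply: nfB; have -> : B = shifte (-1) @` (shifte 1 @` B).
  by rewrite image_comp; apply/seteqP; split => [x Bx|_ [x Bx <-]] /=; rewrite ?shifteK //; exists x => //=; rewrite shifteK.
exact: finite_image.
Qed.

Lemma discrete_nb e : discrete (fun w : mconfig => nb w e).
Proof.
move=> A; have mfin : measurable ([set w | exists B : {fset oedge}, forall e', e' \in B <-> nbr w e e'] : set mconfig).
  apply: (@m_ex _ mconfig) => B; apply: (@m_all _ mconfig) => e'.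
  by apply: m_iff; [exact: m_cst|exact: measurable_nbr].
rewrite (_ : [set w | _] = [set w |
   ((exists B : {fset oedge}, forall e', e' \in B <-> nbr w e e') /\
     (forall e', e' \in A <-> nbr w e e')) \/
   ((~ exists B : {fset oedge}, forall e', e' \in B <-> nbr w e e') /\ A = fset0)]).
  apply: (@m_or _ mconfig).
    apply: (@m_and _ mconfig) => //; apply: (@m_all _ mconfig) => e'.
    by apply: m_iff; [exact: m_cst|exact: measurable_nbr].
  by apply: (@m_and _ mconfig); [exact: m_not|exact: m_cst].
have finP w : (exists B : {fset oedge}, forall e', e' \in B <-> nbr w e e') <->
    finite_set [set e' | nbr w e e'].
  split=> [[B HB]|fB].
    rewrite (_ : [set e' | _] = [set` B]); first exact: finite_fset.
    by apply/seteqP; split => e' /=; move/HB.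
  exists (fset_set [set e' | nbr w e e']) => e'; rewrite in_fset_set //.
  by split; [move/set_mem|move=> h; exact/mem_set].
apply/seteqP; split => w /=; rewrite finP.
  move=> <-; have [fB|nfB] := pselect (finite_set [set e' | nbr w e e']).
    left; split => // e'; rewrite /nb in_fset_set //.
    by split; [move/set_mem|move=> h; exact/mem_set].
  by right; split => //; rewrite /nb fset_set_infinite.
case=> [[fB HA]|[nfB ->]]; last by rewrite /nb fset_set_infinite.
apply/fsetP => e'; rewrite /nb in_fset_set //; apply/idP/idP => h.
  by apply/HA; exact: set_mem h.
by apply/mem_set; exact/HA.
Qed.

Section operators.
Context {R : realType}.
Implicit Types F G : config -> oedge -> R.

Definition Q F w e : R := (\sum_(e' <- nb w e) F w e') / #|` nb w e|%:R.
Definition J F w e : R := F w (reve e).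

Definition measurable_obs F := forall e, measurable_fun setT (fun w : mconfig => F w e).
Definition invariant_obs F := forall w e, F (reroot w) e = F w (shifte 1 e).
Definition obs F := [/\ measurable_obs F, forall w e, 0 <= F w e <= 1 & invariant_obs F].

Lemma measurable_Q F : measurable_obs F -> measurable_obs (Q F).
Proof.
move=> mF e; apply: (measurable_fun_glue (c := fun w : mconfig => nb w e)
  (F := fun A w => (\sum_(e' <- A) F w e') / #|` A|%:R)); first exact: discrete_nb.
move=> A; apply: measurable_funM => //.
rewrite (_ : (fun w => _) = (fun w => \sum_(e' <- enum_fset A) F w e')) //.
by apply: measurable_sum.
Qed.

Lemma invariant_Q F : invariant_obs F -> invariant_obs (Q F).
Proof.
move=> iF w e; rewrite /Q nb_reroot card_imfset /=; last exact: (can_inj (shifteK 1)).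
rewrite big_imfset /=; last by move=> x y _ _; exact: (can_inj (shifteK 1)).
by congr (_ / _); apply: eq_bigr => e' _; rewrite iF.
Qed.

Lemma le_Q F G w e : (forall e', F w e' <= G w e') -> Q F w e <= Q G w e.
Proof. by move=> FG; rewrite ler_wpM2r ?invr_ge0 //; apply: ler_sum. Qed.

Lemma Q_cst w e r : good w -> Q (fun _ _ => r) w e = r.
Proof.
move=> gw; rewrite /Q (_ : \sum_(e' <- nb w e) r = r * #|` nb w e|%:R); last first.
  by rewrite big_const_seq count_predT iter_addr_0 mulr_natr.
rewrite mulfK //.
by rewrite pnatr_eq0 -lt0n; exact: nb_gt0.
Qed.

Lemma QD F G w e : Q (fun w e => F w e + G w e) w e = Q F w e + Q G w e.
Proof. by rewrite /Q big_split /= mulrDl. Qed.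

Lemma QZ r F w e : Q (fun w e => r * F w e) w e = r * Q F w e.
Proof. by rewrite /Q -mulr_sumr mulrA. Qed.

Lemma eq_Q F G w e : (forall e', e' \in nb w e -> F w e' = G w e') -> Q F w e = Q G w e.
Proof. by move=> FG; rewrite /Q (eq_big_seq _ FG). Qed.

Lemma Q_01 F w e : (forall e', 0 <= F w e' <= 1) -> 0 <= Q F w e <= 1.
Proof.
move=> F01; apply/andP; split.
  by rewrite divr_ge0 // sumr_ge0 // => e' _; have /andP[] := F01 e'.
rewrite /Q; have [->|n0] := posnP #|` nb w e|; first by rewrite invr0 mulr0.
rewrite ler_pdivrMr ?ltr0n // mul1r.
apply: (@le_trans _ _ (\sum_(e' <- nb w e) (1 : R))).
  by apply: ler_sum => e' _; have /andP[] := F01 e'.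
by rewrite big_const_seq count_predT iter_addr_0.
Qed.

Lemma obs_Q F : obs F -> obs (Q F).
Proof.
by case=> mF F01 iF; split; [exact: measurable_Q|move=> w e; exact: Q_01|exact: invariant_Q].
Qed.

Lemma obs_J F : obs F -> obs (J F).
Proof. by case=> mF F01 iF; split=> [e|w e|w e]; [exact: mF|exact: F01|exact: iF]. Qed.

Lemma obs_cst r : 0 <= r <= 1 -> obs (fun _ _ => r).
Proof. by move=> r01; split=> // e; exact: measurable_cst. Qed.

Lemma obs_M F G : obs F -> obs G -> obs (fun w e => F w e * G w e).
Proof.
case=> mF F01 iF [mG G01 iG]; split=> [e|w e|w e].
- exact: measurable_funM.
- have /andP[f0 f1] := F01 w e; have /andP[g0 g1] := G01 w e.
  by rewrite mulr_ge0 //= mulr_ile1.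
- by rewrite iF iG.
Qed.

Lemma obs_sub F G : obs F -> obs G -> (forall w e, G w e <= F w e) ->
  obs (fun w e => F w e - G w e).
Proof.
case=> mF F01 iF [mG G01 iG] GF; split=> [e|w e|w e].
- exact: measurable_funB.
- have /andP[f0 f1] := F01 w e; have /andP[g0 g1] := G01 w e.
  by have := GF w e; lra.
- by rewrite iF iG.
Qed.

End operators.

Lemma tgt_uniq w e v v' : wtgt w e v -> wtgt w e v' -> v = v'.
Proof.
case: e => i [] /= [].
  by move=> _ <- [_ <-].
move=> j [[lj [ej Hj]] <-] [j' [[lj' [ej' Hj']] <-]].
suff -> : j' = j by [].
by have := Hj j' lj'; have := Hj' j lj; lia.
Qed.

Lemma org_uniq w e v v' : worg w e v -> worg w e v' -> v = v'.
Proof. by move=> /tgt_reve h /tgt_reve; exact: tgt_uniq. Qed.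

(** [reve e0] points to the origin of [e0], which is the target of [e], and [nb] depends on the
    target only. Hence a step and its reversal have the same weight, which is reversibility. *)
Lemma nb_eq w e e0 : good w -> e0 \in nb w e -> nb w (reve e0) = nb w e.
Proof.
move=> gw /in_nb-/(_ gw) [v [tv ov]]; apply/fsetP => x.
apply/idP/idP => /in_nb-/(_ gw) [v' [tv' ov']]; apply/in_nb => //; exists v; split => //.
- by move/tgt_reve: tv' => /(org_uniq ov) ->.
- exact/tgt_reve.
- by rewrite (tgt_uniq tv tv').
Qed.

Lemma nb_sym w e e0 : good w -> (e0 \in nb w e) = (reve e \in nb w (reve e0)).
Proof.
move=> gw; apply/idP/idP => /in_nb-/(_ gw) h; apply/in_nb => //.
  exact/nbr_reve.
exact/nbr_reve.
Qed.

Section esum_countable.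
Context {R : realType}.
Local Open Scope ereal_scope.

Lemma esum_pickle (C : countType) (a : C -> \bar R) : (forall c, 0 <= a c) ->
  \esum_(c in [set: C]) a c =
  \sum_(n <oo) (if pickle_inv n is Some c then a c else 0).
Proof.
move=> a0; rewrite nneseries_esumT; last by move=> n; case: pickle_inv.
rewrite (esumID (@choice.pickle C @` setT)); last by move=> n _; case: pickle_inv.
rewrite setTI [X in _ + X]esum1 ?adde0; last first.
  move=> n [_ /= nr]; case E: (pickle_inv n) => [c|] //; exfalso; apply: nr; exists c => //.
  by have := @pickle_invK C n; rewrite E.
rewrite (reindex_esum [set: C] (@choice.pickle C @` setT) (@choice.pickle C)).
  by apply: eq_esum => c _; rewrite pickleK_inv.
by split.
Qed.

Lemma integral_esum d (T : measurableType d) (mu : {measure set T -> \bar R})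
    (C : countType) (f : C -> T -> \bar R) :
  (forall c, measurable_fun setT (f c)) -> (forall c w, 0 <= f c w) ->
  \int[mu]_w (\esum_(c in [set: C]) f c w) = \esum_(c in [set: C]) \int[mu]_w f c w.
Proof.
move=> mf f0; rewrite esum_pickle; last by move=> c; exact: integral_ge0.
under eq_integral do rewrite esum_pickle //.
rewrite integral_nneseries //.
- apply: eq_eseriesr => n _; case: (pickle_inv n) => [c|] //.
  exact: integral0.
- by move=> n; case: (pickle_inv n) => [c|] //; exact: measurable_cst.
- by move=> n w _; case: (pickle_inv n).
Qed.

Lemma esum_edge (a : oedge -> \bar R) : (forall e, 0 <= a e) ->
  \esum_(e in [set: oedge]) a e =
  \esum_(i in [set: int]) a (i, false) + \esum_(i in [set: int]) a (i, true).
Proof.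
move=> a0; rewrite (esumID [set e : oedge | e.2 = false]) // !setTI; congr (_ + _).
  rewrite (reindex_esum [set: int] _ (fun i => (i, false))) //.
  split; [by move=> i _|by move=> i j _ _ []|].
  by move=> [i b] /= ->; exists i.
rewrite (reindex_esum [set: int] _ (fun i => (i, true))) //.
split; [by move=> i _|by move=> i j _ _ []|].
by move=> [i [|]] /= h; [exists i|exfalso; apply: h].
Qed.

Lemma esum_fsum (A : {fset oedge}) (a : oedge -> R) : (forall e, (0 <= a e)%R) ->
  \esum_(e in [set: oedge]) (if e \in A then a e else 0%R)%:E = (\sum_(e <- A) a e)%:E.
Proof.
move=> a0; transitivity (\esum_(e in [set` A]) (a e)%:E).
  rewrite [RHS]esum_mkcond; apply: eq_esum => e _.
  by rewrite mem_setE; case: ifP.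
rewrite esum_fset //; last by move=> e _; rewrite lee_fin.
by rewrite fsbig_finite //= set_fsetK sumEFin.
Qed.

End esum_countable.

Lemma diagonal_shift (X : Type) (a : int -> int -> X) (i j k : int) :
  (forall i j, a i j = a (i + 1) (j + 1)) -> a i j = a (i + k) (j + k).
Proof.
move=> step; have pos (n : nat) (i' j' : int) : a i' j' = a (i' + n%:Z) (j' + n%:Z).
  elim: n => [|n IH]; first by rewrite !addr0.
  by rewrite IH step -!addrA (_ : n%:Z + 1 = n.+1%:Z) //; lia.
have [k0|k0] := leP 0 k.
  by rewrite (_ : k = (absz k)%:Z); [exact: pos|lia].
rewrite (pos (absz k) (i + k) (j + k)).
by rewrite -!addrA (_ : k + (absz k)%:Z = 0) ?addr0 //; lia.
Qed.

(** * Mass transport and the adjoint of the walk operator *)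

Section adjoint.
Context {R : realType} (mu : {measure set mconfig -> \bar R}).
Context (law : config_law mu).

(** The mean over the two values of the Bernoulli variable, that is, over the orientations of the
    root arc. *)
Definition at_root (F : config -> oedge -> R) (w : config) : R :=
  2%:R^-1 * (F w (0, false) + F w (0, true)).

Definition Eroot F := Ex mu (at_root F).

Let muT : mu setT = 1%E := config_law_setT law.

Let K (F G : config -> oedge -> R) (w : config) (e e' : oedge) : R :=
  if e' \in nb w e then F w e * G w e' / #|` nb w e|%:R else 0.

Let measurable_K F G e e' : measurable_obs F -> measurable_obs G ->
  measurable_fun setT (fun w : mconfig => K F G w e e').
Proof.
move=> mF mG; apply: (measurable_fun_glue (c := fun w : mconfig => nb w e)
  (F := fun A w => if e' \in A then F w e * G w e' / #|` A|%:R else 0)); first exact: discrete_nb.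
move=> A; case: (e' \in A); last exact: measurable_cst.
by apply: measurable_funM => //; exact: measurable_funM.
Qed.

Let K_ge0 F G w e e' : obs F -> obs G -> 0 <= K F G w e e'.
Proof.
case=> _ F01 _ [_ G01 _]; rewrite /K; case: ifP => // _.
have /andP[f0 _] := F01 w e; have /andP[g0 _] := G01 w e'.
by rewrite divr_ge0 // mulr_ge0.
Qed.

Let K_reroot F G w e e' : obs F -> obs G ->
  K F G (reroot w) e e' = K F G w (shifte 1 e) (shifte 1 e').
Proof.
case=> _ _ iF [_ _ iG]; rewrite /K nb_reroot mem_imfset; last exact: (can_inj (shifteK 1)).
by rewrite card_imfset ?iF ?iG //; exact: (can_inj (shifteK 1)).
Qed.

Let intK F G e e' := (\int[mu]_w (K F G w e e')%:E)%E.

Let intK_shift F G (i j k : int) b b' : obs F -> obs G ->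
  intK F G (i, b) (j, b') = intK F G (i + k, b) (j + k, b').
Proof.
move=> oF oG.
have mE e e' : measurable_fun setT (fun w : mconfig => (K F G w e e')%:E).
  by apply/measurable_EFinP; apply: measurable_K; [case: oF|case: oG].
have step (i' j' : int) : intK F G (i', b) (j', b') = intK F G (i' + 1, b) (j' + 1, b').
  rewrite /intK -(ge0_integral_reroot law (mE _ _)); last by move=> w; rewrite lee_fin K_ge0.
  by apply: eq_integral => w _; rewrite K_reroot.
exact: (diagonal_shift (a := fun i j => intK F G (i, b) (j, b'))).
Qed.

Let intK_ge0 F G e e' : obs F -> obs G -> (0 <= intK F G e e')%E.
Proof. by move=> oF oG; apply: integral_ge0 => w _; rewrite lee_fin K_ge0. Qed.

Let sumK F G w e : obs F -> obs G ->
  (\esum_(e' in [set: oedge]) (K F G w e e')%:E)%E = (F w e * Q G w e)%:E.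
Proof.
move=> oF oG; rewrite /K esum_fsum; last first.
  move=> e'; case: oF oG => _ F01 _ [_ G01 _].
  have /andP[f0 _] := F01 w e; have /andP[g0 _] := G01 w e'.
  by rewrite divr_ge0 // mulr_ge0.
by congr EFin; rewrite -mulr_suml -mulr_sumr /Q mulrA.
Qed.

Let sumK' F G w e0 : obs F -> obs G -> good w ->
  (\esum_(e in [set: oedge]) (K F G w e e0)%:E)%E = (J (Q (J F)) w e0 * G w e0)%:E.
Proof.
move=> oF oG gw; rewrite (reindex_esum [set: oedge] [set: oedge] reve); last first.
  split => //; first by move=> x y _ _; exact: (inv_inj reveK).
  by move=> x _; exists (reve x); rewrite ?reveK.
transitivity (\esum_(i in [set: oedge])
    (if i \in nb w (reve e0) then J F w i * G w e0 / #|` nb w (reve e0)|%:R else 0)%:E)%E.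
  apply: eq_esum => i _; congr EFin; rewrite /K /J nb_sym // reveK.
  case: ifP => // h; congr (_ / _%:R).
  by rewrite (nb_eq (e := reve i)) // nb_sym // reveK.
rewrite esum_fsum; last first.
  move=> e; case: oF oG => _ F01 _ [_ G01 _]; rewrite /J.
  have /andP[f0 _] := F01 w (reve e); have /andP[g0 _] := G01 w e0.
  by rewrite divr_ge0 // mulr_ge0.
by congr EFin; rewrite -mulr_suml -mulr_suml /J /Q mulrAC.
Qed.

(** Let each edge e send mass [K F G w e e'] to its neighbours e'. The mass sent by a root edge is
    [F * Q G]; the mass it receives is [J (Q (J F)) * G], because a step from e to e' is a step from
    [reve e'] to [reve e] with the same weight. The mean of [K] depends only on the difference of
    the corner indices, so both totals agree once the two orientations are added. *)
Lemma adjoint F G : obs F -> obs G ->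
  Eroot (fun w e => F w e * Q G w e) = Eroot (fun w e => J (Q (J F)) w e * G w e).
Proof.
move=> oF oG.
have mE e e' : measurable_fun setT (fun w : mconfig => (K F G w e e')%:E).
  by apply/measurable_EFinP; apply: measurable_K; [case: oF|case: oG].
have o1 : obs (fun w e => F w e * Q G w e) by apply: obs_M => //; exact: obs_Q.
have o2 : obs (fun w e => J (Q (J F)) w e * G w e).
  by apply: obs_M => //; apply: obs_J; apply: obs_Q; exact: obs_J.
have Eroot2 H : obs H -> (Eroot H)%:E = ((2%:R^-1)%:E *
    (\int[mu]_w (H w (0, false))%:E + \int[mu]_w (H w (0, true))%:E))%E.
  case=> mH H01 _.
  have bH e : bm (fun w : mconfig => H w e) by exact: bm01.
  rewrite -!(Ex_EFin muT) // -EFinD -EFinM; congr EFin.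
  rewrite /Eroot /at_root (ExZ muT); last exact: bmD.
  by rewrite (ExD muT).
pose H1 w e := F w e * Q G w e; pose H2 w e := J (Q (J F)) w e * G w e.
have mH2 b : measurable_fun setT (fun w : mconfig => H2 w (0%R, b)).
  by case: o2 => m _ _; exact: (m (0, b)).
pose X b b' := (\esum_(i in [set: int]) intK F G (0%R, b) (i, b'))%E.
pose Y b b' := (\esum_(i in [set: int]) intK F G (i, b) (0%R, b'))%E.
have L b : (\int[mu]_w (H1 w (0%R, b))%:E = X b false + X b true)%E.
  rewrite -(esum_edge (a := fun e => intK F G (0%R, b) e)); last by move=> e; exact: intK_ge0.
  rewrite /intK -integral_esum //; last by move=> e w; rewrite lee_fin K_ge0.
  by apply: eq_integral => w _; rewrite sumK.
have L' b : (\int[mu]_w (H2 w (0%R, b))%:E = Y false b + Y true b)%E.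
  rewrite -(esum_edge (a := fun e => intK F G e (0%R, b))); last by move=> e; exact: intK_ge0.
  rewrite /intK -integral_esum //; last by move=> e w; rewrite lee_fin K_ge0.
  have mS : measurable_fun setT (fun w : mconfig =>
      (\esum_(e in [set: oedge]) (K F G w e (0%R, b))%:E)%E).
    rewrite (_ : (fun w => _) = (fun w : mconfig => (\sum_(n <oo)
        (if pickle_inv n is Some e then (K F G w e (0%R, b))%:E else 0))%E)).
      apply: ge0_emeasurable_sum => n; last first.
        by case: (pickle_inv n) => [e|] //; exact: measurable_cst.
      by move=> w _ _; case: (pickle_inv n) => [e|] //; rewrite lee_fin K_ge0.
    by apply/funext => w; rewrite esum_pickle // => e; rewrite lee_fin K_ge0.
  have ae_sum : {ae mu, forall w : mconfig, setT w ->
      ((H2 w (0%R, b))%:E = \esum_(e in [set: oedge]) (K F G w e (0%R, b))%:E)%E}.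
    have := good_ae law; apply: (@filterS _ _ (ae_filter_ringOfSetsType mu)) => w gw _.
    by rewrite sumK'.
  apply: ge0_ae_eq_integral => //.
  - by apply/measurable_EFinP; exact: mH2.
  - by move=> w _; case: o2 => _ h _; rewrite lee_fin; exact: (proj1 (andP (h w (0, b)))).
  - by move=> w _; apply: esum_ge0 => e _; rewrite lee_fin K_ge0.
(* Shifting by -i identifies what corner 0 sends to corner i with what corner -i sends to corner
   0. *)
have sw b b' : X b b' = Y b b'.
  rewrite /Y (reindex_esum [set: int] [set: int] (fun i => - i)%R).
    apply: eq_esum => i _; have := intK_shift 0 i (- i) b b' oF oG.
    by move: (add0r (- i)) (addrN i) => -> ->.
  split; [by []|by move=> x y _ _; exact: oppr_inj|].
  by move=> x _; exists (- x)%R => //; rewrite opprK.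
apply: EFin_inj; rewrite -/H1 -/H2 (Eroot2 H1 o1) (Eroot2 H2 o2).
rewrite (L false) (L true) (L' false) (L' true).
rewrite (sw false false) (sw false true) (sw true false) (sw true true).
move: (Y false false) (Y false true) (Y true false) (Y true true) => y1 y2 y3 y4.
by rewrite addeACA.
Qed.

End adjoint.

(** * The label process is unbounded *)

Section walk.
Context {R : realType}.
Implicit Types (F G : config -> oedge -> R) (Phi Psi : int -> config -> oedge -> R).

(* The label increment along e; s = true changes its sign, so that one argument
   bounds the label process on both sides. *)
Definition incr (s : bool) (e : oedge) : int := if e.2 (+) s then 1 else -1.

Definition step s Phi (m : int) : config -> oedge -> R :=
  fun w e => Q (Phi (m - incr s e)) w e.

Fixpoint V s n Phi : int -> config -> oedge -> R :=
  if n is n'.+1 then step s (V s n' Phi) else Phi.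

(* In state m = m_0 - S_k after k steps, V is the plain expectation of Phi at time
   n; B also kills the walk when m drops below 0. *)
Fixpoint B s n Phi (m : int) : config -> oedge -> R :=
  fun w e => if 0 <= m then (if n is n'.+1 then step s (B s n' Phi) m w e else Phi m w e)
             else 0.

(* The quenched probability that S_0, ..., S_n <= m from the edge e. *)
Definition g s n : int -> config -> oedge -> R := B s n (fun _ _ _ => 1).

(** Re-rooting preserves the orientation [e.2], so a case distinction on it is compatible with
    [obs]. Increments depend on the edge through its orientation only. *)
Lemma obs_if (b : bool -> bool) F G : obs F -> obs G ->
  obs (fun w e => if b e.2 then F w e else G w e).
Proof.
case=> mF F01 iF [mG G01 iG]; split=> [e|w e|w e] /=; case: (b e.2);
  by [exact: mF|exact: mG|exact: F01|exact: G01|exact: iF|exact: iG].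
Qed.

Lemma obs_step s Phi m : (forall m, obs (Phi m)) -> obs (step s Phi m).
Proof.
move=> oPhi; rewrite (_ : step s Phi m = fun w e =>
    if e.2 then Q (Phi (m - incr s (0, true))) w e else Q (Phi (m - incr s (0, false))) w e).
  by apply: (obs_if id); exact: obs_Q.
by apply/funext => w; apply/funext => -[i []].
Qed.

Lemma obs_V s n Phi m : (forall m, obs (Phi m)) -> obs (V s n Phi m).
Proof. by move=> oPhi; elim: n m => //= n IH m; exact: obs_step. Qed.

Lemma obs_B s n Phi m : (forall m, obs (Phi m)) -> obs (B s n Phi m).
Proof.
move=> oPhi; elim: n m => [|n IH] m /=.
all: case: (0 <= m); last by apply: obs_cst; rewrite lexx ler01.
all: by [exact: oPhi|exact: obs_step].
Qed.

Lemma obs_g s n m : obs (g s n m).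
Proof. by apply: obs_B => _; apply: obs_cst; rewrite ler01 lexx. Qed.

Lemma le_V s n Phi Psi m w e : (forall m e, Phi m w e <= Psi m w e) ->
  V s n Phi m w e <= V s n Psi m w e.
Proof. by move=> le; elim: n m e => //= n IH m e; apply: le_Q => e'; exact: IH. Qed.

Lemma V_cst s n w m e : good w -> V s n (fun _ _ _ => 1) m w e = 1.
Proof.
move=> gw; elim: n m e => //= n IH m e; rewrite /step.
by rewrite (eq_Q (G := fun _ _ => 1)) ?Q_cst.
Qed.

Lemma V_shift s n Phi (a m : int) w e :
  V s n Phi (m + a) w e = V s n (fun k => Phi (k + a)) m w e.
Proof.
elim: n m e => //= n IH m e; apply: eq_Q => e' _.
by rewrite addrAC IH.
Qed.

Lemma V_lin s n a Phi Psi m w e :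
  V s n (fun m w e => a * Phi m w e + Psi m w e) m w e =
  a * V s n Phi m w e + V s n Psi m w e.
Proof.
elim: n m e => //= n IH m e; rewrite /step -QZ -QD.
by apply: eq_Q => e' _; rewrite IH.
Qed.

Lemma V_pull s n Phi (c : R) m w e : V s n (fun m w e => c * Phi m w e) m w e = c * V s n Phi m w e.
Proof.
elim: n m e => //= n IH m e; rewrite /step -QZ.
by apply: eq_Q => e' _; rewrite IH.
Qed.

Lemma V_loc s n Phi Psi m w e : (forall m e, Phi m w e = Psi m w e) ->
  V s n Phi m w e = V s n Psi m w e.
Proof.
by move=> eP; elim: n m e => //= n IH m e; apply: eq_Q => e' _; rewrite IH.
Qed.

Lemma B_lin s n a Phi Psi m w e :
  B s n (fun m w e => a * Phi m w e + Psi m w e) m w e =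
  a * B s n Phi m w e + B s n Psi m w e.
Proof.
elim: n m e => [|n IH] m e /=; case: (0 <= m); rewrite ?mulr0 ?addr0 //.
rewrite /step -QZ -QD.
by apply: eq_Q => e' _; rewrite IH.
Qed.

Lemma B_ge0 s n Phi m w e : (forall m e, 0 <= m -> 0 <= Phi m w e) -> 0 <= B s n Phi m w e.
Proof.
move=> P0; elim: n m e => [|n IH] m e /=; case: ifP => // m0; first exact: P0.
by rewrite divr_ge0 // sumr_ge0.
Qed.

Lemma B_le_V s n Phi m w e : (forall m e, 0 <= Phi m w e) ->
  B s n Phi m w e <= V s n (fun m w e => if 0 <= m then Phi m w e else 0) m w e.
Proof.
move=> P0; elim: n m e => [|n IH] m e //=; case: ifP => m0.
  by apply: le_Q => e'.
apply: divr_ge0 => //; apply: sumr_ge0 => e' _.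
elim: n (m - _) (e') {IH} => [|n IH] m' e0 /=; first by case: ifP.
by rewrite divr_ge0 // sumr_ge0.
Qed.

Lemma B_le_V' s n Phi m w e : (forall m e, 0 <= Phi m w e) ->
  B s n Phi m w e <= V s n Phi m w e.
Proof.
move=> P0; apply: (le_trans (B_le_V _ _ _ _ P0)); apply: le_V => m' e'.
by case: ifP.
Qed.

Lemma gE s n m w e : g s n.+1 m w e =
  if 0 <= m then Q (g s n (m - incr s e)) w e else 0.
Proof. by []. Qed.

Lemma g_01 s n m w e : 0 <= g s n m w e <= 1.
Proof. by case: (obs_g s n m). Qed.

Lemma g_decr s n m w e : g s n.+1 m w e <= g s n m w e.
Proof.
elim: n m e => [|n IH] m e.
  rewrite gE /g /=; case: ifP => // m0.
  by have /andP[] : 0 <= Q (B s 0 (fun=> fun=> fun=> 1) (m - incr s e)) w e <= 1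
    by apply: Q_01 => e'; exact: (g_01 s 0).
by rewrite gE [leRHS]gE; case: ifP => // _; apply: le_Q.
Qed.

Lemma g_mono s n m m' w e : m <= m' -> g s n m w e <= g s n m' w e.
Proof.
elim: n m m' e => [|n IH] m m' e le.
  by rewrite /g /=; case: (leP 0 m) => m0; case: (leP 0 m') => m1 //; lia.
rewrite gE [leRHS]gE; case: (leP 0 m) => m0; case: (leP 0 m') => m1 //.
- by apply: le_Q => e'; apply: IH; lia.
- by lia.
- have /andP[] // : 0 <= Q (g s n (m' - incr s e)) w e <= 1.
  by apply: Q_01 => e'; exact: g_01.
Qed.

Definition goo s m w e : R := limn (fun n => g s n m w e).

Lemma goo_cvg s m w e : (fun n => g s n m w e) @ \oo --> goo s m w e.
Proof.
have : cvgn (fun n => g s n m w e).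
  apply: nonincreasing_is_cvgn.
    by apply/nonincreasing_seqP => n; exact: g_decr.
  by exists 0 => _ [n _ <-]; have /andP[] := g_01 s n m w e.
by [].
Qed.

Lemma Q_cvg (F_ : nat -> config -> oedge -> R) F w e :
  (forall e', (fun n => F_ n w e') @ \oo --> F w e') ->
  (fun n => Q (F_ n) w e) @ \oo --> Q F w e.
Proof.
move=> cF; apply: cvgMl; elim: (enum_fset _) => [|x l IH].
  rewrite (_ : (fun n => _) = fun=> 0); last by apply/funext => n; rewrite big_nil.
  by rewrite big_nil; exact: cvg_cst.
rewrite (_ : (fun n => _) = fun n => F_ n w x + \sum_(e' <- l) F_ n w e').
  by rewrite big_cons; apply: cvgD.
by apply/funext => n; rewrite big_cons.
Qed.

Lemma obs_lim (F_ : nat -> config -> oedge -> R) F : (forall n, obs (F_ n)) ->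
  (forall w e, (fun n => F_ n w e) @ \oo --> F w e) -> obs F.
Proof.
move=> oF cF; split=> [e|w e|w e].
- apply: (measurable_fun_cvg (h := fun n (w : mconfig) => F_ n w e)).
    by move=> n; case: (oF n).
  by move=> w _; exact: cF.
- rewrite -(cvg_lim _ (cF w e)) //; apply/andP; split.
    apply: limr_ge; first by apply/cvg_ex; exists (F w e).
    by apply: nearW => n; case: (oF n) => _ /(_ w e)/andP[].
  apply: limr_le; first by apply/cvg_ex; exists (F w e).
  by apply: nearW => n; case: (oF n) => _ /(_ w e)/andP[].
- rewrite -(cvg_lim _ (cF (reroot w) e)) // -(cvg_lim _ (cF w (shifte 1 e))) //.
  by congr (lim (_ @ \oo)); apply/funext => n; case: (oF n).
Qed.

Lemma obs_goo s m : obs (goo s m).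
Proof. by apply: (obs_lim (obs_g s ^~ m)) => w e; exact: goo_cvg. Qed.

Lemma goo_01 s m w e : 0 <= goo s m w e <= 1.
Proof. by case: (obs_goo s m). Qed.

Lemma gooE s m w e : goo s m w e = if 0 <= m then Q (goo s (m - incr s e)) w e else 0.
Proof.
apply/cvg_lim => //; rewrite -(cvg_shiftS _) /=.
have -> : (fun n => g s n.+1 m w e) =
    fun n => if 0 <= m then Q (g s n (m - incr s e)) w e else 0 by [].
case: (0 <= m); last exact: cvg_cst.
by apply: Q_cvg => e'; exact: goo_cvg.
Qed.

(** The Markov property at time [n] for the killed walk. At negative levels both sides vanish. *)
Lemma goo_B s n m w e : goo s m w e = B s n (goo s) m w e.
Proof.
elim: n m e => [|n IH] m e /=.
  by case: (leP 0 m) => // m0; rewrite gooE leNgt m0.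
rewrite gooE; case: ifP => // _; apply: eq_Q => e' _; exact: IH.
Qed.

Lemma goo_le_g s n m w e : goo s m w e <= g s n m w e.
Proof.
have cv := @goo_cvg s m w e; rewrite /goo.
apply: nonincreasing_cvgn_ge; last by apply/cvg_ex; exists (goo s m w e).
by apply/nonincreasing_seqP => k; exact: g_decr.
Qed.

Lemma goo_mono s m m' w e : m <= m' -> goo s m w e <= goo s m' w e.
Proof.
move=> le; apply: ler_lim; [exact: goo_cvg|exact: goo_cvg|].
by apply: nearW => n; exact: g_mono.
Qed.

(** The map is connected and every label occurs, so a finite path leads to an edge where S exceeds
    [m]. Going back along this path, [goo] at each edge is a mean of finitely many values at most 1,
    one of them smaller than 1. *)
Lemma goo_lt1 s m w e : good w -> goo s m w e < 1.
Proof.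
move=> gw; pose lab e := sgn_int (~~ s) (wolab w e).
have lab_step e1 e2 : nbr w e1 e2 -> lab e2 = lab e1 + incr s e1.
  by move=> /nbr_olab h; rewrite /lab /sgn_int h /incr; case: (s); case: (e1.2) => /=; lia.
suff H e1 e2 : reach w e1 e2 -> forall m : int, m < lab e2 - lab e1 -> goo s m w e1 < 1.
  have [e' he'] := olab_unbounded (sgn_int (~~ s) (m + lab e + 1)) gw.
  apply: (H e e' (reach_all e e' gw)).
  by rewrite /lab he' /lab /sgn_int; case: (s) => /=; lia.
elim=> {e1 e2} [e1 m'|e1 e2 e3 n12 _ IH m' ltm].
  by rewrite subrr => m0; rewrite gooE leNgt m0.
rewrite gooE; case: ifP => // m0.
have lt2 : goo s (m' - incr s e1) w e2 < 1.
  by apply: IH; have := lab_step _ _ n12; lia.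
have in2 : e2 \in nb w e1 by apply/in_nb.
rewrite /Q ltr_pdivrMr ?ltr0n ?nb_gt0 // mul1r.
have -> : #|` nb w e1|%:R = \sum_(e' <- nb w e1) (1 : R).
  by rewrite big_const_seq count_predT iter_addr_0.
rewrite (big_rem _ in2) [ltRHS](big_rem _ in2) /= ltr_leD //.
by apply: ler_sum => e' _; have /andP[] := goo_01 s (m' - incr s e1) w e'.
Qed.

(* The quenched probability that S is bounded above. *)
Definition hesc s w e : R := limn (fun k : nat => goo s k%:Z w e).

Lemma hesc_cvg s w e : (fun k : nat => goo s k%:Z w e) @ \oo --> hesc s w e.
Proof.
have : cvgn (fun k : nat => goo s k%:Z w e).
  apply: nondecreasing_is_cvgn.
    by apply/nondecreasing_seqP => k; apply: goo_mono; lia.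
  by exists 1 => _ [k _ <-]; have /andP[] := goo_01 s k w e.
by [].
Qed.

Lemma obs_hesc s : obs (hesc s).
Proof. by apply: (obs_lim (fun k : nat => obs_goo s k%:Z)) => w e; exact: hesc_cvg. Qed.

Lemma hesc_01 s w e : 0 <= hesc s w e <= 1.
Proof. by case: (obs_hesc s). Qed.

Lemma goo_le_hesc s (m : int) w e : goo s m w e <= hesc s w e.
Proof.
apply: (@le_trans _ _ (goo s (absz m)%:Z w e)); first by apply: goo_mono; lia.
apply: nondecreasing_cvgn_le; last by apply/cvg_ex; exists (hesc s w e); exact: hesc_cvg.
by apply/nondecreasing_seqP => k; apply: goo_mono; lia.
Qed.

(** The first step moves the level by one unit, which the limit in the level absorbs. Starting from
    [n.+1] keeps the level in the nonnegative branch of [gooE]. *)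
Lemma hesc_Q s w e : hesc s w e = Q (hesc s) w e.
Proof.
apply/cvg_lim => //; rewrite -(cvg_shiftS _) /=.
have -> : (fun n => goo s n.+1%:Z w e) = fun n => Q (goo s (n.+1%:Z - incr s e)) w e.
  by apply/funext => n; rewrite gooE.
apply: Q_cvg => e'; rewrite /incr; case: (e.2 (+) s).
  rewrite (_ : (fun n => _) = fun n : nat => goo s n%:Z w e'); first exact: hesc_cvg.
  by apply/funext => n; congr (goo s _ w e'); lia.
rewrite (_ : (fun n => _) = fun n : nat => goo s (n + 2)%N%:Z w e').
  by rewrite (cvg_shiftn 2 (fun n : nat => goo s n%:Z w e')); exact: hesc_cvg.
by apply/funext => n; congr (goo s _ w e'); lia.
Qed.

End walk.

(** * Vanishing of the probability that the label process is bounded on one side *)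

Section escape.
Context {R : realType} (mu : {measure set mconfig -> \bar R}).
Context (law : config_law mu).
Implicit Types (F G : config -> oedge -> R).
Let muT : mu setT = 1%E := config_law_setT law.

Definition bobs F := forall e, bm (fun w : mconfig => F w e).

Lemma obs_bobs F : obs F -> bobs F.
Proof. by case=> mF F01 _ e; exact: bm01. Qed.

Lemma bobs_lin a F G : bobs F -> bobs G -> bobs (fun w e => a * F w e + G w e).
Proof. by move=> bF bG e; apply: bmD => //; exact: bmZ. Qed.

Lemma bm_root F : bobs F -> bm (at_root F : mconfig -> R).
Proof. by move=> bF; apply: bmZ; exact: bmD. Qed.

Lemma Eroot_lin a F G : bobs F -> bobs G ->
  Eroot mu (fun w e => a * F w e + G w e) = a * Eroot mu F + Eroot mu G.
Proof.
move=> bF bG; rewrite /Eroot -(ExZ muT _ (bm_root bF)) -(ExD muT); last 2 first.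
- exact/bmZ/bm_root.
- exact: bm_root.
by congr Ex; apply/funext => w; rewrite /at_root; ring.
Qed.

Lemma ErootD F G : bobs F -> bobs G ->
  Eroot mu (fun w e => F w e + G w e) = Eroot mu F + Eroot mu G.
Proof.
move=> bF bG; rewrite -[in RHS](mul1r (Eroot mu F)) -Eroot_lin //.
by congr Eroot; apply/funext => w; apply/funext => e; rewrite mul1r.
Qed.

Lemma Eroot_le (P : mconfig -> Prop) F G : {ae mu, forall w : mconfig, P w} -> bobs F -> bobs G ->
  (forall w e, P w -> F w e <= G w e) -> Eroot mu F <= Eroot mu G.
Proof.
move=> aP bF bG le; apply: (le_Ex muT); [exact: bm_root|exact: bm_root|].
move: aP; apply: (@filterS _ _ (ae_filter_ringOfSetsType mu)) => w Pw.
by rewrite /at_root ler_pM2l ?invr_gt0 // lerD // le.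
Qed.

Lemma Eroot_eq (P : mconfig -> Prop) F G : {ae mu, forall w : mconfig, P w} -> bobs F -> bobs G ->
  (forall w e, P w -> F w e = G w e) -> Eroot mu F = Eroot mu G.
Proof.
move=> aP bF bG e; apply/eqP; rewrite eq_le.
by apply/andP; split; apply: (Eroot_le aP) => // w x Pw; rewrite e.
Qed.

Lemma Eroot_cvg (F_ : nat -> config -> oedge -> R) F : (forall n, obs (F_ n)) ->
  (forall w e, (fun n => F_ n w e) @ \oo --> F w e) ->
  bm (at_root F : mconfig -> R) /\ (fun n => Eroot mu (F_ n)) @ \oo --> Eroot mu F.
Proof.
move=> oF cF; apply: (Ex_cvg muT (M := 1) (f_ := fun n => at_root (F_ n))).
- by move=> n; case: (bm_root (obs_bobs (oF n))).
- move=> n w; case: (oF n) => _ F01 _; rewrite /at_root.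
  have /andP[h1 h2] := F01 w (0, false); have /andP[h3 h4] := F01 w (0, true).
  by rewrite ger0_norm; [|apply: mulr_ge0 => //; exact: addr_ge0]; lra.
- by move=> w; apply: cvgMr; apply: cvgD.
Qed.

Lemma Eroot_ge0 F : (forall w e, 0 <= F w e) -> 0 <= Eroot mu F.
Proof. by move=> F0; apply: Ex_ge0 => w; rewrite mulr_ge0 // addr_ge0. Qed.

Lemma Eroot_eq0 F : bobs F -> (forall w e, 0 <= F w e) -> Eroot mu F = 0 ->
  {ae mu, forall w : mconfig, forall b, F w (0, b) = 0}.
Proof.
move=> bF F0 E0; have := Ex_eq0 muT (bm_root bF) _ E0.
have p w : 0 <= at_root F w by rewrite mulr_ge0 // addr_ge0.
move/(_ p); apply: (@filterS _ _ (ae_filter_ringOfSetsType mu)) => w.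
rewrite /at_root => h b; have h1 := F0 w (0, false); have h2 := F0 w (0, true).
by case: b; lra.
Qed.

Lemma ge_limit (u : nat -> R) (l c : R) : u @ \oo --> l -> (forall n, c <= u n) -> c <= l.
Proof.
move=> cu le; rewrite -(cvg_lim _ cu) //; apply: limr_ge; first by apply/cvg_ex; exists l.
exact: nearW.
Qed.

(** The case F = 1 of [adjoint]: on good configurations the constant 1 is fixed by [J (Q (J _))]. *)
Lemma Eroot_Q F : obs F -> Eroot mu (Q F) = Eroot mu F.
Proof.
move=> oF; have o1 : obs (fun _ _ => 1 : R) by apply: obs_cst; rewrite ler01 lexx.
transitivity (Eroot mu (fun w e => 1 * Q F w e)).
  by congr Eroot; apply/funext => w; apply/funext => e; rewrite mul1r.
rewrite (adjoint law o1 oF); apply: (Eroot_eq (good_ae law)).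
- by apply: obs_bobs; apply: obs_M => //; apply: obs_J; apply: obs_Q; exact: obs_J.
- exact: obs_bobs.
- by move=> w e gw; rewrite /J Q_cst // mul1r.
Qed.

Lemma Eroot_V s n F m : obs F -> Eroot mu (V s n (fun _ => F) m) = Eroot mu F.
Proof.
move=> oF; have VQ k m' : V s k (fun _ => F) m' = iter k Q F.
  elim: k m' => //= k IH m'; rewrite /step.
  by apply/funext => w; apply/funext => e; rewrite IH.
rewrite VQ; elim: n => //= n IH; rewrite Eroot_Q //.
by elim: (n) => //= k; exact: obs_Q.
Qed.

(** Since [hesc] is its own mean over the neighbours, Q(h^2) - h^2 is the variance of h under one
    step of the walk. *)
Lemma Q_variance s w e : (0 < #|` nb w e|)%N ->
  Q (fun w e => hesc s w e * hesc s w e : R) w e - hesc s w e * hesc s w e =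
  (\sum_(e' <- nb w e) (hesc s w e' - hesc s w e) ^+ 2) / #|` nb w e|%:R.
Proof.
move=> n0; set c := hesc s w e.
have n0' : #|` nb w e|%:R != 0 :> R by rewrite pnatr_eq0 -lt0n.
have hc : \sum_(e' <- nb w e) hesc s w e' = c * #|` nb w e|%:R.
  by rewrite /c hesc_Q /Q mulfVK.
have sq : \sum_(e' <- nb w e) (hesc s w e' - c) ^+ 2 =
    \sum_(e' <- nb w e) hesc s w e' * hesc s w e' - c * c * #|` nb w e|%:R.
  transitivity (\sum_(e' <- nb w e) (hesc s w e' * hesc s w e' + (- (2 * c) * hesc s w e' + c * c))).
    by apply: eq_bigr => e' _; ring.
  rewrite !big_split /= -mulr_sumr hc.
  have -> : \sum_(e' <- nb w e) c * c = c * c * #|` nb w e|%:R.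
    by rewrite big_const_seq count_predT iter_addr_0 mulr_natr.
  by ring.
by rewrite sq mulrBl mulfK.
Qed.

(* By stationarity, the mean of the nonnegative Q(h^2) - h^2 vanishes. *)
Lemma hesc_root_const s :
  {ae mu, forall w : mconfig, forall b e', e' \in nb w (0, b) -> hesc s w e' = hesc s w (0, b) :> R}.
Proof.
pose h2 w e : R := hesc s w e * hesc s w e.
have oh2 : obs h2 by apply: obs_M; exact: obs_hesc.
have le w e : h2 w e <= Q h2 w e.
  have [n0|n0] := posnP #|` nb w e|.
    by rewrite /h2 hesc_Q /Q n0 invr0 !mulr0.
  by rewrite -subr_ge0 Q_variance // divr_ge0 // sumr_ge0 // => e' _; exact: sqr_ge0.
have E0 : Eroot mu (fun w e => (-1) * h2 w e + Q h2 w e) = 0.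
  rewrite Eroot_lin; [|exact: obs_bobs|exact/obs_bobs/obs_Q].
  by rewrite Eroot_Q // mulN1r addNr.
have bF : bobs (fun w e => (-1) * h2 w e + Q h2 w e).
  by apply: bobs_lin; [exact: obs_bobs|exact/obs_bobs/obs_Q].
have := Eroot_eq0 bF _ E0.
have p w e : 0 <= (-1) * h2 w e + Q h2 w e by rewrite mulN1r addrC subr_ge0.
move/(_ p); apply: (@filterS _ _ (ae_filter_ringOfSetsType mu)) => w H b e' inb.
have n0 : (0 < #|` nb w (0%R, b)|)%N by rewrite cardfs_gt0; apply/fset0Pn; exists e'.
have := H b; rewrite mulN1r addrC Q_variance // => /eqP.
rewrite mulf_eq0 invr_eq0 pnatr_eq0 (gtn_eqF n0) orbF psumr_eq0; last by move=> ? _; exact: sqr_ge0.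
by move/allP => /(_ e' inb); rewrite sqrf_eq0 subr_eq0 => /eqP.
Qed.

Definition regular s (w : mconfig) := good w /\ forall e e', hesc s w e = hesc s w e' :> R.

(** [hesc_root_const] only speaks of the root corner. Re-rooting spreads it to all corners, and
    connectedness propagates the equality along paths. *)
Lemma regular_ae s : {ae mu, forall w : mconfig, regular s w}.
Proof.
pose bad (i : int) (w : config) :=
  exists b e', e' \in nb w (i, b) /\ hesc s w e' <> hesc s w (i, b) :> R.
have mbad i : measurable ([set w | bad i w] : set mconfig).
  apply: (@m_ex _ mconfig) => b; apply: (@m_ex _ mconfig) => e'; apply: (@m_and _ mconfig).
    exact: (discrete_pred (fun A : {fset oedge} => e' \in A) (discrete_nb (i, b))).
  apply: (@m_not _ mconfig).
  have [mh _ _] := @obs_hesc R s.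
  have md := measurable_funB (mh e') (mh (i, b)).
  rewrite (_ : [set w | _] = (fun w : mconfig => hesc s w e' - hesc s w (i, b) : R) @^-1` [set 0]).
    by rewrite -[X in measurable X]setTI; exact: md.
  by apply/seteqP; split => w /=; [move=> ->; rewrite subrr|move/eqP; rewrite subr_eq0 => /eqP].
have ih : invariant_obs (@hesc R s) by case: (@obs_hesc R s).
have bad0 i : mu [set w | bad i w] = 0%E.
  apply: (null_reroot law mbad).
    move=> j w; split=> -[b [e' [inb ne]]]; exists b.
      exists (shifte 1 e'); rewrite -!ih in ne *.
      rewrite -[(j + 1, b)]/(shifte 1 (j, b)) nb_reroot -ih mem_imfset //.
      exact: (can_inj (shifteK 1)).
    exists (shifte (-1) e'); move: inb ne.
    rewrite -[(j + 1, b)]/(shifte 1 (j, b)) nb_reroot -ih => /imfsetP[e0 /= inb ->].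
    by rewrite shifteK -ih.
  apply/negligibleP => //; have := hesc_root_const s.
  apply: negligibleS => w [b [e' [inb ne]]] H; exact: ne (H _ _ inb).
have gb : {ae mu, forall w : mconfig, forall i : int, ~ bad i w}.
  apply: ae_all => i; apply: ae_not.
    by apply: m_not; apply: m_not; exact: mbad.
  rewrite (_ : [set w | _] = [set w | bad i w]); first exact: bad0.
  by apply/seteqP; split => w /=; [move/contrapT|move=> h; apply].
move: (good_ae law) gb; apply: (@filterS2 _ _ (ae_filter_ringOfSetsType mu)) => w gw nb0.
split => //; have stp e1 e2 : nbr w e1 e2 -> hesc s w e2 = hesc s w e1 :> R.
  case: e1 => i b n12; apply: contrapT => ne; apply: (nb0 i); exists b, e2.
  by split => //; apply/in_nb.
move=> e e'; elim: (reach_all e e' gw) => // e1 e2 e3 n12 _ <-.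
by rewrite (stp _ _ n12).
Qed.

(* The expectation of phi (m + S_{n+1}) * F E_n: paths of n+1 edges, the last
   increment included. *)
Fixpoint W s n (phi : int -> R) F (m : int) : config -> oedge -> R :=
  fun w e => if n is n'.+1 then Q (W s n' phi F (m + incr s e)) w e
             else phi (m + incr s e) * F w e.

Definition restr (b : bool) F : config -> oedge -> R := fun w e => if e.2 == b then F w e else 0.

Lemma obs_restr b F : obs F -> obs (restr b F).
Proof.
move=> oF; apply: (@obs_if _ (eq_op^~ b) F (fun _ _ => 0)) => //.
by apply: obs_cst; rewrite lexx ler01.
Qed.

Lemma obs_W s n phi F m : (forall x, 0 <= phi x <= 1) -> obs F -> obs (W s n phi F m).
Proof.
move=> p01 oF; elim: n m => [|n IH] m.
  apply: obs_M => //; rewrite (_ : (fun _ => _) = fun (_ : config) (e : oedge) =>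
      if e.2 then phi (m + incr s (0, true)) else phi (m + incr s (0, false))).
    by apply: (@obs_if _ id (fun _ _ => phi _) (fun _ _ => phi _)); exact: obs_cst.
  by apply/funext => w; apply/funext => -[i []].
rewrite (_ : W s n.+1 phi F m = fun w e =>
    if e.2 then Q (W s n phi F (m + incr s (0, true))) w e
    else Q (W s n phi F (m + incr s (0, false))) w e).
  by apply: (@obs_if _ id); exact: obs_Q.
by apply/funext => w; apply/funext => -[i []].
Qed.

Lemma W_shift s n phi F (m a : int) w e :
  W s n phi F (m + a) w e = W s n (fun x => phi (x + a)) F m w e.
Proof.
elim: n m e => [|n IH] m e /=; first by rewrite addrAC.
by apply: eq_Q => e' _; rewrite addrAC IH.
Qed.

(** [W] is defined by its first step, and time reversal turns the first step into the last.
    Splitting by the orientation of the last edge makes its increment a constant that [phi] can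
    absorb. *)
Lemma W_last s n phi F (m : int) w e : W s n.+1 phi F m w e =
  W s n (fun x => phi (x + incr s (0, true))) (Q (restr true F)) m w e +
  W s n (fun x => phi (x + incr s (0, false))) (Q (restr false F)) m w e.
Proof.
elim: n m e => [|n IH] m e.
  rewrite /= -!QZ -QD; apply: eq_Q => -[i []] _ /=;
    by rewrite /restr /= ?mulr0 ?add0r ?addr0.
rewrite [LHS]/= -[in RHS]/(W s n.+1 _ _ _ _ _) [in RHS]/= -QD.
by apply: eq_Q => e' _; rewrite -IH.
Qed.

(* Time reversal: a path of n+1 edges and the reversed path have the same
   weight, and the increments change sign. *)
Lemma reversal s n phi F G : (forall x, 0 <= phi x <= 1) -> obs F -> obs G ->
  Eroot mu (fun w e => F w e * W s n phi G 0 w e) =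
  Eroot mu (fun w e => J G w e * W s n (fun x => phi (- x)) (J F) 0 w e).
Proof.
elim: n phi F G => [|n IH] phi F G p01 oF oG.
  congr Ex; apply/funext => w; rewrite /at_root /= /J /reve /=.
  by rewrite !add0r /incr /=; case: s => /=; rewrite ?opprK; ring.
have oW b : obs (W s n phi G (incr s (0, b))) by exact: obs_W.
have oR b : obs (restr b F) by exact: obs_restr.
have p01' b x : 0 <= phi (x + incr s (0, b)) <= 1 by exact: p01.
(* [adjoint] moves the first step to the other side, the induction hypothesis reverses the remaining
   path, and the step comes back as the last one. Reversing an edge turns orientation [b] into
   [~~ b]. *)
have half b : Eroot mu (fun w e => restr b F w e * Q (W s n phi G (incr s (0, b))) w e) =
    Eroot mu (fun w e => J G w e *
      W s n (fun x => phi (- (x + incr s (0, ~~ b)))) (Q (restr (~~ b) (J F))) 0 w e).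
  rewrite (adjoint law) //.
  transitivity (Eroot mu (fun w e => J (Q (J (restr b F))) w e *
      W s n (fun x => phi (x + incr s (0, b))) G 0 w e)).
    congr Eroot; apply/funext => w; apply/funext => e.
    by rewrite -[X in W _ _ _ _ X _ _](add0r (incr s (0, b))) W_shift.
  have oJ : obs (J (Q (J (restr b F)))) by apply: obs_J; apply: obs_Q; exact: obs_J.
  rewrite (IH (fun x => phi (x + incr s (0, b))) _ G (p01' b) oJ oG).
  congr Eroot; apply/funext => w; apply/funext => e; congr (_ * _).
  have -> : J (J (Q (J (restr b F)))) = Q (restr (~~ b) (J F)).
    apply/funext => w'; apply/funext => e'; rewrite /J reveK; apply: eq_Q => -[i c] _.
    by rewrite /restr /=; case: c; case: (b).
  congr (W s n _ _ _ _ _); apply/funext => x; congr phi.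
  by rewrite /incr /=; case: (b); case: (s) => /=; lia.
have oL b : obs (fun w e => restr b F w e * Q (W s n phi G (incr s (0, b))) w e).
  by apply: obs_M => //; exact: obs_Q.
have oL' b : obs (fun w e => J G w e *
      W s n (fun x => phi (- (x + incr s (0, b)))) (Q (restr b (J F))) 0 w e).
  apply: obs_M; first exact: obs_J.
  by apply: obs_W => //; apply: obs_Q; apply: obs_restr; exact: obs_J.
transitivity (Eroot mu (fun w e => restr true F w e * Q (W s n phi G (incr s (0, true))) w e) +
  Eroot mu (fun w e => restr false F w e * Q (W s n phi G (incr s (0, false))) w e)).
  rewrite -ErootD; [|exact: obs_bobs|exact: obs_bobs].
  congr Eroot; apply/funext => w; apply/funext => -[i []] /=;
    by rewrite /restr /= ?mul0r ?addr0 ?add0r.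
rewrite !half addrC -ErootD; [|exact: (obs_bobs (oL' _))|exact: (obs_bobs (oL' _))].
congr Eroot; apply/funext => w; apply/funext => e; rewrite W_last -mulrDr.
by [].
Qed.

Lemma W_pull s n phi F (c : R) m w e : (forall e', F w e' = c) ->
  W s n phi F m w e = c * W s n phi (fun _ _ => 1) m w e.
Proof.
move=> Fc; elim: n m e => [|n IH] m e /=; first by rewrite Fc mulr1 mulrC.
by rewrite -QZ; apply: eq_Q => e' _; rewrite IH.
Qed.

(** [n.+1] steps of [V] read the increments of n+1 edges, as [W s n] does. The last average is over
    a constant, which it preserves because [good] excludes empty neighbourhoods. *)
Lemma V_W s n (phi : int -> R) m w e : good w ->
  V s n.+1 (fun m _ _ => phi m) m w e = W s n (fun x => phi (- x)) (fun _ _ => 1) (- m) w e.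
Proof.
move=> gw; elim: n m e => [|n IH] m e.
  by rewrite /= /step Q_cst // mulr1 opprD opprK.
rewrite [LHS]/= -/(V s n.+1 _) /step [RHS]/=; apply: eq_Q => e' _.
by rewrite IH opprB addrC.
Qed.

(** Reversal moves the factor h from the start of the path to its end. As h is constant on the map,
    the h-weighted law of S_{n+1} is symmetric. *)
Lemma hesc_V_sym s n phi : (forall x, 0 <= phi x <= 1) ->
  Eroot mu (fun w e => hesc s w e * V s n.+1 (fun m _ _ => phi m) 0 w e) =
  Eroot mu (fun w e => hesc s w e * V s n.+1 (fun m _ _ => phi (- m)) 0 w e).
Proof.
move=> p01; have o1 : obs (fun _ _ => 1 : R) by apply: obs_cst; rewrite ler01 lexx.
have oV psi : (forall x, 0 <= psi x <= 1) ->
    obs (fun w e => hesc s w e * V s n.+1 (fun m _ _ => psi m) 0 w e).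
  move=> q01; apply: obs_M; first exact: obs_hesc.
  by apply: obs_V => m; exact: obs_cst.
have p01N x : 0 <= phi (- x) <= 1 by exact: p01.
have oh := @obs_hesc R s.
transitivity (Eroot mu (fun w e => hesc s w e * W s n (fun x => phi (- x)) (fun _ _ => 1) 0 w e)).
  apply: (Eroot_eq (good_ae law)); [exact/obs_bobs/oV| |].
    by apply: obs_bobs; apply: obs_M => //; exact: obs_W.
  by move=> w e gw; rewrite V_W // oppr0.
rewrite (reversal _ _ p01N) //.
apply: (Eroot_eq (regular_ae s)).
- apply: obs_bobs; apply: obs_M; first exact: obs_J.
  by apply: obs_W; [move=> x; exact: p01|exact: obs_J].
- by apply: obs_bobs; apply: oV.
move=> w e [gw hc]; rewrite V_W // oppr0 /J mul1r (@W_pull s n _ _ (hesc s w e)) //.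
Qed.

(* h being constant, P(S <= x forever) <= P(S_n <= x) h. *)
Lemma hesc_V_bound s n (x : int) w e : regular s w ->
  hesc s w e * V s n (fun m _ _ => (x < - m)%R%:R) 0 w e <= hesc s w e - goo s x w e :> R.
Proof.
move=> [gw hc]; set h : R := hesc s w e.
have e1 : V s n (fun m _ _ => (0 <= m)%R%:R) x w e + V s n (fun m _ _ => (m < 0)%R%:R) x w e = 1 :> R.
  rewrite -[V s n (fun m _ _ => (0 <= m)%R%:R) x w e]mul1r -V_lin -[RHS](V_cst s n x e gw).
  by apply: V_loc => m e' /=; case: (ltP m 0) => _ /=; rewrite ?mulr0 ?mulr1 ?add0r ?addr0.
have e2 : V s n (fun m _ _ => (x < - m)%R%:R) 0 w e = V s n (fun m _ _ => (m < 0)%R%:R) x w e :> R.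
  rewrite -[X in _ = V _ _ _ X _ _](add0r x) V_shift; apply: V_loc => m e'.
  by congr (_%:R); congr nat_of_bool; lia.
have e3 : goo s x w e <= h * V s n (fun m _ _ => (0 <= m)%R%:R) x w e.
  rewrite (goo_B s n).
  apply: (@le_trans _ _ (V s n (fun m w e => if 0 <= m then goo s m w e else 0) x w e)).
    by apply: B_le_V => m e'; have /andP[] := @goo_01 R s m w e'.
  rewrite -V_pull; apply: le_V => m e'; case: ifP => m0 /=; last by rewrite mulr0.
  by rewrite mulr1 /h (hc e e'); exact: goo_le_hesc.
by rewrite e2 (_ : V s n (fun m _ _ => (m < 0)%R%:R) x w e =
  1 - V s n (fun m _ _ => (0 <= m)%R%:R) x w e); [rewrite mulrBr mulr1; lra|lra].
Qed.

Lemma one_sub_exp (x : R) k : 0 <= x <= 1 -> 1 - x ^+ k <= k%:R * (1 - x).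
Proof.
case/andP => x0 x1; elim: k => [|k IH]; first by rewrite expr0 subrr mul0r.
rewrite exprS -natr1 mulrDl mul1r.
have p : 0 <= 1 - x ^+ k by rewrite subr_ge0 exprn_ile1.
have := ler_piMl p x1; lra.
Qed.

(** By the Markov property, g_n(y) - goo(y) is the mean of 1 - goo(m) under the killed walk, where m
    = y - S_n is the room left at time n. Either m > x + y, that is S_n < -x, or goo(m) <= goo(x+y)
    and [one_sub_exp] gives k (1 - goo(m)) + goo(x+y)^k >= 1. Averaging bounds g_n(y), which
    dominates goo(y). *)
Lemma key_pointwise s n k (x y : int) w e : regular s w ->
  hesc s w e * goo s y w e <=
  k%:R * (hesc s w e * (g s n y w e - goo s y w e)) +
  hesc s w e * V s n (fun m _ _ => (x < m)%R%:R) 0 w e +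
  V s n (fun _ w e => goo s (x + y) w e ^+ k) y w e :> R.
Proof.
move=> [gw hc]; set h : R := hesc s w e.
have /andP[h0 h1] : 0 <= h <= 1 by exact: hesc_01.
pose P1 (m : int) (w : config) (e : oedge) : R := (x + y < m)%R%:R.
pose P2 (m : int) (w : config) (e : oedge) : R := goo s (x + y) w e ^+ k.
have g01 m e' : 0 <= (goo s m w e' : R) <= 1 by exact: goo_01.
(* k (1 - goo m) + 1{m > x + y} + goo (x + y)^k >= 1 for the level m at time n. *)
have PB : 0 <= B s n (fun m w e => k%:R * 1 + (- k%:R * goo s m w e +
    (-1 * 1 + (1 * P1 m w e + P2 m w e)))) y w e.
  apply: B_ge0 => m e' m0; rewrite /P1 /P2.
  have /andP[a0 a1] := g01 m e'; have /andP[b0 b1] := g01 (x + y) e'.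
  have := one_sub_exp k (g01 (x + y) e').
  have bk : 0 <= goo s (x + y) w e' ^+ k :> R by exact: exprn_ge0.
  case: (ltP (x + y) m) => le /=.
    have : 0 <= k%:R * (1 - goo s m w e') :> R by rewrite mulr_ge0 // subr_ge0.
    by lra.
  have : k%:R * goo s m w e' <= k%:R * goo s (x + y) w e' :> R.
    by rewrite ler_wpM2l //; exact: goo_mono.
  by lra.
rewrite !B_lin -/(g s n y w e) -goo_B mul1r in PB.
have le1 : B s n P1 y w e <= V s n (fun m _ _ => (x < m)%R%:R) 0 w e.
  apply: (le_trans (B_le_V' _ _ _ _ _)); first by move=> m e'; rewrite /P1.
  rewrite -[X in V _ _ _ X _ _ <= _](add0r y) V_shift le_eqVlt; apply/orP; left; apply/eqP.
  by apply: V_loc => m e'; rewrite /P1 ltrD2r.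
have le2 : B s n P2 y w e <= V s n P2 y w e.
  by apply: B_le_V' => m e'; rewrite exprn_ge0 //; have /andP[] := g01 (x + y) e'.
have v2 : 0 <= V s n P2 y w e.
  rewrite (le_trans _ le2) //; apply: B_ge0 => m e' _.
  by rewrite exprn_ge0 //; have /andP[] := g01 (x + y) e'.
have gg : goo s y w e <= g s n y w e :> R by exact: goo_le_g.
(* The factor [h <= 1] is dropped from the last term only, so that stationarity will apply to that
   term. *)
have m1 : h * (g s n y w e) <= h * (k%:R * (g s n y w e - goo s y w e) +
    V s n (fun m _ _ => (x < m)%R%:R) 0 w e) + V s n P2 y w e.
  have : h * g s n y w e <= h * (k%:R * (g s n y w e - goo s y w e) +
      V s n (fun m _ _ => (x < m)%R%:R) 0 w e + V s n P2 y w e).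
    by rewrite ler_wpM2l //; lra.
  by move/le_trans; apply; rewrite mulrDr lerD2l ler_piMl.
apply: (@le_trans _ _ (h * g s n y w e)); first by rewrite ler_wpM2l.
by move: m1; rewrite mulrDr (mulrCA h).
Qed.

Lemma obs_exp F k : obs F -> obs (fun w e => F w e ^+ k).
Proof.
move=> oF; elim: k => [|k IH].
  by under eq_fun do under eq_fun do rewrite expr0; apply: obs_cst; rewrite ler01 lexx.
by under eq_fun do under eq_fun do rewrite exprS; exact: obs_M.
Qed.

Lemma key_expectation s n k (x y : int) :
  Eroot mu (fun w e => hesc s w e * goo s y w e) <=
  k%:R * Eroot mu (fun w e => hesc s w e * (g s n.+1 y w e - goo s y w e)) +
  Eroot mu (fun w e => hesc s w e - goo s x w e) +
  Eroot mu (fun w e => goo s (x + y) w e ^+ k).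
Proof.
have oh := @obs_hesc R s; have og m := @obs_goo R s m.
have i01 (b : bool) : 0 <= (b%:R : R) <= 1 by case: b; rewrite ?lexx ler01.
have o1 : obs (fun w e => hesc s w e * goo s y w e : R) by exact: obs_M.
have o2 : obs (fun w e => hesc s w e * (g s n.+1 y w e - goo s y w e) : R).
  by apply: obs_M => //; apply: obs_sub => //; [exact: obs_g|move=> w e; exact: goo_le_g].
have o3 (phi : int -> R) : (forall x, 0 <= phi x <= 1) ->
    obs (fun w e => hesc s w e * V s n.+1 (fun m _ _ => phi m) 0 w e).
  by move=> p01; apply: obs_M => //; apply: obs_V => m; exact: obs_cst.
have o4 : obs (fun w e => goo s (x + y) w e ^+ k : R) by exact: obs_exp.
have o5 : obs (fun w e => hesc s w e - goo s x w e : R).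
  by apply: obs_sub => // w e; exact: goo_le_hesc.
have o6 : obs (V s n.+1 (fun _ w e => goo s (x + y) w e ^+ k : R) y) by apply: obs_V.
have o3a := o3 (fun m => (x < m)%R%:R) (fun m => i01 (x < m)).
have o3b := o3 (fun m => (x < - m)%R%:R) (fun m => i01 (x < - m)).
(* By stationarity the last term may be evaluated at the edge reached at time n+1. *)
rewrite -(Eroot_V s n.+1 y o4).
have le3 : Eroot mu (fun w e => hesc s w e * V s n.+1 (fun m _ _ => (x < m)%R%:R) 0 w e) <=
    Eroot mu (fun w e => hesc s w e - goo s x w e).
  rewrite (hesc_V_sym s n (phi := fun m => (x < m)%R%:R)); last by move=> m; exact: i01.
  apply: (Eroot_le (regular_ae s)); [exact: obs_bobs|exact: obs_bobs|].
  by move=> w e rw; exact: hesc_V_bound.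
apply: (@le_trans _ _ (k%:R * Eroot mu (fun w e => hesc s w e * (g s n.+1 y w e - goo s y w e)) +
  Eroot mu (fun w e => hesc s w e * V s n.+1 (fun m _ _ => (x < m)%R%:R) 0 w e) +
  Eroot mu (V s n.+1 (fun _ w e => goo s (x + y) w e ^+ k) y))); last first.
  by rewrite lerD2r lerD2l.
rewrite -addrA -ErootD; [|exact: obs_bobs|exact: obs_bobs].
rewrite -Eroot_lin; [|exact: obs_bobs|by move=> e; apply: bmD; [exact: (obs_bobs o3a e)|exact: (obs_bobs o6 e)]].
apply: (Eroot_le (regular_ae s)); first exact: obs_bobs.
  by apply: bobs_lin; [exact: obs_bobs|by move=> e; apply: bmD; [exact: (obs_bobs o3a e)|exact: (obs_bobs o6 e)]].
by move=> w e rw; rewrite addrA; exact: key_pointwise.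
Qed.

(* In [key_expectation], let n, then k, then x go to infinity. *)
Lemma hesc_goo0 s (y : int) : Eroot mu (fun w e => hesc s w e * goo s y w e) = 0.
Proof.
have oh := @obs_hesc R s; have og m := @obs_goo R s m.
set a := Eroot _ _.
have s1 k (x : int) : a <= Eroot mu (fun w e => hesc s w e - goo s x w e) +
    Eroot mu (fun w e => goo s (x + y) w e ^+ k).
  have [_ cv] : bm (at_root (fun w e => hesc s w e * 0 : R) : mconfig -> R) /\
     (fun n => Eroot mu (fun w e => hesc s w e * (g s n.+1 y w e - goo s y w e))) @ \oo -->
     Eroot mu (fun w e => hesc s w e * 0).
    apply: Eroot_cvg => [n|w e].
      by apply: obs_M => //; apply: obs_sub => //; [exact: obs_g|move=> w e; exact: goo_le_g].
    apply: cvgMr; rewrite -(subrr (goo s y w e)); apply: cvgB; last exact: cvg_cst.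
    by rewrite (cvg_shiftS (fun n => g s n y w e)); exact: goo_cvg.
  have E0 : Eroot mu (fun w e => hesc s w e * 0) = 0.
    rewrite /Eroot (_ : at_root _ = fun=> 0) ?(Ex_cst muT) //.
    by apply/funext => w; rewrite /at_root !mulr0 addr0 mulr0.
  rewrite E0 in cv.
  have cv2 : (fun n => k%:R * Eroot mu (fun w e => hesc s w e * (g s n.+1 y w e - goo s y w e)) +
      Eroot mu (fun w e => hesc s w e - goo s x w e) +
      Eroot mu (fun w e => goo s (x + y) w e ^+ k)) @ \oo -->
      k%:R * 0 + Eroot mu (fun w e => hesc s w e - goo s x w e) +
      Eroot mu (fun w e => goo s (x + y) w e ^+ k).
    apply: cvgD; last exact: cvg_cst.
    by apply: cvgD; [exact: cvgMr|exact: cvg_cst].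
  rewrite mulr0 add0r in cv2; apply: (ge_limit cv2) => n; exact: key_expectation.
have s2 (x : int) : a <= Eroot mu (fun w e => hesc s w e - goo s x w e).
  (* The powers converge to the indicator of [goo = 1], which vanishes on good configurations by
     [goo_lt1]. *)
  pose L (w : config) (e : oedge) : R := ((goo s (x + y) w e : R) == 1)%:R.
  have [bL cv] : bm (at_root L : mconfig -> R) /\
      (fun k => Eroot mu (fun w e => goo s (x + y) w e ^+ k)) @ \oo --> Eroot mu L.
    apply: Eroot_cvg => [k|w e]; first exact: obs_exp.
    rewrite /L; have /andP[g0 g1] := @goo_01 R s (x + y) w e.
    case: eqVneq => [->|n1].
      by rewrite (_ : (fun k => _) = fun=> 1); [exact: cvg_cst|apply/funext => k; rewrite expr1n].
    by apply: cvg_expr; rewrite ger0_norm // lt_neqAle n1.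
  have EL : Eroot mu L = 0.
    rewrite -(Ex_cst muT 0); apply: (Ex_ae_eq bL (bm_cst 0)).
    have := good_ae law; apply: (@filterS _ _ (ae_filter_ringOfSetsType mu)) => w gw.
    by rewrite /at_root /L !lt_eqF ?goo_lt1 // addr0 mulr0.
  rewrite EL in cv.
  set c := Eroot _ _.
  have cv2 : (fun k => c + Eroot mu (fun w e => goo s (x + y) w e ^+ k)) @ \oo --> c.
    by rewrite -[X in _ --> X]addr0; apply: cvgD => //; exact: cvg_cst.
  by apply: (ge_limit cv2) => k; exact: s1.
have [_ cv] : bm (at_root (fun w e => hesc s w e - hesc s w e : R) : mconfig -> R) /\
    (fun k : nat => Eroot mu (fun w e => hesc s w e - goo s k%:Z w e)) @ \oo -->
    Eroot mu (fun w e => hesc s w e - hesc s w e).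
  apply: Eroot_cvg => [k|w e]; first by apply: obs_sub => // w e; exact: goo_le_hesc.
  by apply: cvgB; [exact: cvg_cst|exact: hesc_cvg].
have E0 : Eroot mu (fun w e => hesc s w e - hesc s w e) = 0.
  rewrite /Eroot (_ : at_root _ = fun=> 0) ?(Ex_cst muT) //.
  by apply/funext => w; rewrite /at_root !subrr addr0 mulr0.
rewrite E0 in cv; apply/eqP; rewrite eq_le; apply/andP; split.
  by apply: (ge_limit cv) => k; exact: s2.
apply: Eroot_ge0 => w e.
have /andP[h0 _] := @hesc_01 R s w e; have /andP[g0 _] := @goo_01 R s y w e.
exact: mulr_ge0.
Qed.

(** Letting the level tend to infinity in [hesc_goo0] gives E[h^2] = 0. *)
Lemma hesc0 s : {ae mu, forall w : mconfig, forall b, hesc s w (0, b) = 0 :> R}.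
Proof.
have oh := @obs_hesc R s.
have [_ cv] : bm (at_root (fun w e => hesc s w e * hesc s w e : R) : mconfig -> R) /\
    (fun k : nat => Eroot mu (fun w e => hesc s w e * goo s k%:Z w e)) @ \oo -->
    Eroot mu (fun w e => hesc s w e * hesc s w e).
  apply: Eroot_cvg => [k|w e]; first by apply: obs_M => //; exact: obs_goo.
  by apply: cvgMr; exact: hesc_cvg.
have E0 : Eroot mu (fun w e => hesc s w e * hesc s w e) = 0.
  rewrite -(cvg_lim _ cv) //; under eq_fun do rewrite hesc_goo0.
  exact: lim_cst.
have := Eroot_eq0 (obs_bobs (obs_M oh oh)) _ E0.
have p w e : 0 <= hesc s w e * hesc s w e :> R by rewrite -expr2 sqr_ge0.
move/(_ p); apply: (@filterS _ _ (ae_filter_ringOfSetsType mu)) => w H b.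
by apply/eqP; have /eqP := H b; rewrite mulf_eq0 orbb.
Qed.

Lemma Eroot_g_cvg0 s (m : int) : (fun n => Eroot mu (g s n m)) @ \oo --> (0 : R).
Proof.
have [bg cv] := Eroot_cvg (fun n => obs_g s n m) (@goo_cvg R s m).
suff E0 : Eroot mu (goo s m) = 0 :> R by rewrite E0 in cv.
rewrite -(Ex_cst muT 0); apply: (Ex_ae_eq bg (bm_cst 0)).
have := hesc0 s; apply: (@filterS _ _ (ae_filter_ringOfSetsType mu)) => w H.
have z b : goo s m w (0, b) = 0 :> R.
  apply/eqP; rewrite eq_le -{1}(H b) goo_le_hesc.
  by have /andP[] := @goo_01 R s m w (0, b).
by rewrite /at_root !z addr0 mulr0.
Qed.

End escape.

(** * From the operator to the random walk *)

Section discrete_seq.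
Context {d : measure_display} {T : measurableType d}.

Lemma discrete_pair (C1 C2 : Type) (c1 : T -> C1) (c2 : T -> C2) :
  discrete c1 -> discrete c2 -> discrete (fun w => (c1 w, c2 w)).
Proof.
move=> d1 d2 [x y]; rewrite (_ : [set w | _] = [set w | c1 w = x /\ c2 w = y]).
  exact: m_and.
by apply/seteqP; split => w /=; [case=> -> ->|case=> -> ->].
Qed.

Lemma discrete_mkseq (C : Type) (c : nat -> T -> C) n :
  (forall k, discrete (c k)) -> discrete (fun w => mkseq (c^~ w) n).
Proof.
move=> dc s; have [->|x0] : s = [::] \/ inhabited C by case: s => [|x s]; [left|right].
  rewrite (_ : [set w | _] = [set w | n = 0%N]); first exact: m_cst.
  by apply/seteqP; split => w /=; [move/(congr1 size); rewrite size_mkseq|move=> ->].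
case: x0 => x0; rewrite (_ : [set w | _] = [set w | size s = n /\
    forall k, (k < n)%N -> c k w = nth x0 s k]).
  apply: m_and; first exact: m_cst.
  by apply: m_all => k; apply: m_imp; [exact: m_cst|exact: dc].
apply/seteqP; split => w /=.
  by move=> <-; rewrite size_mkseq; split => // k ltk; rewrite nth_mkseq.
move=> [sz H]; apply: (@eq_from_nth _ x0); rewrite size_mkseq // => k ltk.
by rewrite nth_mkseq // H.
Qed.

Lemma measure_in_seq (R : realType) (mu : {measure set T -> \bar R}) (C : countType)
    (c : T -> C) (A : set T) (s : seq C) : discrete c -> measurable A -> uniq s ->
  mu (A `&` [set w | c w \in s]) = (\sum_(x <- s) mu (A `&` [set w | c w = x]))%E.
Proof.
move=> dc mA; elim: s => [_|x s IH /= /andP[xs us]].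
  rewrite big_nil (_ : _ `&` _ = set0) ?measure0 //.
  by apply/seteqP; split => // w [].
rewrite big_cons -IH // -measureU //.
- congr (mu _); apply/seteqP; split => w /=.
    by move=> [Aw]; rewrite inE => /orP[/eqP|]; [left|right].
  by case=> -[Aw e]; split => //; rewrite in_cons; apply/orP; [left; apply/eqP|right].
- by apply: measurableI => //; exact: dc.
- by apply: measurableI => //; exact: (discrete_pred (fun y => y \in s) dc).
- apply/seteqP; split => // w [[_ /= e] [_ /= h]].
  by rewrite e (negPf xs) in h.
Qed.

End discrete_seq.

Lemma prefix_of_nth s w : prefix_of s w <-> forall n, (n < size s)%N -> w n = nth level0 s n.
Proof.
rewrite prefix_ofE; split=> [<- n|H].
  by rewrite size_mkseq => ltn; rewrite nth_mkseq.
apply: (@eq_from_nth _ level0); rewrite size_mkseq // => n ltn.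
by rewrite nth_mkseq // H.
Qed.

Lemma chain_w_prod (R : realType) x s :
  (\prod_(k < size s) step_w R (root_label (nth level0 (x :: s) k).1)
     (root_label (nth level0 (x :: s) k.+1).1)) *
  (\prod_(k < (size s).+1) level_w (nth level0 (x :: s) k)) =
  level_w x * chain_w (root_label x.1) s.
Proof.
elim: s x => [|y s IH] x; first by rewrite big_ord0 big_ord_recl big_ord0 mul1r.
rewrite (big_ord_recl (size s)) (big_ord_recl (size s).+1).
set w := step_w _ _ _; rewrite mulrACA (IH y).
rewrite -[chain_w _ (y :: s)]/(w * level_w y * chain_w (root_label y.1) s).
by rewrite mulrA [_ * level_w x]mulrC !mulrA.
Qed.

Lemma env_cyl_prob_config (R : realType) s n : size s = n.+1 ->
  env_cyl_prob R n (fun k => root_label (nth level0 s k).1) (fun k => (nth level0 s k).1)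
    (fun k => LNode (root_label (nth level0 s k).1) (nth level0 s k).2) =
  2%:R^-1 * config_w s.
Proof.
rewrite /env_cyl_prob; case: s => // x s [<-].
rewrite -[config_w _]/((if root_label x.1 == 0 then 1 else 0) * level_w x *
  chain_w (root_label x.1) s) -[in RHS]mulrA -chain_w_prod.
have assoc (a b u v v' : R) : v = v' -> a * b * u * v = a * (b * (u * v')) by move=> ->; rewrite !mulrA.
apply: assoc; apply: eq_bigr => k _.
by rewrite /rho !eqxx.
Qed.

Section link.
Context {R : realType} {d : measure_display} {Omega : measurableType d}.
Context (P : probability Omega R).
Context (X : nat -> Omega -> int) (L Rt : nat -> Omega -> ltree) (eta : Omega -> bool).
Context (E : nat -> Omega -> oedge).
Context (mX : forall n, discrete (X n)) (mL : forall n, discrete (L n)).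
Context (mRt : forall n, discrete (Rt n)) (meta : discrete eta) (mE : forall j, discrete (E j)).
Context (lawP : forall N xs ls rs b,
  P (env_cyl X L Rt eta N xs ls rs b) = (env_cyl_prob R N xs ls rs)%:E).
Context (E0 : forall w, E 0%N w = (0%Z, eta w)).
Context (Enext : forall j, P [set w | ~ exists v, tgt (L^~ w) (Rt^~ w) (E j w) v /\
                                    org (L^~ w) (Rt^~ w) (E j.+1 w) v] = 0%E).
Context (Eunif : forall j N xs ls rs b (path : nat -> oedge) (e e' : oedge),
  let C := env_cyl X L Rt eta N xs ls rs b `&`
           [set w | forall k, (k <= j)%N -> E k w = path k] in
  let D := [set w | exists v, tgt (L^~ w) (Rt^~ w) (path j) v /\
                              org (L^~ w) (Rt^~ w) e v /\
                              org (L^~ w) (Rt^~ w) e' v] in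
  P (C `&` D `&` [set w | E j.+1 w = e]) =
  P (C `&` D `&` [set w | E j.+1 w = e'])).

(** Drops [X] and the root labels of the right trees, which are recovered from the left trees on
    coherent outcomes. *)
Definition env (w : Omega) : config := fun n => (L n w, children (Rt n w)).

Lemma discrete_children (t : Omega -> ltree) : discrete t -> discrete (fun w => children (t w)).
Proof. by move=> dt x; exact: (discrete_pred (fun u => children u = x) dt). Qed.

Lemma discrete_env n : discrete (fun w => env w n).
Proof. by apply: discrete_pair => //; exact: discrete_children. Qed.

Lemma measurable_to_config (f : Omega -> config) : (forall n, discrete (fun w => f w n)) ->
  measurable_fun setT (f : Omega -> mconfig).
Proof.
move=> df; apply: (@measurability _ _ Omega mconfig setT f cylinders erefl).
move=> _ [B [->|[s ->]] <-]; rewrite setTI; first by rewrite preimage_set0.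
rewrite (_ : _ @^-1` _ = [set w | forall n, (n < size s)%N -> f w n = nth level0 s n]).
  by apply: m_all => n; apply: m_imp; [exact: m_cst|exact: df].
by apply/seteqP; split => w /prefix_of_nth.
Qed.

Lemma measurable_env : measurable_fun setT (env : Omega -> mconfig).
Proof. exact: measurable_to_config discrete_env. Qed.

Lemma measurable_env_local (p : config -> Prop) :
  measurable ([set w | p w] : set mconfig) -> measurable [set w | p (env w)].
Proof. by move=> mp; have := measurable_env measurableT mp; rewrite setTI. Qed.

Lemma measurable_env_prefix s : measurable [set w | prefix_of s (env w)].
Proof. exact: (@measurable_env_local (prefix_of s) (measurable_prefix s)). Qed.

(* On incoherent outcomes [env w] forgets the root labels of the right trees, so
   each side is read off a configuration of its own. *)
Lemma discrete_corner_pair i : discrete (fun w => corner (L^~ w) (Rt^~ w) i).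
Proof.
pose env' w : config := fun n => (Rt n w, children (Rt n w)).
have menv' : measurable_fun setT (env' : Omega -> mconfig).
  by apply: measurable_to_config => n; apply: discrete_pair => //; exact: discrete_children.
have right w : rgt (env' w) = Rt^~ w by apply/funext => n; rewrite /rgt /= -ltreeE.
case: i => k x.
  by have := measurable_env measurableT (discrete_corner (Posz k) x); rewrite setTI.
have := menv' measurableT _ (discrete_corner (Negz k) x); rewrite setTI.
have e w : wcorner (env' w) (Negz k) = corner (L^~ w) (Rt^~ w) (Negz k).
  by rewrite right.
rewrite (_ : _ @^-1` _ = [set w | corner (L^~ w) (Rt^~ w) (Negz k) = x]) //.
by apply/seteqP; split => w; rewrite /preimage /mkset e.
Qed.

Lemma measurable_org_pair e v : measurable [set w | org (L^~ w) (Rt^~ w) e v].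
Proof.
have dl i : discrete (fun w => clab (L^~ w) (Rt^~ w) i).
  by move=> x; exact: (discrete_pred (fun u : vertex * int => u.2 = x) (discrete_corner_pair i)).
have dv i : discrete (fun w => cvert (L^~ w) (Rt^~ w) i).
  by move=> x; exact: (discrete_pred (fun u : vertex * int => u.1 = x) (discrete_corner_pair i)).
have mS i j : measurable [set w | is_succ (L^~ w) (Rt^~ w) i j].
  have mD k : measurable [set w | clab (L^~ w) (Rt^~ w) k = clab (L^~ w) (Rt^~ w) i - 1].
    exact: (discrete_pred (fun u : int * int => u.1 = u.2 - 1) (discrete_pair (dl k) (dl i))).
  apply: m_and; first exact: m_cst.
  apply: m_and; first exact: mD.
  apply: m_all => k; apply: m_imp; first exact: m_cst.
  by apply: m_imp; [exact: m_cst|exact: m_not].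
case: e => i [].
  by apply: m_ex => j; apply: m_and; [exact: mS|exact: dv].
by apply: m_and; [apply: m_ex => j; exact: mS|exact: dv].
Qed.

Lemma measurable_tgt_pair e v : measurable [set w | tgt (L^~ w) (Rt^~ w) e v].
Proof.
by case: e => i []; [exact: (measurable_org_pair (i, false))|exact: (measurable_org_pair (i, true))].
Qed.

Lemma measurable_env_cyl N xs ls rs b : measurable (env_cyl X L Rt eta N xs ls rs b).
Proof.
apply: m_and; last exact: meta.
apply: m_all => n; apply: m_imp; first exact: m_cst.
by apply: m_and; [exact: mX|apply: m_and; [exact: mL|exact: mRt]].
Qed.

Definition coherent (w : Omega) : Prop :=
  forall n, X n w = root_label (L n w) /\ root_label (Rt n w) = root_label (L n w).

Lemma measurable_incoherent : measurable [set w | ~ coherent w].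
Proof.
apply: m_not; apply: m_all => n.
have dd := discrete_pair (mX n) (discrete_pair (mL n) (mRt n)).
exact: (discrete_pred (fun u : int * (ltree * ltree) =>
  u.1 = root_label u.2.1 /\ root_label u.2.2 = root_label u.2.1) dd).
Qed.

(** A cylinder that contains an incoherent level has probability 0, since [rho] vanishes on a tree
    with the wrong root label. *)
Lemma incoherent_null : P [set w | ~ coherent w] = 0%E.
Proof.
pose ok n w := X n w = root_label (L n w) /\ root_label (Rt n w) = root_label (L n w).
have dd n : discrete (fun w => (X n w, (L n w, Rt n w))).
  exact: discrete_pair (mX n) (discrete_pair (mL n) (mRt n)).
have mok n : measurable [set w | ~ ok n w].
  apply: m_not; exact: (discrete_pred (fun u : int * (ltree * ltree) =>
    u.1 = root_label u.2.1 /\ root_label u.2.2 = root_label u.2.1) (dd n)).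
have null n : P [set w | ~ ok n w] = 0%E.
  have dc : discrete (fun w => (mkseq (fun k => (X k w, (L k w, Rt k w))) n.+1, eta w)).
    by apply: discrete_pair => //; apply: (discrete_mkseq (c := fun k w => (X k w, (L k w, Rt k w)))).
  apply: (null_fibers dc (mok n)) => -[s b].
  pose x0 : int * (ltree * ltree) := (0, (LNode 0 [::], LNode 0 [::])).
  pose xs k := (nth x0 s k).1; pose ls k := (nth x0 s k).2.1; pose rs k := (nth x0 s k).2.2.
  have [okn|nok] := pselect (xs n = root_label (ls n) /\ root_label (rs n) = root_label (ls n)).
    rewrite (_ : _ `&` _ = set0) ?measure0 //; apply/seteqP; split => // w [/= H [es _]].
    by apply: H; move: okn; rewrite /xs /ls /rs -es nth_mkseq.
  apply/eqP; rewrite -measure_le0.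
  rewrite -[leRHS](_ : P (env_cyl X L Rt eta n xs ls rs b) = 0%E); last first.
    rewrite lawP /env_cyl_prob big_ord_recr /= /rho.
    have [e1|e1] := eqVneq (root_label (ls n)) (xs n); last by rewrite mul0r !mulr0.
    have [e2|e2] := eqVneq (root_label (rs n)) (xs n); last by rewrite !mulr0.
    by exfalso; apply: nok; rewrite e1 e2.
  apply: le_measure; rewrite ?inE; [|exact: measurable_env_cyl|].
    by apply: measurableI; [exact: mok|exact: dc].
  move=> w [_ /= [es eb]]; split => // k lek.
  by rewrite /xs /ls /rs -es nth_mkseq.
have : {ae P, forall w, forall n, ok n w}.
  by apply: ae_foralln => n; exists [set w | ~ ok n w]; split; [exact: mok|exact: null|].
by move/negligibleP; apply; exact: measurable_incoherent.
Qed.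

Lemma coherent_env w : coherent w -> lft (env w) = L^~ w /\ rgt (env w) = Rt^~ w.
Proof.
move=> cw; split; first by [].
by apply/funext => n; rewrite /rgt /=; have [_ <-] := cw n; rewrite -ltreeE.
Qed.

(** Translates between prefixes of [env] and the cylinders of the hypotheses. The event [Z] leaves
    room for the history of the walk. *)
Lemma prefix_env_cyl s n b (Z : set Omega) : size s = n.+1 -> measurable Z ->
  P ([set w | prefix_of s (env w)] `&` [set w | eta w = b] `&` Z) =
  P (env_cyl X L Rt eta n (fun k => root_label (nth level0 s k).1)
       (fun k => (nth level0 s k).1)
       (fun k => LNode (root_label (nth level0 s k).1) (nth level0 s k).2) b `&` Z).
Proof.
move=> ss mZ; apply: (eq_measure_mod_null measurable_incoherent _ _ incoherent_null).
- apply: measurableI => //; apply: measurableI; last exact: meta.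
  by exact: measurable_env_prefix.
- by apply: measurableI => //; exact: measurable_env_cyl.
move=> w /contrapT cw; split.
  move=> [[/= /prefix_of_nth ps eb] Zw]; split => //; split => // k lek.
  have [c1 c2] := cw k; have := ps k; rewrite ss ltnS lek => /(_ isT) <- /=.
  by rewrite c1 -c2 -ltreeE.
move=> [[H eb] Zw]; split => //; split => //=; apply/prefix_of_nth => k.
rewrite ss ltnS => /H[_ [eL eR]].
by rewrite /env eL eR /= -surjective_pairing.
Qed.

Lemma prefix_eta_prob s b : s <> [::] ->
  P ([set w | prefix_of s (env w)] `&` [set w | eta w = b]) = (2%:R^-1 * config_w s)%:E.
Proof.
case: s => // x s _; have := @prefix_env_cyl (x :: s) (size s) b setT erefl measurableT.
by rewrite !setIT => ->; rewrite lawP env_cyl_prob_config.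
Qed.

Lemma eta_split (A : set Omega) : measurable A ->
  P A = (P (A `&` [set w | eta w = true]) + P (A `&` [set w | eta w = false]))%E.
Proof.
move=> mA; rewrite -measureU //.
- by congr (P _); apply/seteqP; split => w /=; [case: (eta w); [left|right]|case=> -[]].
- by apply: measurableI => //; exact: meta.
- by apply: measurableI => //; exact: meta.
- by apply/seteqP; split => // w [[_ /= ->] []].
Qed.

Definition law_env : {measure set mconfig -> \bar R} := image_measure P measurable_env.

Lemma config_law_env : config_law law_env.
Proof.
move=> [|x s].
  rewrite -[LHS]/(P [set w | prefix_of [::] (env w)]).
  by rewrite (_ : [set w | _] = setT) ?probability_setT //; apply/seteqP.
rewrite -[LHS]/(P [set w | prefix_of (x :: s) (env w)]) eta_split; last first.
  exact: measurable_env_prefix.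
rewrite !(@prefix_eta_prob (x :: s)) // -EFinD; congr EFin.
by field.
Qed.

Section restricted.
Context (Z : set Omega) (mZ : measurable Z).

(** An unnormalised conditional law of the environment given [Z]: nothing is divided by the mass of
    [Z], which may be 0. *)
Definition law_on : {measure set mconfig -> \bar R} :=
  image_measure (mrestr P mZ) measurable_env.

Lemma law_onE A : law_on A = P ([set w | A (env w)] `&` Z).
Proof. by []. Qed.

Lemma law_on_fin A : measurable A -> law_on A \is a fin_num.
Proof.
move=> mA; rewrite law_onE fin_num_measure //; apply: measurableI => //.
exact: measurable_env_local.
Qed.

End restricted.

(** The empty prefix is excluded from the hypothesis because [env_cyl] always fixes level 0; it is
    recovered by summing over that level. *)
Lemma law_on_unique (Z1 Z2 : set Omega) (m1 : measurable Z1) (m2 : measurable Z2) :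
  (forall s, s <> [::] -> law_on m1 (prefix_of s) = law_on m2 (prefix_of s)) ->
  forall A, measurable A -> law_on m1 A = law_on m2 A.
Proof.
move=> H; apply: measure_config_unique; last first.
  by have := law_on_fin m1 measurableT; rewrite fin_numE => /andP[_]; rewrite ltey.
move=> [|x s]; last exact: H.
apply: (@eq_measure_fibers _ _ _ _ _ (law_on m1) (law_on m2) _ (fun w : mconfig => w 0%N) (fun w : mconfig => w 0%N)).
- exact: discrete_level.
- exact: discrete_level.
- exact: measurable_prefix.
- exact: measurable_prefix.
move=> x; have := H [:: x]; rewrite (_ : prefix_of [::] `&` _ = prefix_of [:: x]); first exact.
by apply/seteqP; split => w /=; tauto.
Qed.

Lemma law_on_eta b A : measurable A -> law_on (meta b) A = ((2%:R^-1)%:E * law_env A)%E.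
Proof.
move=> mA; have e : law_on (meta true) A = law_on (meta false) A.
  by apply: law_on_unique => // s s0; rewrite !law_onE !prefix_eta_prob.
have : law_env A = (law_on (meta true) A + law_on (meta false) A)%E.
  by rewrite !law_onE -eta_split //; exact: measurable_env_local.
have f := law_on_fin (meta false) mA.
have -> : law_on (meta b) A = law_on (meta false) A by case: b.
rewrite e => ->; rewrite -(fineK f) -EFinD -EFinM; congr EFin.
by field.
Qed.

(** * Joint law of the environment and the path of the walk *)

Definition history (p : seq oedge) : set Omega :=
  [set w | forall k, (k < size p)%N -> E k w = nth (0, false) p k].

Lemma measurable_history p : measurable (history p).
Proof. by apply: m_all => k; apply: m_imp; [exact: m_cst|exact: mE]. Qed.

Local Notation law_path p := (law_on (measurable_history p)).

Lemma history_rcons p e :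
  history (rcons p e) = history p `&` [set w | E (size p) w = e].
Proof.
apply/seteqP; split => w /=.
  move=> H; split; last by rewrite (H (size p)) ?size_rcons // nth_rcons ltnn eqxx.
  by move=> k ltk; rewrite H ?size_rcons ?ltnS 1?ltnW // nth_rcons ltk.
move=> [H e0] k; rewrite size_rcons ltnS leq_eqVlt nth_rcons => /predU1P[->|ltk].
  by rewrite ltnn eqxx.
by rewrite ltk H.
Qed.

(** Uniformity is assumed for cylinders intersected with the event that [e1] and [e2] both start at
    the target of the last edge. This event [D] holds throughout [A]; inserting it first yields two
    restricted laws that agree on cylinders, hence on [A]. *)
Lemma law_path_swap p e1 e2 (B : {fset oedge}) (A : set mconfig) : p <> [::] ->
  e1 \in B -> e2 \in B -> measurable A ->
  (forall w, A w -> good w /\ nb w (last (0, false) p) = B) ->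
  law_path (rcons p e1) A = law_path (rcons p e2) A.
Proof.
move=> p0 in1 in2 mA AB; pose x : oedge := last (0, false) p.
pose D : set config := [set w | exists v, wtgt w x v /\ (worg w e1 v /\ worg w e2 v)].
have AD : A `<=` D.
  move=> w /AB[gw nbB]; rewrite -nbB in in1 in2.
  have [v1 [t1 o1]] := iffLR (in_nb x e1 gw) in1.
  have [v2 [t2 o2]] := iffLR (in_nb x e2 gw) in2.
  by exists v1; split => //; split => //; rewrite (tgt_uniq t1 t2).
have mD : measurable (D : set mconfig).
  apply: (@m_ex _ mconfig) => v; apply: (@m_and _ mconfig); last first.
    by apply: (@m_and _ mconfig); exact: measurable_worg.
  rewrite (_ : [set w | _] = [set w | worg w (reve x) v]); first exact: measurable_worg.
  by apply/seteqP; split => w; move/org_reve.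
pose Z e := history p `&` [set w | D (env w)] `&` [set w | E (size p) w = e].
have mZ e : measurable (Z e).
  apply: measurableI; last exact: mE.
  by apply: measurableI; [exact: measurable_history|exact: measurable_env_local].
have onZ e : law_path (rcons p e) A = law_on (mZ e) A.
  rewrite !law_onE history_rcons; congr (P _); apply/seteqP; split => w /=.
    by move=> [Aw [Hw Ew]]; split => //; split => //; split => //; exact: AD.
  by move=> [Aw [[Hw Dw] Ew]].
rewrite !onZ; apply: law_on_unique mA => s s0; rewrite !law_onE.
have ps : (size p).-1.+1 = size p by case: (p) p0.
case: s s0 => // y s _.
have mA' e : measurable ([set w | prefix_of (y :: s) (env w)] `&` Z e).
  by apply: measurableI => //; exact: measurable_env_prefix.
rewrite (eta_split (mA' e1)) (eta_split (mA' e2)).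
have key b : P ([set w | prefix_of (y :: s) (env w)] `&` Z e1 `&` [set w | eta w = b]) =
    P ([set w | prefix_of (y :: s) (env w)] `&` Z e2 `&` [set w | eta w = b]).
  rewrite ![_ `&` Z _ `&` _]setIAC !(@prefix_env_cyl (y :: s) (size s)) //.
  have := @Eunif (size p).-1 (size s) (fun k => root_label (nth level0 (y :: s) k).1)
    (fun k => (nth level0 (y :: s) k).1)
    (fun k => LNode (root_label (nth level0 (y :: s) k).1) (nth level0 (y :: s) k).2)
    b (nth (0, false) p) e1 e2.
  rewrite /= ps nth_last -/x.
  set C := env_cyl _ _ _ _ _ _ _ _ _.
  set H := [set w | forall k, _ -> _]; set D' := [set w | exists v, _] => hyp.
  have side e : P (C `&` Z e) = P (C `&` H `&` D' `&` [set w | E (size p) w = e]).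
    apply: (eq_measure_mod_null measurable_incoherent _ _ incoherent_null).
    - by apply: measurableI => //; exact: measurable_env_cyl.
    - apply: measurableI; last exact: mE.
      apply: measurableI.
        apply: measurableI; first exact: measurable_env_cyl.
        by apply: m_all => k; apply: m_imp; [exact: m_cst|exact: mE].
      apply: m_ex => v; apply: m_and; first exact: measurable_tgt_pair.
      by apply: m_and; exact: measurable_org_pair.
    move=> w /contrapT /coherent_env[eL eR].
    have eH : H w <-> history p w.
      have lt k : (k < size p)%N = (k <= (size p).-1)%N by rewrite -[in RHS]ltnS ps.
      by split=> h k; [rewrite lt => /h|rewrite -lt => /h].
    have eD : D' w <-> D (env w) by rewrite /D' /D /= eL eR.
    by rewrite /Z /setI /=; tauto.
  by rewrite !side.
by rewrite !key.
Qed.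


Definition follows j w := nbr (env w) (E j w) (E j.+1 w).

Lemma measurable_follows j : measurable [set w | ~ follows j w].
Proof.
apply: m_not; apply: (m_fiber (p := fun e w => nbr (env w) e (E j.+1 w)) (mE j)) => e.
apply: (m_fiber (p := fun e' w => nbr (env w) e e') (mE j.+1)) => e'.
exact: (measurable_env_local (measurable_nbr e e')).
Qed.

Lemma not_follows_null j : P [set w | ~ follows j w] = 0%E.
Proof.
rewrite -[RHS](Enext j).
apply: (eq_measure_mod_null measurable_incoherent _ _ incoherent_null).
- exact: measurable_follows.
- apply: m_not; apply: m_ex => v; apply: m_and.
    by apply: (m_fiber (p := fun e w => tgt (L^~ w) (Rt^~ w) e v) (mE j)) => e; exact: measurable_tgt_pair.
  by apply: (m_fiber (p := fun e w => org (L^~ w) (Rt^~ w) e v) (mE j.+1)) => e; exact: measurable_org_pair.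
by move=> w /contrapT /coherent_env[eL eR]; rewrite /follows /nbr /mkset eL eR.
Qed.

Lemma measurable_not_good : measurable [set w | ~ good (env w)].
Proof. by apply: m_not; exact: (measurable_env_local measurable_good). Qed.

Lemma not_good_null : P [set w | ~ good (env w)] = 0%E.
Proof.
have : law_env [set w | ~ good w] = 0%E.
  have := good_ae config_law_env; move/negligibleP; apply.
  by apply: (@m_not _ mconfig); exact: measurable_good.
by [].
Qed.

Lemma step_in_nb p w : p <> [::] -> good (env w) -> follows (size p).-1 w -> history p w ->
  E (size p) w \in nb (env w) (last (0, false) p).
Proof.
move=> p0 gw; have ps : (size p).-1.+1 = size p by case: (p) p0.
rewrite /follows ps => fw hw; apply/in_nb => //.
by rewrite -nth_last -hw // -[in X in (_ < X)%N]ps.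
Qed.

Section step.
Context (p : seq oedge) (p0 : p <> [::]).
Context (B : {fset oedge}) (A : set mconfig) (mA : measurable A).
Context (AB : forall w, A w -> good w /\ nb w (last (0, false) p) = B).

Lemma le_step_sum (M : set Omega) : measurable M ->
  (P ([set w | A (env w)] `&` history p `&` M) <=
   \sum_(e <- B) P ([set w | A (env w)] `&` history (rcons p e) `&` M))%E.
Proof.
move=> mM; have mS : measurable ([set w | A (env w)] `&` history p `&` M).
  apply: measurableI => //; apply: measurableI; last exact: measurable_history.
  exact: (measurable_env_local mA).
rewrite (eq_bigr (fun e => P ([set w | A (env w)] `&` history p `&` M `&`
    [set w | E (size p) w = e]))); last first.
  move=> e _; rewrite history_rcons; congr (P _).
  by apply/seteqP; split => w /=; tauto.
rewrite -(measure_in_seq P (mE (size p)) mS (fset_uniq B)).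
apply: (le_measure_mod_null (measurable_follows (size p).-1)) => //.
- by apply: measurableI => //; exact: (discrete_pred (fun e => e \in B) (mE _)).
- exact: not_follows_null.
move=> w /contrapT fw [[Aw hw] Mw]; split => //=.
have [gw <-] := AB Aw; exact: step_in_nb.
Qed.

(** On [A] the neighbourhood of the last edge is the fixed set [B]. The next edge almost surely lies
    in [B], and by [law_path_swap] its possible values share the mass equally. *)
Lemma law_path_step e C : e \in B -> measurable C -> C `<=` A ->
  law_path (rcons p e) C = ((#|` B|%:R^-1)%:E * law_path p C)%E.
Proof.
move=> eB mC CA.
have CB w : C w -> good w /\ nb w (last (0, false) p) = B by move/CA; exact: AB.
have : law_path p C = (\sum_(e' <- B) law_path (rcons p e') C)%E.
  have mS : measurable ([set w | C (env w)] `&` history p).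
    by apply: measurableI; [exact: (measurable_env_local mC)|exact: measurable_history].
  rewrite (eq_bigr (fun e => P ([set w | C (env w)] `&` history p `&`
      [set w | E (size p) w = e]))); last first.
    by move=> e' _; rewrite law_onE history_rcons setIA.
  rewrite -(measure_in_seq P (mE (size p)) mS (fset_uniq B)).
  rewrite [LHS]law_onE; apply: (eq_measure_mod_null (measurable_follows (size p).-1)) => //.
  - by apply: measurableI => //; exact: (discrete_pred (fun e => e \in B) (mE _)).
  - exact: not_follows_null.
  move=> w /contrapT fw; split; last by case.
  by move=> [Cw hw]; split => //=; have [gw <-] := CB _ Cw; exact: step_in_nb.
rewrite (eq_big_seq (fun=> law_path (rcons p e) C)); last first.
  by move=> e' e'B; exact: (law_path_swap (B := B)).
have := law_on_fin (measurable_history (rcons p e)) mC.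
case: (law_path (rcons p e) C) => // r _.
rewrite sumEFin big_const_seq count_predT iter_addr_0 => ->.
rewrite -EFinM -[r *+ _]mulr_natl mulKf // pnatr_eq0 -lt0n cardfs_gt0.
by apply/fset0Pn; exists e.
Qed.

Lemma integral_step e (f : mconfig -> \bar R) : e \in B -> measurable_fun setT f ->
  (forall w, 0 <= f w)%E ->
  (\int[law_path (rcons p e)]_(w in A) f w =
   (#|` B|%:R^-1)%:E * \int[law_path p]_(w in A) f w)%E.
Proof.
move=> eB mf f0; have k0 : 0 <= #|` B|%:R^-1 :> R by rewrite invr_ge0.
rewrite (@eq_measure_integral _ _ _ A (mscale (NngNum k0) (law_path p))).
  by rewrite ge0_integral_mscale //; exact: measurable_funS mf.
by move=> C mC CA; rewrite law_path_step.
Qed.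

End step.

(** Pathwise counterpart of [g], started at time [j] with the same killing rule. *)
Fixpoint stays s N j (m : int) w : Prop :=
  0 <= m /\ (if N is N'.+1 then stays s N' j.+1 (m - incr s (E j w)) w else True).

Lemma measurable_stays s N j m : measurable [set w | stays s N j m w].
Proof.
elim: N j m => [|N IH] j m; apply: m_and; try exact: m_cst.
by apply: (m_fiber (p := fun e w => stays s N j.+1 (m - incr s e) w) (mE j)) => e; exact: IH.
Qed.

Lemma measurable_g s N m e : measurable_fun setT (fun w : mconfig => (g s N m w e : R)%:E).
Proof. by apply/measurable_EFinP; have [+ _ _] := obs_g (R := R) s N m; apply. Qed.

Lemma g_ge0 s N m w e : (0 <= (g s N m w e : R)%:E)%E.
Proof. by rewrite lee_fin; have /andP[] := g_01 (R := R) s N m w e. Qed.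

(** The Markov property as a one-sided bound. [A] is cut along the neighbourhood [B] of the last
    edge; on each piece the walk extends the path by an edge of [B] with weight 1/#B, as in [Q], and
    the induction hypothesis applies to the longer path. *)
Lemma stays_bound s N p m (A : set mconfig) : p <> [::] -> measurable A ->
  (P ([set w | A (env w)] `&` history p `&` [set w | stays s N (size p).-1 m w]) <=
   \int[law_path p]_(w in A) (g s N m w (last (0, false) p))%:E)%E.
Proof.
elim: N p m A => [|N IH] p m A p0 mA; have mA' := measurable_env_local mA.
  have [m0|m0] := boolP (0 <= m); last first.
    rewrite (_ : _ `&` _ = set0) ?measure0; last first.
      by apply/seteqP; split => // w [_ [/= h]]; rewrite h in m0.
    by apply: integral_ge0 => w _; exact: g_ge0.
  rewrite (eq_integral (fun=> 1%:E)); last by move=> w _; rewrite /g /= m0.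
  rewrite integral_cst // mul1e law_onE; apply: le_measure; rewrite ?inE.
  - apply: measurableI; last exact: measurable_stays.
    by apply: measurableI => //; exact: measurable_history.
  - by apply: measurableI => //; exact: measurable_history.
  - by move=> w [].
have [m0|m0] := boolP (0 <= m); last first.
  rewrite (_ : _ `&` _ = set0) ?measure0; last first.
    by apply/seteqP; split => // w [_ [/= h]]; rewrite h in m0.
  by apply: integral_ge0 => w _; exact: g_ge0.
pose x : oedge := last (0, false) p; rewrite -/x.
have ps : (size p).-1.+1 = size p by case: (p) p0.
have mS := measurable_stays s N.+1 (size p).-1 m.
set S := [set w | stays _ _ _ _ _] in mS *.
have mAS : measurable ([set w | A (env w)] `&` history p `&` S).
  by apply: measurableI => //; apply: measurableI => //; exact: measurable_history.
have dnb : discrete (fun w => nb (env w) x).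
  by move=> B; exact: (measurable_env_local (discrete_nb x B)).
rewrite (measure_fibers P dnb mAS).
rewrite (integral_fibers _ (discrete_nb x) mA); first last.
- by move=> w; exact: g_ge0.
- by apply: measurable_funS (measurable_g s N.+1 m x).
apply: lee_nneseries => n _ //; rewrite !setI_fiberE.
case: pickle_inv => [B|]; last by rewrite measure0 integral_set0.
pose A2 : set mconfig := A `&` [set w | nb w x = B] `&` [set w | good w].
have mA1 : measurable (A `&` [set w : mconfig | nb w x = B]).
  by apply: measurableI => //; exact: (discrete_nb x B).
have mA2 : measurable A2 by apply: measurableI => //; exact: measurable_good.
have A2B w : A2 w -> good w /\ nb w (last (0, false) p) = B by case=> -[].
(* Restricting to good configurations loses a null event and makes [B] the actual set of neighbours
   instead of a default value. *)
apply: (@le_trans _ _ (P ([set w | A2 (env w)] `&` history p `&` S))).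
  apply: (le_measure_mod_null measurable_not_good _ _ not_good_null).
  - by apply: measurableI => //; exact: dnb.
  - apply: measurableI => //; apply: measurableI; last exact: measurable_history.
    exact: (measurable_env_local mA2).
  by move=> w /contrapT gw [[[Aw hw] Sw] /= nw].
apply: (le_trans (le_step_sum p0 mA2 A2B mS)).
apply: (@le_trans _ _ (\sum_(e <- B) (#|` B|%:R^-1)%:E *
    \int[law_path p]_(w in A2) (g s N (m - incr s x) w e : R)%:E)%E).
  rewrite big_seq [leRHS]big_seq; apply: lee_sum => e eB.
  rewrite -(integral_step p0 mA2 A2B eB (measurable_g _ _ _ _)); last by move=> w; exact: g_ge0.
  have p1 : rcons p e <> [::] by case: (p).
  have := IH (rcons p e) (m - incr s x) A2 p1 mA2.
  rewrite last_rcons size_rcons /=; apply: le_trans.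
  apply: le_measure; rewrite ?inE.
  - apply: measurableI => //; apply: measurableI; last exact: measurable_history.
    exact: (measurable_env_local mA2).
  - apply: measurableI; last exact: measurable_stays.
    apply: measurableI; last exact: measurable_history.
    exact: (measurable_env_local mA2).
  move=> w [[A2w hw] [_ /= Sw]]; split => //=.
  move: Sw; rewrite ps hw ?size_rcons; last by lia.
  by rewrite nth_rcons -[in X in (_ < X)%N]ps ltnS leqnn nth_last.
rewrite (eq_bigr (fun e => \int[law_path p]_(w in A2)
    ((#|` B|%:R^-1)%:E * (g s N (m - incr s x) w e : R)%:E)))%E; last first.
  move=> e _; rewrite ge0_integralZl ?lee_fin ?invr_ge0 //.
    exact: measurable_funS (measurable_g _ _ _ _).
  by move=> w _; exact: g_ge0.
rewrite -ge0_integral_sum //; last first.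
- by move=> e w _; apply: mule_ge0; [rewrite lee_fin invr_ge0|exact: g_ge0].
- move=> e; apply: emeasurable_funM; first exact: measurable_cst.
  exact: measurable_funS (measurable_g _ _ _ _).
rewrite (eq_integral (fun w : mconfig => (g s N.+1 m w x : R)%:E)); last first.
  move=> w /set_mem[[_ /= nw] _]; rewrite gE m0 /Q nw.
  under eq_bigr do rewrite -EFinM.
  by rewrite sumEFin -mulr_sumr mulrC.
apply: ge0_subset_integral => //.
- by apply: measurable_funS (measurable_g _ _ _ _).
- by move=> w _; exact: g_ge0.
- by move=> w [].
Qed.

(** The two values of [eta] are independent of the environment and produce the two halves of
    [at_root]. *)
Lemma stays_root s N m :
  (P [set w | stays s N 0 m w] <= (Eroot law_env (g s N m))%:E)%E.
Proof.
have half b : (P ([set w | stays s N 0 m w] `&` [set w | eta w = b]) <=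
    (2%:R^-1)%:E * \int[law_env]_w (g s N m w (0, b) : R)%:E)%E.
  have -> : [set w | stays s N 0 m w] `&` [set w | eta w = b] =
      [set w | [set: config] (env w)] `&` history [:: (0, b)] `&` [set w | stays s N 0 m w].
    apply/seteqP; split => w /=.
      by move=> [Sw eb]; split => //; split => // -[|k] //= _; rewrite E0 eb.
    by move=> [[_ /(_ 0%N isT)]]; rewrite E0 /= => -[].
  have p0 : [:: (0, b)] <> [::] :> seq oedge by [].
  apply: (le_trans (@stays_bound s N _ m [set: mconfig] p0 measurableT)).
  have k0 : 0 <= 2%:R^-1 :> R by rewrite invr_ge0.
  rewrite (@eq_measure_integral _ _ _ setT (mscale (NngNum k0) law_env)).
    rewrite ge0_integral_mscale //; first exact: measurable_g.
    by move=> w _; exact: g_ge0.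
  move=> C mC _; rewrite -[RHS](law_on_eta b mC) !law_onE; congr (P _).
  apply/seteqP; split => w /= [Cw]; first by move=> /(_ 0%N isT); rewrite E0 /= => -[].
  by move=> eb; split => // -[|k] //= _; rewrite E0 eb.
rewrite (eta_split (measurable_stays s N 0 m)).
apply: (le_trans (leeD (half true) (half false))).
have bg b : bm (fun w : mconfig => g s N m w (0, b) : R).
  by apply: bm01 => [|w]; [have [+ _ _] := obs_g (R := R) s N m; apply|exact: g_01].
have law1 : law_env setT = 1%E := config_law_setT config_law_env.
rewrite -!Ex_EFin // -!EFinM -EFinD lee_fin /Eroot /at_root ExZ ?ExD //; last exact: bmD.
by rewrite mulrDr addrC.
Qed.

Lemma stays_null s m : P [set w | forall N, stays s N 0 m w] = 0%E.
Proof.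
set A := [set w | _]; have mA : measurable A.
  by apply: m_all => N; exact: measurable_stays.
have cv := Eroot_g_cvg0 config_law_env s m.
have : fine (P A) <= 0.
  rewrite -(cvg_lim _ cv) //.
  apply: limr_ge; first by apply/cvg_ex; exists 0; exact: cv.
  apply: nearW => N; rewrite -lee_fin fineK ?fin_num_measure //.
  apply: le_trans (stays_root s N m); apply: le_measure; rewrite ?inE //.
    exact: measurable_stays.
  by move=> w /(_ N).
by rewrite -lee_fin fineK ?fin_num_measure // measure_le0 => /eqP.
Qed.

Lemma stays_of_le s N j (m : int) w (x : nat -> int) :
  (forall k, x k.+1 = x k + incr s (E k w)) -> (forall n, x (j + n)%N <= x j + m) ->
  stays s N j m w.
Proof.
move=> xS; elim: N j m => [|N IH] j m xm.
  by split => //; have := xm 0%N; rewrite addn0; lia.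
split; first by have := xm 0%N; rewrite addn0; lia.
apply: IH => n; rewrite addSnnS; apply: le_trans (xm n.+1) _.
by rewrite xS; lia.
Qed.

Lemma label_recurrent : {ae P, forall w, forall (z : int) (n : nat),
  exists m, (n <= m)%N /\ olab (L^~ w) (Rt^~ w) (E m w) = z}.
Proof.
have ae1 : {ae P, forall w, coherent w}.
  by exists [set w | ~ coherent w]; split => //; [exact: measurable_incoherent|exact: incoherent_null].
have ae2 : {ae P, forall w, forall j, follows j w}.
  apply: ae_foralln => j; exists [set w | ~ follows j w].
  by split => //; [exact: measurable_follows|exact: not_follows_null].
have ae3 s : {ae P, forall w, forall m : nat, ~ forall N, stays s N 0 m w}.
  apply: ae_foralln => m; exists [set w | forall N, stays s N 0 m w].
  split; [|exact: stays_null|by move=> w /= /contrapT].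
  by apply: m_all => N; exact: measurable_stays.
have F := ae_filter_ringOfSetsType P.
have : \forall w \ae P, (coherent w /\ (forall j, follows j w)) /\
    ((forall m : nat, ~ forall N, stays false N 0 m w) /\
     (forall m : nat, ~ forall N, stays true N 0 m w)).
  exact: (@filterI _ _ F _ _ (@filterI _ _ F _ _ ae1 ae2)
    (@filterI _ _ F _ _ (ae3 false) (ae3 true))).
apply: (@filterS _ _ F) => w [[cw fw] [up down]].
have [eL eR] := coherent_env cw.
pose x k := olab (L^~ w) (Rt^~ w) (E k w).
have xS k : x k.+1 = x k + incr false (E k w).
  have := nbr_olab (fw k); rewrite eL eR /x => ->.
  by rewrite /incr; case: (E k w) => i [].
apply: (@walk_visits x).
- by move=> k; rewrite xS addrAC addrN add0r /incr; case: (_ (+) _).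
(* If the labels never exceed [m], then S never exceeds the natural number [|m - x 0|],
   contradicting [up]. The next bullet treats the labels with opposite sign. *)
- move=> m; apply: contrapT => H; apply: (up `|m - x 0%N|%N) => N.
  apply: (@stays_of_le false _ _ _ _ x) => // n; rewrite add0n.
  have : x n <= m by rewrite leNgt; apply/negP => lt; apply: H; exists n.
  by lia.
- move=> m; apply: contrapT => H; apply: (down `|x 0%N - m|%N) => N.
  apply: (@stays_of_le true _ _ _ _ (fun k => - x k)) => [k|n].
    by rewrite xS /incr; case: (E k w) => i [] /=; lia.
  have : m <= x n by rewrite leNgt; apply/negP => lt; apply: H; exists n.
  by rewrite add0n; lia.
Qed.

End link.

Local Open Scope ring_scope.

Theorem theorem7 (R : realType) (d : measure_display) (Omega : measurableType d)
  (P : probability Omega R)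
  (X : nat -> Omega -> int) (L Rt : nat -> Omega -> ltree) (eta : Omega -> bool)
  (E : nat -> Omega -> oedge) :
  (* measurability of the random variables *)
  (forall n x, measurable [set w | X n w = x]) ->
  (forall n t, measurable [set w | L n w = t]) ->
  (forall n t, measurable [set w | Rt n w = t]) ->
  (forall b, measurable [set w | eta w = b]) ->
  (forall j e, measurable [set w | E j w = e]) ->
  (* ((T_infty, l), eta) has law mu (x) Bernoulli(1/2) *)
  (forall N xs ls rs b,
     P (env_cyl X L Rt eta N xs ls rs b) = (env_cyl_prob R N xs ls rs)%:E) ->
  (* E_0 = e^*, the arc from c_0 to its successor, reversed iff eta = 1 *)
  (forall w, E 0%N w = (0%Z, eta w)) ->
  (* a.s. the origin of E_{j+1} is the target of E_j *)
  (forall j, P [set w | ~ exists v, tgt (L^~ w) (Rt^~ w) (E j w) v /\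
                                    org (L^~ w) (Rt^~ w) (E j.+1 w) v] = 0%E) ->
  (* conditionally on Q_infty and E_0..E_j, E_{j+1} gives equal mass to all
     oriented edges with origin the target of E_j *)
  (forall j N xs ls rs b (path : nat -> oedge) (e e' : oedge),
     let C := env_cyl X L Rt eta N xs ls rs b `&`
              [set w | forall k, (k <= j)%N -> E k w = path k] in
     let D := [set w | exists v, tgt (L^~ w) (Rt^~ w) (path j) v /\
                                 org (L^~ w) (Rt^~ w) e v /\
                                 org (L^~ w) (Rt^~ w) e' v] in
     P (C `&` D `&` [set w | E j.+1 w = e]) =
     P (C `&` D `&` [set w | E j.+1 w = e'])) ->
  (* almost surely the label process l(X_n) visits every integer i.o. *)
  {ae P, forall w, forall (z : int) (n : nat),
     exists m, (n <= m)%N /\ olab (L^~ w) (Rt^~ w) (E m w) = z}.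
Proof.
move=> mX mL mRt meta mE lawP E0 Enext Eunif.
exact: (@label_recurrent R d Omega P X L Rt eta E).
Qed.
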